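(* Let $\Gamma$ be a fixed sentence of the two-variable fragment of first-order logic (only variables $x,y$) which may additionally contain finitely many counting quantifiers $\exists_{=k_1},\dots,\exists_{=k_m}$ (with fixed natural numbers $k_1,\dots,k_m$). Then computing $\mathrm{WFOMC}(\Gamma,w,\overline{w},\Delta)$ is domain-liftable, i.e. there is an algorithm that, given a finite domain $\Delta$ and rational weight functions $w,\overline{w}$ on the predicates, computes $\mathrm{WFOMC}(\Gamma,w,\overline{w},\Delta)$ in time polynomial in $|\Delta|$ and in the number of bits needed to encode the weights.
   Context: Fix a function-free first-order language with a finite set $\mathcal{R}$ of predicates. A domain $\Delta$ is a finite set of constants. A possible world $\omega$ on $\Delta$ is a set of ground atoms $R(t_1,\dots,t_{\mathrm{arity}(R)})$ with $R\in\mathcal{R}$, $t_i\in\Delta$; $\Omega_\Delta$ is the set of all possible worlds on $\Delta$. $N(R,\omega)$ is the number of ground atoms of $R$ in $\omega$. For weight functions $w,\overline{w}:\mathcal{R}\to\mathbb{Q}$, a sentence $\Gamma$ and a set $\Omega$ of possible worlds on $\Delta$, $\mathrm{WFOMC}(\Gamma,w,\overline{w},\Omega)=\sum_{\omega\in\Omega,\,\omega\models\Gamma}\prod_{R\in\mathcal{R}} w(R)^{N(R,\omega)}\overline{w}(R)^{|\Delta|^{\mathrm{arity}(R)}-N(R,\omega)}$ and $\mathrm{WFOMC}(\Gamma,w,\overline{w},\Delta):=\mathrm{WFOMC}(\Gamma,w,\overline{w},\Omega_\Delta)$. The counting quantifier $\exists_{=k}x\,\psi(x)$ holds in $\omega$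 iff there are exactly $k$ distinct $t\in\Delta$ with $\omega\models\psi(t)$. *)

(* Defs.v *)
From HB Require Import structures.
From mathcomp Require Import all_boot all_order all_algebra.
Set Implicit Arguments. Unset Strict Implicit. Unset Printing Implicit Defensive.
Import Order.TTheory GRing.Theory Num.Theory.

Definition var := bool.
Definition vx : var := false.
Definition vy : var := true.

Inductive c2form (P : Type) (ar : P -> nat) : Type :=
  | FAtom (R : P) (args : (ar R).-tuple var)
  | FEq (u v : var)
  | FNeg (f : c2form ar)
  | FAnd (f g : c2form ar)
  | FEx (v : var) (f : c2form ar)
  | FCnt (k : nat) (v : var) (f : c2form ar).

Section Semantics.
Variables (P : finType) (ar : P -> nat).

Definition gatom (n : nat) : finType := {R : P & (ar R).-tuple 'I_n}.

Definition world (n : nat) := {set gatom n}.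

Definition upd n (env : var -> option 'I_n) (v : var) (o : option 'I_n) :=
  fun u => if u == v then o else env u.

Fixpoint sat n (om : world n) (env : var -> option 'I_n) (f : c2form ar) : bool :=
  match f with
  | FAtom R a =>
      match (insub (pmap id (map env a)) : option ((ar R).-tuple 'I_n)) with
      | Some t => (Tagged (fun R => (ar R).-tuple 'I_n) t : gatom n) \in om
      | None => false
      end
  | FEq u v => match env u, env v with
               | Some a, Some b => a == b
               | _, _ => false
               end
  | FNeg g => ~~ sat om env g
  | FAnd g h => sat om env g && sat om env h
  | FEx v g => [exists t : 'I_n, sat om (upd env v (Some t)) g]
  | FCnt k v g => #|[pred t : 'I_n | sat om (upd env v (Some t)) g]| == k
  end.

Fixpoint closed_under (bnd : var -> bool) (f : c2form ar) : bool :=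
  match f with
  | FAtom _ a => all bnd a
  | FEq u v => bnd u && bnd v
  | FNeg g => closed_under bnd g
  | FAnd g h => closed_under bnd g && closed_under bnd h
  | FEx v g => closed_under (fun u => (u == v) || bnd u) g
  | FCnt _ v g => closed_under (fun u => (u == v) || bnd u) g
  end.

Definition sentence (f : c2form ar) : bool := closed_under (fun _ => false) f.

Definition models n (om : world n) (f : c2form ar) : bool :=
  sat om (fun _ => None) f.

Definition Ncount n (R : P) (om : world n) : nat :=
  #|[set a in om | tag a == R]|.

Definition WFOMC (Gamma : c2form ar) (w wb : P -> rat) (n : nat) : rat :=
  \sum_(om : world n | models om Gamma)
     \prod_(R : P) (w R ^+ Ncount R om * wb R ^+ (n ^ ar R - Ncount R om)).

End Semantics.

(* Machine model: deterministic single-tape Turing machines over the   *)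
(* tape alphabet {0,1,blank} (blank = None).                           *)
Definition sym := option bool.
Inductive move := MoveL | MoveR | Stay.

Record TM := mkTM {
  tm_q : nat;  (* states are 'I_(tm_q.+1); start state ord0 *)
  tm_delta : 'I_tm_q.+1 -> sym -> option ('I_tm_q.+1 * sym * move)
  (* None = halt *)
}.

(* configuration: state, left part (reversed), head symbol, right part *)
Definition config (M : TM) := ('I_(tm_q M).+1 * seq sym * sym * seq sym)%type.

Definition tm_step (M : TM) (c : config M) : config M :=
  let: (q, l, h, r) := c in
  match tm_delta q h with
  | None => c
  | Some (q', s, MoveL) =>
      match l with
      | [::] => (q', [::], None, s :: r)
      | x :: l' => (q', l', x, s :: r)
      end
  | Some (q', s, MoveR) =>
      match r with
      | [::] => (q', s :: l, None, [::])
      | x :: r' => (q', s :: l, x, r')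
      end
  | Some (q', s, Stay) => (q', l, s, r)
  end.

Definition tm_halted (M : TM) (c : config M) : bool :=
  let: (q, _, h, _) := c in
  if tm_delta q h is None then true else false.

Definition tm_init (M : TM) (inp : seq bool) : config M :=
  match map Some inp with
  | [::] => (ord0, [::], None, [::])
  | x :: r => (ord0, [::], x, r)
  end.

Definition tm_run (M : TM) (t : nat) (c : config M) : config M :=
  iter t (@tm_step M) c.

Definition tm_output (M : TM) (c : config M) : seq bool :=
  let: (_, _, h, r) := c in
  let s := h :: r in pmap id (take (find (pred1 None) s) s).

Definition tm_computes (M : TM) (t : nat) (inp out : seq bool) : bool :=
  let c := tm_run t (tm_init M inp) in tm_halted c && (tm_output c == out).

Fixpoint bits_aux (fuel n : nat) : seq bool :=
  match fuel with
  | 0 => [::]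
  | f.+1 => if n == 0 then [::] else odd n :: bits_aux f n./2
  end.
Definition bits (n : nat) : seq bool := bits_aux n n.

(* self-delimiting binary encoding of a natural number *)
Definition enc_nat (n : nat) : seq bool :=
  flatten [seq [:: true; b] | b <- bits n] ++ [:: false; false].

Definition enc_int (z : int) : seq bool := (z < 0)%R :: enc_nat `|z|%N.

Definition enc_rat (q : rat) : seq bool :=
  enc_int (numq q) ++ enc_nat `|denq q|%N.

(* An instance: the domain size |Delta| = n (in unary, the domain being
   given as a list of n constants) followed by the weights w(R), wbar(R)
   for the predicates R in the fixed enumeration of P. *)
Definition enc_instance (P : finType) (n : nat) (w wb : P -> rat) : seq bool :=
  nseq n true ++ [:: false] ++
  flatten [seq enc_rat (w R) ++ enc_rat (wb R) | R <- enum P].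

(* Main.v *)
Require Import Defs.
From mathcomp Require Import all_boot all_order all_algebra.
From mathcomp Require Import zify ring.
From Stdlib Require Import FunctionalExtensionality.

(** Add the elements of the domain one at a time, letting each new element meet the earlier ones.
    Extend a world by a guess, for every quantified subformula and every value of its free
    variable, of its truth value; subformulas are then evaluated on single pairs of elements by
    looking guesses up. Give every element the state consisting of its 1-type (with its guesses)
    and of the number of witnesses seen so far for each quantified subformula, capped beyond the
    largest [k_i]. At the end the counters certify the guesses, and exactly one guess per world
    survives, so that no weight is counted twice. The value of a configuration depends only on
    the multiset of states, and there are polynomially many multisets; atoms with at least three
    distinct constants contribute a constant factor. To bound the time on an actual Turing
    machine, polynomial-time functions on binary trees are closed under composition, case
    distinction and size-bounded iteration: each is computed by a program over five stacks, all
    of which are stored on the single tape. *)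

Set Implicit Arguments. Unset Strict Implicit. Unset Printing Implicit Defensive.

(** * Turing machine fragments *)

(** With only two variables, a quantified subformula has at most one free variable, so its truth is
    a unary predicate of the elements; this is why guesses per element suffice, however deep the
    nesting. States have to come from a set that does not depend on the domain: hence the capped
    counters, and hence a number of multisets that is polynomial with the number of states as
    exponent. Functions on this finite set are not programmed but wired into the machine by case
    distinction. The danger in an iterated polynomial-time function is the growth of intermediate
    values, so every iteration comes with a bound on their sizes. Sums of fractions would make
    denominators hard to control; therefore the weights are first multiplied by a common
    denominator, the recursion runs on integers (as differences of natural numbers, which avoids
    signs), and only the final value is divided and reduced. The empty domain has no element at
    which a verdict could be checked and gets its value separately. *)

Definition tape := nat -> sym.
Definition wr (t : tape) p s : tape := fun i => if i == p then s else t i.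
Definition okm m p := if m is MoveL then 0 < p else true.
Definition mv p m := match m with MoveL => p.-1 | MoveR => p.+1 | Stay => p end.

Lemma wr_id t p : wr t p (t p) = t.
Proof. by apply: functional_extensionality => i; rewrite /wr; case: eqP => [->|]. Qed.

(* A transition to [inr e] leaves the fragment with result [e]. The cells are numbered by [nat],
   so runs carry the proof [okm] that the head never moves left from cell 0. *)
Record frag (E : finType) := Frag {
  fq : finType; f0 : fq; fd : fq -> sym -> (fq + E) * sym * move }.

Inductive runs (E : finType) (f : frag E) :
    fq f -> tape -> nat -> E -> tape -> nat -> nat -> Prop :=
| runs_exit q t p e s m : fd q (t p) = (inr e, s, m) -> okm m p ->
    runs q t p e (wr t p s) (mv p m) 1
| runs_step q t p q' s m e t' p' k : fd q (t p) = (inl q', s, m) -> okm m p ->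
    runs q' (wr t p s) (mv p m) e t' p' k -> runs q t p e t' p' k.+1.

Definition exits E (f : frag E) t p e t' p' N :=
  exists2 k, k <= N & runs (f0 f) t p e t' p' k.

Lemma exits_le E (f : frag E) t p e t' p' N N' :
  N <= N' -> exits f t p e t' p' N -> exits f t p e t' p' N'.
Proof. by move=> le [k lek r]; exists k => //; apply: leq_trans le. Qed.

Definition prim (E : finType) (g : sym -> E * sym * move) : frag E :=
  @Frag E unit tt (fun _ s => let: (e, s', m) := g s in (inr e, s', m)).

Lemma exits_prim (E : finType) (g : sym -> E * sym * move) t p e s m :
  g (t p) = (e, s, m) -> okm m p -> exits (prim g) t p e (wr t p s) (mv p m) 1.
Proof. by move=> eg ok; exists 1 => //; apply: runs_exit => //=; rewrite eg. Qed.

(** The exit value of [f] selects the fragment that continues: what was read from the tape is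
    remembered in the finite control. The last step of [f] already enters [g e], so running times
    simply add. *)
Definition bind (E E' : finType) (f : frag E) (g : E -> frag E') : frag E' :=
  @Frag E' (fq f + {e : E & fq (g e)})%type (inl (f0 f))
   (fun q s => match q with
     | inl q => let: (o, s', m) := fd q s in
        (inl (match o with inl q' => inl q'
              | inr e => inr (Tagged (fun e => fq (g e)) (f0 (g e))) end), s', m)
     | inr u => let: (o, s', m) := fd (tagged u) s in
        (match o with inl q' => inl (inr (Tagged (fun e => fq (g e)) q'))
         | inr e => inr e end, s', m)
     end).

Lemma runs_bind2 (E E' : finType) (f : frag E) (g : E -> frag E') e q t p e' t' p' k :
  runs q t p e' t' p' k ->
  @runs _ (bind f g) (inr (Tagged (fun e => fq (g e)) (q : fq (g e)))) t p e' t' p' k.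
Proof.
elim=> {q t p e' t' p' k} [q t p e' s m E1 ok|q t p q' s m e' t' p' k E1 ok _ IH].
  by apply: runs_exit => //=; rewrite E1.
by apply: (runs_step _ ok IH) => /=; rewrite E1.
Qed.

Lemma runs_bind (E E' : finType) (f : frag E) (g : E -> frag E') q t p e t1 p1 k1 e' t' p' k2 :
  runs q t p e t1 p1 k1 -> runs (f0 (g e)) t1 p1 e' t' p' k2 ->
  @runs _ (bind f g) (inl q) t p e' t' p' (k1 + k2).
Proof.
elim=> {q t p e t1 p1 k1} [q t p e s m E1 ok|q t p q' s m e t1 p1 k E1 ok _ IH] r.
  by rewrite add1n; apply: (runs_step _ ok (runs_bind2 f (g := g) r)) => /=; rewrite E1.
by rewrite addSn; apply: (runs_step _ ok (IH r)) => /=; rewrite E1.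
Qed.

Lemma exits_bind (E E' : finType) (f : frag E) (g : E -> frag E') t p e t1 p1 N1 e' t' p' N2 :
  exits f t p e t1 p1 N1 -> exits (g e) t1 p1 e' t' p' N2 ->
  exits (bind f g) t p e' t' p' (N1 + N2).
Proof.
move=> [k le1 r1] [k' le2 r2]; exists (k + k'); first exact: leq_add.
exact: runs_bind r1 r2.
Qed.

Definition loop (E : finType) (f : frag (option E)) : frag E :=
  @Frag E (fq f) (f0 f) (fun q s => let: (o, s', m) := fd q s in
    (match o with inl q' => inl q' | inr None => inl (f0 f) | inr (Some e) => inr e end, s', m)).

Lemma exits_loop_end (E : finType) (f : frag (option E)) t p e t' p' N :
  exits f t p (Some e) t' p' N -> exits (loop f) t p e t' p' N.
Proof.
move=> [k le r]; exists k => // {le}.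
suff: forall q o, runs q t p o t' p' k -> o = Some e -> @runs _ (loop f) q t p e t' p' k.
  by move=> H; apply: (H _ _ r).
move=> q o; elim=> {q t p o t' p' k r} [q t p o s m E1 ok eo|q t p q' s m o t' p' k E1 ok _ IH eo].
  by apply: runs_exit => //=; rewrite E1 eo.
by apply: (runs_step _ ok (IH eo)) => /=; rewrite E1.
Qed.

Lemma exits_loop (E : finType) (f : frag (option E)) t p t1 p1 N1 e t' p' N2 :
  exits f t p None t1 p1 N1 -> exits (loop f) t1 p1 e t' p' N2 ->
  exits (loop f) t p e t' p' (N1 + N2).
Proof.
move=> [k le r] [k' le' r']; exists (k + k'); first exact: leq_add.
move: {le le'} r'.
suff: forall q o, runs q t p o t1 p1 k -> o = None ->
  @runs _ (loop f) (f0 f) t1 p1 e t' p' k' -> @runs _ (loop f) q t p e t' p' (k + k').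
  by move=> H; apply: (H _ _ r).
move=> q o; elim=> {q t p o t1 p1 k r} [q t p o s m E1 ok eo|q t p q' s m o t1 p1 k E1 ok _ IH eo] r.
  by rewrite add1n; apply: (runs_step _ ok r) => /=; rewrite E1 eo.
by rewrite addSn; apply: (runs_step _ ok (IH eo r)) => /=; rewrite E1.
Qed.

Definition ret (E : finType) (e : E) : frag E := prim (fun s => (e, s, Stay)).
Lemma exits_ret (E : finType) (e : E) t p : exits (ret e) t p e t p 1.
Proof. by rewrite -{2}(wr_id t p); apply: (@exits_prim _ _ t p e (t p) Stay). Qed.

Definition rd : frag (option bool) := prim (fun s => (s, s, Stay)).
Lemma exits_rd t p : exits rd t p (t p) t p 1.
Proof. by rewrite -{3}(wr_id t p); apply: (@exits_prim _ _ t p (t p) (t p) Stay). Qed.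

Definition wrt s : frag unit := prim (fun _ => (tt, s, Stay)).
Lemma exits_wrt s t p : exits (wrt s) t p tt (wr t p s) p 1.
Proof. exact: (@exits_prim _ _ t p tt s Stay). Qed.

Fixpoint gom (ms : seq move) : frag unit :=
  if ms is m :: ms' then bind (prim (fun s => (tt, s, m))) (fun _ => gom ms') else ret tt.

Fixpoint okms p ms := if ms is m :: ms' then okm m p && okms (mv p m) ms' else true.

Lemma exits_gom ms t p : okms p ms -> exits (gom ms) t p tt t (foldl mv p ms) (size ms).+1.
Proof.
elim: ms p => [|m ms IH] p /=; first by move=> _; apply: exits_ret.
case/andP=> ok oks; rewrite -[(size ms).+2]add1n.
have := @exits_prim unit (fun s => (tt, s, m)) t p tt (t p) m erefl ok.
by rewrite wr_id => r; apply: exits_bind r (IH _ oks).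
Qed.

Lemma okms_nseqL p n : n <= p -> okms p (nseq n MoveL).
Proof. by elim: n p => //= n IH p le; rewrite IH ?andbT; lia. Qed.
Lemma mv_nseqL p n : foldl mv p (nseq n MoveL) = p - n.
Proof. by elim: n p => [|n IH] p /=; rewrite ?IH; lia. Qed.

(* Five stacks, each listed top first. [RL] occupies the cells to the left of the home cell, with its top leftmost;
   it holds the input at the start and the output at the end. The others occupy the tracks
   1..4 of the blocks of width 5 to the right of home, with the top rightmost; track 0 of the
   first block is home and is the only nonblank cell of track 0. *)
Inductive reg := RL | RX | RY | RZ | RC.
Record store := Store { gL : seq bool; gX : seq bool; gY : seq bool; gZ : seq bool; gC : seq bool }.

Definition get s r := match r with
  RL => gL s | RX => gX s | RY => gY s | RZ => gZ s | RC => gC s end.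
Definition set s r v := match r with
  | RL => Store v (gX s) (gY s) (gZ s) (gC s)
  | RX => Store (gL s) v (gY s) (gZ s) (gC s)
  | RY => Store (gL s) (gX s) v (gZ s) (gC s)
  | RZ => Store (gL s) (gX s) (gY s) v (gC s)
  | RC => Store (gL s) (gX s) (gY s) (gZ s) v end.

Definition trk i s := match i with
  1 => gX s | 2 => gY s | 3 => gZ s | _ => gC s end.
Definition off r := match r with RL => 0 | RX => 1 | RY => 2 | RZ => 3 | RC => 4 end.

(** [RL] has its bottom at [base - 2]. The cell [base.-1] stays blank, as a stop for scans that
    return from [RL]. *)
Definition tp base s : tape := fun p =>
  if p < base then (if p == base.-1 then None else onth (rev (gL s)) (base - 2 - p))
  else let d := p - base in
    if d %% 5 == 0 then (if d == 0 then Some true else None)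
    else onth (rev (trk (d %% 5) s)) (d %/ 5).

Definition adr base r j := if r is RL then base - 2 - j else base + 5 * j + off r.
(** Subtraction truncates at 0; under this bound [base - 2 - j] is the intended cell. *)
Definition roomy base r j := if r is RL then j + 2 <= base else true.

Lemma tp_adr base s r j : roomy base r j -> tp base s (adr base r j) = onth (rev (get s r)) j.
Proof.
rewrite /tp; case: r => /= le.
- have -> : base - 2 - j < base by lia.
  have -> : (base - 2 - j == base.-1) = false by lia.
  by have -> : base - 2 - (base - 2 - j) = j by lia.
all: rewrite ifF; last by apply/negbTE; rewrite -leqNgt -addnA leq_addr.
all: rewrite -addnA [base + _]addnC addnK mulnC modnMDl divnMDl //= addn0 //.
Qed.

Lemma wr_ext t p s t' : t' p = s -> (forall i, i <> p -> t' i = t i) -> wr t p s = t'.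
Proof.
by move=> e1 e2; apply: functional_extensionality => i; rewrite /wr; case: eqP => [->|/e2].
Qed.

Lemma get_set s r v : get (set s r v) r = v. Proof. by case: r. Qed.

Lemma mod5 d : d %% 5 = 0 \/ d %% 5 = 1 \/ d %% 5 = 2 \/ d %% 5 = 3 \/ d %% 5 = 4.
Proof.
have: d %% 5 < 5 by rewrite ltn_mod.
by case: (d %% 5) => [|[|[|[|[|//]]]]] _; auto 6.
Qed.

Lemma tp_set base s r v p : p <> base.-1 \/ r <> RL ->
  (forall j, roomy base r j -> p = adr base r j -> onth (rev v) j = onth (rev (get s r)) j) ->
  tp base (set s r v) p = tp base s p.
Proof.
move=> hp H; rewrite /tp; case: ltnP => lt.
  case: eqP => // ne; case: r hp H => //= hp; apply; lia.
have := divn_eq (p - base) 5; have := mod5 (p - base).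
move: (_ %/ 5) (_ %% 5) => q m.
case: r {hp} H => /= H //; case=> [|[|[|[|]]]] -> //= ed; apply: H => //; lia.
Qed.

Lemma onth_rcons (T : Type) (s : seq T) x i :
  onth (rcons s x) i = if i < size s then onth s i else if i == size s then Some x else None.
Proof. by elim: s i => [|y s IH] [|i] //=; rewrite ?IH //; case: i. Qed.

Lemma onth_over (T : Type) (s : seq T) i : size s <= i -> onth s i = None.
Proof. by elim: s i => [|y s IH] [|i] //=; apply: IH. Qed.

Lemma onth_isSome (T : Type) (s : seq T) i : i < size s -> exists b, onth s i = Some b.
Proof. by elim: s i => [|y s IH] [|i] //=; [exists y | apply: IH]. Qed.



Lemma tp_push base s r b : roomy base r (size (get s r)) ->
  wr (tp base s) (adr base r (size (get s r))) (Some b) = tp base (set s r (b :: get s r)).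
Proof.
move=> ro; apply: wr_ext.
  by rewrite tp_adr // get_set rev_cons onth_rcons size_rev ltnn eqxx.
move=> i ne; have [rL|rN] : r = RL \/ r <> RL by case: (r); auto; right.
  move: ro ne; rewrite rL /= => ro ne; rewrite /tp; case: ltnP => // lt.
  case: eqP => // nb; rewrite rev_cons onth_rcons size_rev; case: ltngtP => // [l|e].
    by rewrite onth_over // size_rev ltnW.
  by case: ne; lia.
apply: tp_set => [|j rj ei]; first by right.
rewrite rev_cons onth_rcons size_rev; case: ltngtP => // [l|e].
  by rewrite onth_over // size_rev ltnW.
by case: ne; rewrite ei e.
Qed.

Lemma tp_pop base s r b l : get s r = b :: l -> roomy base r (size l) ->
  wr (tp base s) (adr base r (size l)) None = tp base (set s r l).
Proof.
move=> E ro; set s' := set s r l.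
have gs' : get s' r = l by rewrite get_set.
have ss : s = set s' r (b :: get s' r).
  by rewrite gs' -E /s' {E ro gs' s'}; case: s => ? ? ? ? ?; case: r.
have ro' : roomy base r (size (get s' r)) by rewrite gs'.
have := tp_push b ro'; rewrite -ss gs' => <-.
apply: wr_ext.
  by rewrite tp_adr // get_set onth_over // size_rev.
by move=> i ne; rewrite /wr; case: eqP.
Qed.

(** Head movements from home to the bottom cell of a stack ([out]), one cell towards its top ([fw]),
    and one cell back ([bw]). *)
Definition out r := if r is RL then nseq 2 MoveL else nseq (off r) MoveR.
Definition fw r := if r is RL then [:: MoveL] else nseq 5 MoveR.
Definition bw r := if r is RL then [:: MoveR] else nseq 5 MoveL.

Lemma exits_bindk (E' : finType) (f : frag unit) (g : frag E') t p t1 p1 N1 e' t' p' N2 :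
  exits f t p tt t1 p1 N1 -> exits g t1 p1 e' t' p' N2 ->
  exits (bind f (fun _ => g)) t p e' t' p' (N1 + N2).
Proof. exact: exits_bind. Qed.

Lemma exits_gomR t p : exits (gom [:: MoveR]) t p tt t p.+1 2.
Proof. exact: (@exits_gom [:: MoveR]). Qed.

Definition scan ms : frag unit :=
  loop (bind rd (fun o => if o is Some _ then bind (gom ms) (fun _ => ret None) else ret (Some tt))).

(** From [RL] the head runs right to the blank before home; the initial step matters because the
    current cell may itself be blank after a [pop]. From another track it moves to track 0 and jumps
    back block by block to the only mark there. *)
Definition home r : frag unit :=
  if r is RL then
    bind (gom [:: MoveR]) (fun _ => bind (scan [:: MoveR]) (fun _ => gom [:: MoveR]))
  else bind (gom (nseq (off r) MoveL)) (fun _ =>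
    loop (bind rd (fun o => if o is Some true then ret (Some tt)
                            else bind (gom (nseq 5 MoveL)) (fun _ => ret None)))).

Definition push r b : frag unit :=
  bind (gom (out r)) (fun _ => bind (scan (fw r)) (fun _ =>
  bind (wrt (Some b)) (fun _ => home r))).

(** Emptiness is visible in the bottom cell. Otherwise the scan ends one cell above the top, whence
    the step [bw] before reading. *)
Definition pop r : frag (option bool) :=
  bind (gom (out r)) (fun _ => bind rd (fun o =>
    if o is None then bind (home r) (fun _ => ret None)
    else bind (scan (fw r)) (fun _ => bind (gom (bw r)) (fun _ => bind rd (fun o =>
         bind (wrt None) (fun _ => bind (home r) (fun _ => ret o))))))).

Definition roomys base s := 3 + size (gL s) <= base.

Lemma exits_out base s r : roomys base s ->
  exits (gom (out r)) (tp base s) base tt (tp base s) (adr base r 0) 5.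
Proof.
rewrite /roomys => ro.
have ok : okms base (out r) by case: r => //=; lia.
have := exits_gom (tp base s) ok; rewrite (_ : foldl _ _ _ = adr base r 0); last by case: (r) => /=; lia.
by apply: exits_le; case: (r).
Qed.

Lemma exits_scan base s r j : roomys base s -> j <= size (get s r) ->
  exits (scan (fw r)) (tp base s) (adr base r j) tt (tp base s) (adr base r (size (get s r)))
    (8 * (size (get s r) - j) + 2).
Proof.
move=> ro; move E: (size _ - j) => d; elim: d j E => [|d IH] j E le.
  have -> : j = size (get s r) by lia.
  apply: exits_loop_end; rewrite muln0 add0n (_ : 2 = 1 + 1) //.
  apply: exits_bind (exits_rd _ _) _.
  rewrite tp_adr ?onth_over ?size_rev //; first exact: exits_ret.
  by move: ro; rewrite /roomys; case: (r) => //=; lia.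
rewrite mulnS -addnA; apply: exits_loop (IH j.+1 _ _); try lia.
(* One round of the scan: a read, at most five moves with their closing [ret], and the final
   [ret None]. *)
rewrite (_ : 8 = 1 + (6 + 1)) //; apply: exits_bind (exits_rd _ _) _.
rewrite tp_adr; last by move: ro; rewrite /roomys; case: (r) le E => //=; lia.
have [b ->] : exists b, onth (rev (get s r)) j = Some b.
  by apply: onth_isSome; rewrite size_rev; lia.
apply: exits_bindk _ (exits_ret _ _ _).
have ok : okms (adr base r j) (fw r).
  by move: ro E; rewrite /roomys; case: (r) => //=; lia.
have := exits_gom (tp base s) ok; rewrite (_ : foldl _ _ _ = adr base r j.+1); last first.
  by move: ro E; rewrite /roomys; case: (r) => //=; lia.
by apply: exits_le; case: (r).
Qed.

Lemma exits_scanR base s j : roomys base s -> j <= size (gL s) ->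
  exits (scan [:: MoveR]) (tp base s) (base - 1 - j) tt (tp base s) (base - 1) (8 * j + 2).
Proof.
rewrite /roomys => ro; elim: j => [|j IH] le.
  apply: exits_loop_end; rewrite muln0 add0n (_ : 2 = 1 + 1) // subn0.
  apply: exits_bind (exits_rd _ _) _.
  have -> : tp base s (base - 1) = None.
    by rewrite /tp ifT ?ifT //; lia.
  exact: exits_ret.
rewrite mulnS -addnA; apply: exits_loop (IH _); last lia.
apply: (@exits_le _ _ _ _ _ _ _ (1 + (2 + 1))) => //; apply: exits_bind (exits_rd _ _) _.
have -> : base - 1 - j.+1 = adr base RL j by rewrite /=; lia.
rewrite tp_adr /=; last lia.
have [b ->] : exists b, onth (rev (gL s)) j = Some b.
  by apply: onth_isSome; rewrite size_rev; lia.
apply: exits_bindk _ (exits_ret _ _ _).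
have := exits_gomR (tp base s) (base - 2 - j).
by rewrite (_ : (base - 2 - j).+1 = base - 1 - j) //; lia.
Qed.

Lemma exits_homeR base s j :
  exits (loop (bind rd (fun o => if o is Some true then ret (Some tt)
                            else bind (gom (nseq 5 MoveL)) (fun _ => ret None))))
   (tp base s) (base + 5 * j) tt (tp base s) base (8 * j + 2).
Proof.
elim: j => [|j IH].
  apply: exits_loop_end; rewrite !muln0 add0n addn0 (_ : 2 = 1 + 1) //.
  apply: exits_bind (exits_rd _ _) _.
  have -> : tp base s base = Some true by rewrite /tp ltnn subnn.
  exact: exits_ret.
rewrite [8 * _]mulnS -addnA; apply: exits_loop IH.
rewrite (_ : 8 = 1 + (6 + 1)) //; apply: exits_bind (exits_rd _ _) _.
have -> : tp base s (base + 5 * j.+1) = None.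
  by rewrite /tp [base + _]addnC addnK mulnC modnMl ifF //; apply/negbTE; rewrite -leqNgt leq_addl.
apply: exits_bindk _ (exits_ret _ _ _).
have ok : okms (base + 5 * j.+1) (nseq 5 MoveL) by apply: okms_nseqL; lia.
have := exits_gom (tp base s) ok; rewrite mv_nseqL.
by rewrite (_ : base + 5 * j.+1 - 5 = base + 5 * j) //; lia.
Qed.

Lemma exits_home base s r j : roomys base s -> j <= size (get s r) ->
  exits (home r) (tp base s) (adr base r j) tt (tp base s) base (8 * j + 8).
Proof.
move=> ro le; have [rL|rN] : r = RL \/ r <> RL by case: (r); auto; right.
  move: le; rewrite /roomys rL /= in ro * => le.
  rewrite (_ : 8 * j + 8 = 2 + ((8 * j + 2) + 4)); last lia.
  apply: exits_bind (exits_gomR _ _) _.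
  rewrite (_ : (base - 2 - j).+1 = base - 1 - j); last lia.
  apply: exits_bind (exits_scanR ro le) _.
  apply: (@exits_le _ _ _ _ _ _ _ 2) => //.
  have := exits_gomR (tp base s) (base - 1).
  by rewrite (_ : (base - 1).+1 = base) //; lia.
apply: (@exits_le _ _ _ _ _ _ _ ((off r).+1 + (8 * j + 2))); first by case: (r) => /=; lia.
have -> : home r = bind (gom (nseq (off r) MoveL)) (fun _ =>
    loop (bind rd (fun o => if o is Some true then ret (Some tt)
                            else bind (gom (nseq 5 MoveL)) (fun _ => ret None)))).
  by case: (r) rN.
have ea : adr base r j = base + 5 * j + off r by case: (r) rN.
have ok : okms (adr base r j) (nseq (off r) MoveL) by apply: okms_nseqL; rewrite ea; lia.
apply: exits_bindk _ (exits_homeR _ _ _).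
have := exits_gom (tp base s) ok; rewrite mv_nseqL size_nseq ea.
by rewrite addnK.
Qed.

Definition hgt s := size (gL s) + size (gX s) + size (gY s) + size (gZ s) + size (gC s).

Lemma hgt_get s r : size (get s r) <= hgt s.
Proof. by rewrite /hgt; case: r => /=; lia. Qed.

Lemma exits_push base s r b : 4 + hgt s <= base ->
  exits (push r b) (tp base s) base tt (tp base (set s r (b :: get s r))) base (30 * (hgt s).+1).
Proof.
move=> ro; have ro1 : roomys base s by move: ro; rewrite /roomys /hgt; lia.
have ro2 : roomys base (set s r (b :: get s r)).
  by move: ro; rewrite /roomys /hgt; case: (r) => /=; lia.
have le := hgt_get s r.
apply: (@exits_le _ _ _ _ _ _ _ (5 + ((8 * (size (get s r) - 0) + 2) + (1 + (8 * size (get s r) + 8))))).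
  lia.
apply: exits_bind (exits_out r ro1) _; apply: exits_bind (exits_scan ro1 _) _ => //.
apply: exits_bind (exits_wrt _ _ _) _; rewrite tp_push.
  by apply: exits_home => //; rewrite get_set.
by move: ro1; rewrite /roomys; case: (r) => //=; lia.
Qed.

Lemma exits_pop_nil base s r : 4 + hgt s <= base -> get s r = [::] ->
  exits (pop r) (tp base s) base None (tp base s) base (30 * (hgt s).+1).
Proof.
move=> ro E; have ro1 : roomys base s by move: ro; rewrite /roomys /hgt; lia.
have roa : roomy base r 0 by move: ro1; rewrite /roomys; case: (r) => //=; lia.
apply: (@exits_le _ _ _ _ _ _ _ (5 + (1 + ((8 * 0 + 8) + 1)))); first lia.
apply: exits_bind (exits_out r ro1) _; apply: exits_bind (exits_rd _ _) _.
rewrite tp_adr // E /=; apply: exits_bindk _ (exits_ret _ _ _).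
exact: exits_home.
Qed.

Lemma exits_pop base s r b l : 4 + hgt s <= base -> get s r = b :: l ->
  exits (pop r) (tp base s) base (Some b) (tp base (set s r l)) base (30 * (hgt s).+1).
Proof.
move=> ro E; have ro1 : roomys base s by move: ro; rewrite /roomys /hgt; lia.
have ro2 : roomys base (set s r l).
  by move: ro1; rewrite /roomys; case: (r) E => //= -> /=; lia.
have roa j : j <= size (get s r) -> roomy base r j.
  by move: ro1; rewrite /roomys; case: (r) => //=; lia.
have le := hgt_get s r.
have sz : size (get s r) = (size l).+1 by rewrite E.
apply: (@exits_le _ _ _ _ _ _ _ (5 + (1 + ((8 * (size (get s r) - 0) + 2) + (6 + (1 + (1 + ((8 * size l + 8) + 1)))))))).
  lia.
apply: exits_bind (exits_out r ro1) _; apply: exits_bind (exits_rd _ _) _.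
rewrite tp_adr; last exact: roa.
have [b' ->] : exists b, onth (rev (get s r)) 0 = Some b by apply: onth_isSome; rewrite size_rev sz.
apply: exits_bind (exits_scan ro1 _) _ => //.
have ok : okms (adr base r (size (get s r))) (bw r).
  by move: (roa (size (get s r)) (leqnn _)); rewrite sz; case: (r) => //=; lia.
apply: (@exits_bind _ _ _ _ _ _ tt (tp base s) (adr base r (size l))).
  have := exits_gom (tp base s) ok; rewrite (_ : foldl _ _ _ = adr base r (size l)).
    by apply: exits_le; case: (r).
  by move: (roa (size (get s r)) (leqnn _)); rewrite sz; case: (r) => //=; lia.
apply: exits_bind (exits_rd _ _) _.
rewrite tp_adr; last by apply: roa; lia.
rewrite {1}E rev_cons onth_rcons size_rev ltnn eqxx.
apply: exits_bind (exits_wrt _ _ _) _; rewrite (tp_pop E); last by apply: roa; lia.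
apply: exits_bindk _ (exits_ret _ _ _); apply: exits_home => //.
by rewrite get_set.
Qed.

(** * Stack programs and their compilation *)

Inductive stm :=
  | Skip | Push (r : reg) (b : bool) | Seq (a b : stm)
  | Case (r : reg) (a b c : stm) | While (r : reg) (a : stm).

(* [exec p s t s']: [p] leads from [s] to [s'] with [t] elementary operations.
   [Case] and [While] pop; [While] continues as long as the popped bit is 1. *)
Inductive exec : stm -> store -> nat -> store -> Prop :=
| ESkip s : exec Skip s 1 s
| EPush r b s : exec (Push r b) s 1 (set s r (b :: get s r))
| ESeq a b s t1 s1 t2 s2 : exec a s t1 s1 -> exec b s1 t2 s2 -> exec (Seq a b) s (t1 + t2) s2
| ECaseT r a b c s l t s' : get s r = true :: l -> exec a (set s r l) t s' ->
    exec (Case r a b c) s t.+1 s'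
| ECaseF r a b c s l t s' : get s r = false :: l -> exec b (set s r l) t s' ->
    exec (Case r a b c) s t.+1 s'
| ECaseN r a b c s t s' : get s r = [::] -> exec c s t s' -> exec (Case r a b c) s t.+1 s'
| EWhileN r a s : get s r = [::] -> exec (While r a) s 1 s
| EWhileF r a s l : get s r = false :: l -> exec (While r a) s 1 (set s r l)
| EWhileT r a s l t1 s1 t2 s2 : get s r = true :: l -> exec a (set s r l) t1 s1 ->
    exec (While r a) s1 t2 s2 -> exec (While r a) s (t1 + t2).+1 s2.

Fixpoint comp (p : stm) : frag unit :=
  match p with
  | Skip => ret tt
  | Push r b => push r b
  | Seq a b => bind (comp a) (fun _ => comp b)
  | Case r a b c => bind (pop r) (fun o => match o with
      | Some true => comp a | Some false => comp b | None => comp c end)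
  | While r a => loop (bind (pop r) (fun o =>
      if o is Some true then bind (comp a) (fun _ => ret None) else ret (Some tt)))
  end.

Lemma hgt_set_pop s r b l : get s r = b :: l -> hgt (set s r l) < hgt s.
Proof. by rewrite /hgt; case: r => /= -> /=; lia. Qed.

Lemma exec_hgt p s t s' : exec p s t s' -> hgt s' <= hgt s + t.
Proof.
elim=> {p s t s'}; intros; rewrite ?addn0;
  repeat match goal with H : get _ _ = _ :: _ |- _ => move/hgt_set_pop: H => H end; try lia.
by rewrite /hgt; case: (r) => /=; lia.
Qed.

(** Every operation adds at most one bit, so within [t] operations no stack outgrows [H]; a push or
    pop walks to the top of a stack and back, hence the factor [40 * H.+1] per operation. The bound
    on [base] keeps [RL] clear of cell 0. *)
Lemma exec_comp base p s t s' : exec p s t s' -> forall H, hgt s + t <= H -> 4 + H <= base ->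
  exits (comp p) (tp base s) base tt (tp base s') base (t * (40 * H.+1)).
Proof.
elim=> {p s t s'}
 [s|r b s|a b s t1 s1 t2 s2 ea IHa _ IHb|r a b c s l t s' E _ IH|r a b c s l t s' E _ IH
 |r a b c s t s' E _ IH|r a s E|r a s l E|r a s l t1 s1 t2 s2 E ea IHa _ IHb] H le leb.
- by apply: exits_le (exits_ret _ _ _); lia.
- by apply: exits_le (exits_push _ _ _); nia.
- have := exec_hgt ea => h1; rewrite mulnDl; apply: exits_bindk (IHa H _ leb) (IHb H _ leb); lia.
- have h := hgt_set_pop E; rewrite mulSn; apply: exits_bind (exits_le _ (exits_pop _ E)) (IH H _ leb); nia.
- have h := hgt_set_pop E; rewrite mulSn; apply: exits_bind (exits_le _ (exits_pop _ E)) (IH H _ leb); nia.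
- rewrite mulSn; apply: exits_bind (exits_le _ (exits_pop_nil _ E)) (IH H _ leb); nia.
- apply: exits_loop_end; rewrite mul1n.
  apply: (@exits_le _ _ _ _ _ _ _ (30 * (hgt s).+1 + 1)); first nia.
  apply: exits_bind (exits_pop_nil _ E) _; [lia|exact: exits_ret].
- apply: exits_loop_end; rewrite mul1n.
  apply: (@exits_le _ _ _ _ _ _ _ (30 * (hgt s).+1 + 1)); first nia.
  apply: exits_bind (exits_pop _ E) _; [lia|exact: exits_ret].
- have h := hgt_set_pop E; have h1 := exec_hgt ea.
  apply: (@exits_le _ _ _ _ _ _ _ ((30 * (hgt s).+1 + (t1 * (40 * H.+1) + 1)) + t2 * (40 * H.+1))).
    by rewrite mulSn; nia.
  apply: exits_loop (IHb H _ leb); last lia.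
  apply: exits_bind (exits_pop _ E) _; first lia.
  by apply: exits_bindk (IHa H _ leb) (exits_ret _ _ _); lia.
Qed.

(** The input already has the form of the stack [RL], first bit on top: marking the second cell
    behind it as home turns the input tape into a [tp]. At the end the head is put on the top of
    [RL], from where the output is read to the right up to the blank before home. *)
Definition whole p : frag unit :=
  bind (bind (scan [:: MoveR]) (fun _ => bind (gom [:: MoveR]) (fun _ => wrt (Some true)))) (fun _ =>
  bind (comp p) (fun _ => bind (gom (out RL)) (fun _ => bind (scan [:: MoveL]) (fun _ => gom [:: MoveR])))).

(* The input starts at cell [B], chosen large enough for the head never to reach cell 0. *)
Definition tpin B (inp : seq bool) : tape := fun p => if p < B then None else onth inp (p - B).

Lemma exits_scan_in B inp j : j <= size inp ->
  exits (scan [:: MoveR]) (tpin B inp) (B + (size inp - j)) tt (tpin B inp) (B + size inp) (8 * j + 2).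
Proof.
elim: j => [|j IH] le.
  apply: exits_loop_end; rewrite muln0 add0n (_ : 2 = 1 + 1) // subn0.
  apply: exits_bind (exits_rd _ _) _.
  have -> : tpin B inp (B + size inp) = None.
    by rewrite /tpin ifF; [rewrite onth_over //|]; lia.
  exact: exits_ret.
rewrite mulnS -addnA; apply: exits_loop (IH _); last lia.
apply: (@exits_le _ _ _ _ _ _ _ (1 + (2 + 1))) => //; apply: exits_bind (exits_rd _ _) _.
have [b ->] : exists b, tpin B inp (B + (size inp - j.+1)) = Some b.
  by rewrite /tpin ifF; [apply: onth_isSome|]; lia.
apply: exits_bindk _ (exits_ret _ _ _).
have := exits_gomR (tpin B inp) (B + (size inp - j.+1)).
by rewrite (_ : (B + _).+1 = B + (size inp - j)) //; lia.
Qed.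

Lemma onth_rev (T : Type) (s : seq T) i : i < size s -> onth (rev s) i = onth s (size s - i.+1).
Proof.
elim: s i => [|x s IH] i //= lt; rewrite rev_cons onth_rcons size_rev.
case: ltngtP => [l|l|e]; [|lia|by rewrite e subnn].
by rewrite IH // subSn.
Qed.

Lemma exits_init B inp :
  exits (bind (scan [:: MoveR]) (fun _ => bind (gom [:: MoveR]) (fun _ => wrt (Some true))))
    (tpin B inp) B tt (tp (B + size inp).+1 (Store inp [::] [::] [::] [::])) (B + size inp).+1
    (8 * size inp + 5).
Proof.
rewrite (_ : _ + 5 = (8 * size inp + 2) + (2 + 1)); last lia.
have := exits_scan_in B (leqnn (size inp)); rewrite subnn addn0 => r.
apply: exits_bind r _; apply: exits_bind (exits_gomR _ _) _.
have <- : wr (tpin B inp) (B + size inp).+1 (Some true) =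
   tp (B + size inp).+1 (Store inp [::] [::] [::] [::]); last exact: exits_wrt.
apply: wr_ext => [|i ne]; rewrite /tp; first by rewrite ltnn subnn.
case: ltnP => lt.
  case: eqP => [->|ne2] /=.
    by rewrite /tpin; case: ifP => // _; rewrite onth_over //; lia.
  rewrite /tpin; case: ltnP => ltB; first by rewrite onth_over // size_rev; lia.
  by rewrite onth_rev; [congr onth|]; lia.
rewrite /tpin [RHS]ifF ?[RHS]onth_over /=; try lia.
case: ifP => _; first by rewrite ifF //; lia.
have := mod5 (i - (B + size inp).+1).
by move: (_ %% _) => m; case=> [|[|[|[|]]]] ->; rewrite /= onth_over.
Qed.

Lemma exits_fin base s : roomys base s ->
  exits (bind (gom (out RL)) (fun _ => bind (scan [:: MoveL]) (fun _ => gom [:: MoveR])))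
    (tp base s) base tt (tp base s) (base - 1 - size (gL s)) (8 * size (gL s) + 9).
Proof.
move=> ro; rewrite (_ : _ + 9 = 5 + ((8 * (size (gL s) - 0) + 2) + 2)); last lia.
apply: exits_bind (exits_out RL ro) _.
apply: exits_bind (exits_scan (r := RL) ro _) _ => //=.
have := exits_gomR (tp base s) (base - 2 - size (gL s)).
by rewrite (_ : (base - 2 - _).+1 = base - 1 - size (gL s)) //; move: ro; rewrite /roomys; lia.
Qed.

Definition start inp := Store inp [::] [::] [::] [::].

Lemma exits_whole p inp t s' : exec p (start inp) t s' -> exists B base, 
  [/\ 0 < B, roomys base s' & exits (whole p) (tpin B inp) B tt (tp base s') (base - 1 - size (gL s'))
    (100 * (size inp + t).+1 ^ 2)].
Proof.
(* In [t] operations [RL] gains at most [t] bits, so this many cells before the input suffice. *)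
move=> ex; set B := 4 + t; exists B, (B + size inp).+1.
have h := exec_hgt ex; rewrite /hgt /= !addn0 in h.
have ro : roomys (B + size inp).+1 s' by rewrite /roomys /B; lia.
split => //.
have := exec_comp (base := (B + size inp).+1) ex (H := size inp + t) _ _.
rewrite /hgt /= !addn0 => /(_ (leqnn _)) r.
apply: exits_le (exits_bind (exits_init B inp) (exits_bindk (r _) (exits_fin ro))); rewrite /B; nia.
Qed.

(** * From fragments to Turing machines *)

Section Machine.
Variable f : frag unit.
(** [None] is the halting state. Since a machine starts in [ord0], that index is set apart as an
    additional start state whose only step enters [f0 f]. *)
Let Q : finType := option (fq f).
Let st (q : Q) : 'I_(#|Q|).+1 := lift ord0 (enum_rank q).
Let N := #|Q|.

Definition mdelta (q : 'I_N.+1) (s : sym) : option ('I_N.+1 * sym * move) :=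
  match unlift ord0 q with
  | None => Some (st (Some (f0 f)), s, Stay)
  | Some j => match enum_val j with
    | None => None
    | Some q' => let: (o, s', m) := fd q' s in
        Some (match o with inl q'' => st (Some q'') | inr _ => st None end, s', m)
    end
  end.

Definition machine : TM := @mkTM N mdelta.

Lemma mdelta_st q s : mdelta (st q) s = match q with
    | None => None
    | Some q' => let: (o, s', m) := fd q' s in
        Some (match o with inl q'' => st (Some q'') | inr _ => st None end, s', m)
    end.
Proof. by rewrite /mdelta /st liftK enum_rankK. Qed.

(** The default [None] of [nth] lets the finite lists stand for a tape that is blank beyond them. *)
Definition rep (q : 'I_N.+1) (t : tape) p (c : config machine) :=
  let: (q', l, h, r) := c in
  [/\ q' = q, h = t p, (size l <= p), (forall i, i < p -> nth None l i = t (p.-1 - i)) &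
      forall i, nth None r i = t (p.+1 + i)].

Lemma rep_step q t p c q' s m : rep q t p c -> mdelta q (t p) = Some (q', s, m) -> okm m p ->
  rep q' (wr t p s) (mv p m) (@tm_step machine c).
Proof.
case: c => [[[q1 l] h] r] /= [-> -> sl Hl Hr] -> {q1 h}; case: m => /= ok.
- case: l sl Hl => [|x l] /= sl Hl.
    have t0 i : i < p -> None = t (p.-1 - i) by move/Hl; rewrite nth_nil.
    split=> //; first by rewrite (t0 0) // subn0 /wr; case: eqP => //; lia.
    + by move=> i lt; rewrite nth_nil /wr ifF; [rewrite (t0 i.+1); [congr t|] |]; lia.
    + case=> [|i] /=; first by rewrite addn0 /wr prednK // eqxx.
      by rewrite Hr /wr ifF; [congr t|]; lia.
  split=> //.
  + by have := Hl 0 ok; rewrite /= subn0 /wr => ->; case: eqP => //; lia.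
  + by lia.
  + move=> i lt; have := Hl i.+1; rewrite /= => ->; last lia.
    by rewrite /wr ifF; [congr t|]; lia.
  + case=> [|i] /=; first by rewrite addn0 /wr prednK // eqxx.
    by rewrite Hr /wr ifF; [congr t|]; lia.
- have hl i : i < p.+1 -> nth None (s :: l) i = wr t p s (p - i).
    case: i => [|i] /= lt; first by rewrite subn0 /wr eqxx.
    by rewrite Hl // /wr ifF; [congr t|]; lia.
  case: r Hr => [|x r] Hr /=; split => //.
  + by have := Hr 0; rewrite /= addn0 /wr => ->; case: eqP => //; lia.
  + by move=> i; rewrite nth_nil; have := Hr i.+1; rewrite nth_nil /wr => ->; rewrite ifF; [congr t|]; lia.
  + by have := Hr 0; rewrite /= addn0 /wr => ->; case: eqP => //; lia.
  + by move=> i; have := Hr i.+1; rewrite /= /wr => ->; rewrite ifF; [congr t|]; lia.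
- split => //; first by rewrite /wr eqxx.
  + by move=> i lt; rewrite Hl // /wr ifF //; lia.
  + by move=> i; rewrite Hr // /wr ifF //; lia.
Qed.

Lemma runs_machine q t p e t' p' k c : runs q t p e t' p' k -> rep (st (Some q)) t p c ->
  rep (st None) t' p' (@tm_run machine k c).
Proof.
move=> r; elim: r c => {q t p e t' p' k} [q t p e s m E1 ok|q t p q' s m e t' p' k E1 ok _ IH] c rc.
  by apply: rep_step rc _ ok; rewrite mdelta_st E1.
by rewrite /tm_run iterSr; apply: IH; apply: rep_step rc _ ok; rewrite mdelta_st E1.
Qed.

Lemma rep_init B inp : 0 < B -> rep ord0 (tpin B inp) B (tm_init machine inp).
Proof.
move=> B0; have e : forall i, nth None (map Some inp) i = tpin B inp (B + i).
  move=> i; rewrite /tpin ifF; last lia.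
  by rewrite addKn; elim: (inp) i => [|x s IH] [|i] /=.
have nl i : i < B -> None = tpin B inp (B.-1 - i) by rewrite /tpin ifT //; lia.
rewrite /tm_init; case E: (map Some inp) e => [|x r] e; split=> //.
- by have := e 0; rewrite addn0.
- by move=> i lt; rewrite nth_nil -nl.
- by move=> i; have := e i.+1; rewrite !nth_nil addSnnS => ->.
- by have := e 0; rewrite addn0.
- by move=> i lt; rewrite nth_nil -nl.
- by move=> i; have := e i.+1; rewrite addSnnS => /= ->.
Qed.

Lemma rep_out t p c s : rep (st None) t p c -> (forall i, i < size s -> t (p + i) = onth s i) ->
  t (p + size s) = None -> tm_halted c /\ tm_output c = s.
Proof.
case: c => [[[q l] h] r] /= [-> -> _ _ Hr] Hs Hn; split; first by rewrite mdelta_st.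
have e i : nth None (t p :: r) i = t (p + i).
  by case: i => [|i] /=; rewrite ?addn0 // Hr addSnnS.
change (pmap id (take (find (pred1 None) (t p :: r)) (t p :: r)) = s).
move: (t p :: r) e => {Hr r l} u e.
elim: s u p Hs Hn e => [|x s IH] u p Hs Hn e.
  have := e 0; rewrite addn0 -[p in t p]addn0 Hn.
  by case: u {e} => [|y u] //= ->.
have := e 0; rewrite addn0 -[p in t p]addn0 (Hs 0) //=.
case: u e => [|y u] e //= ey; rewrite ey /=; congr (_ :: _).
apply: (IH _ p.+1) => [i lt||i].
- by rewrite addSnnS Hs.
- by rewrite addSnnS.
- by rewrite addSnnS -e.
Qed.

End Machine.

Theorem exec_tm p : exists M : TM, forall inp t s', exec p (start inp) t s' ->
  exists2 k, k <= (100 * (size inp + t).+1 ^ 2).+1 & tm_computes M k inp (gL s').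
Proof.
exists (machine (whole p)) => inp t s' ex.
have [B [base [B0 ro [k le r]]]] := exits_whole ex.
exists k.+1 => //; rewrite /tm_computes.
have r1 : rep (lift ord0 (enum_rank (Some (f0 (whole p))))) (tpin B inp) B
    (@tm_step (machine (whole p)) (tm_init (machine (whole p)) inp)).
  have := @rep_step (whole p) ord0 (tpin B inp) B _ (lift ord0 (enum_rank (Some (f0 (whole p))))) (tpin B inp B) Stay (rep_init _ _ B0).
  by rewrite /mdelta unlift_none wr_id /=; apply.
have := runs_machine r r1; rewrite /tm_run -iterSr => r2.
have := rep_out (s := gL s') r2; case=> [i lt||-> ->]; rewrite ?eqxx //.
  move: ro; rewrite /roomys => ro; rewrite /tp ifT ?ifF; try lia.
  by rewrite onth_rev; [congr onth|]; lia.
by move: ro; rewrite /roomys => ro; rewrite /tp ifT ?ifT //; lia.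
Qed.

Definition run p s N s' := exists2 t, t <= N & exec p s t s'.

Lemma run_le p s N N' s' : N <= N' -> run p s N s' -> run p s N' s'.
Proof. by move=> le [t le' e]; exists t => //; apply: leq_trans le. Qed.
Lemma run_skip s : run Skip s 1 s. Proof. by exists 1 => //; constructor. Qed.
Lemma run_push r b s : run (Push r b) s 1 (set s r (b :: get s r)).
Proof. by exists 1 => //; constructor. Qed.
Lemma run_seq a b s N1 s1 N2 s2 : run a s N1 s1 -> run b s1 N2 s2 -> run (Seq a b) s (N1 + N2) s2.
Proof. by move=> [t le e] [t' le' e']; exists (t + t'); [apply: leq_add|econstructor; eauto]. Qed.
Lemma run_caseT r a b c s l N s' : get s r = true :: l -> run a (set s r l) N s' ->
  run (Case r a b c) s N.+1 s'.
Proof. by move=> E [t le e]; exists t.+1 => //; apply: ECaseT E e. Qed.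
Lemma run_caseF r a b c s l N s' : get s r = false :: l -> run b (set s r l) N s' ->
  run (Case r a b c) s N.+1 s'.
Proof. by move=> E [t le e]; exists t.+1 => //; apply: ECaseF E e. Qed.
Lemma run_caseN r a b c s N s' : get s r = [::] -> run c s N s' -> run (Case r a b c) s N.+1 s'.
Proof. by move=> E [t le e]; exists t.+1 => //; apply: ECaseN E e. Qed.
Lemma run_whileN r a s : get s r = [::] -> run (While r a) s 1 s.
Proof. by exists 1 => //; constructor. Qed.
Lemma run_whileT r a s l N1 s1 N2 s2 : get s r = true :: l -> run a (set s r l) N1 s1 ->
  run (While r a) s1 N2 s2 -> run (While r a) s (N1 + N2).+1 s2.
Proof.
move=> E [t le e] [t' le' e']; exists (t + t').+1; last by apply: EWhileT E e e'.
by rewrite ltnS leq_add.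
Qed.

(** * Polynomial-time functions on encoded data *)

Inductive tree := Leaf | Node of tree & tree.
(** Preorder, one bit per node: codes are prefix-free, so values can be stacked one above the other
    with no separators. *)
Fixpoint code v := match v with
  | Leaf => [:: false] | Node a b => true :: code a ++ code b end.

Lemma code_gt0 v : 0 < size (code v). Proof. by case: v. Qed.

Definition stk l x := Store l x [::] [::] [::].

(* A counter of pending subtrees, in unary on [RC], delimits the tree on top of [RX]. *)
Definition moveX (dy dz : bool) :=
  let q b := Seq (if dy then Push RY b else Skip) (if dz then Push RZ b else Skip) in
  Seq (Push RC true)
      (While RC (Case RX (Seq (Seq (Push RC true) (Push RC true)) (q true)) (q false) Skip)).

Lemma run_moveX dy dz v l x y z : run (moveX dy dz) (Store l (code v ++ x) y z [::])
  (10 * size (code v)) (Store l x (if dy then rev (code v) ++ y else y)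
                                  (if dz then rev (code v) ++ z else z) [::]).
Proof.
have q b l' x' y' z' c' : run (Seq (if dy then Push RY b else Skip) (if dz then Push RZ b else Skip))
    (Store l' x' y' z' c') 2 (Store l' x' (if dy then b :: y' else y') (if dz then b :: z' else z') c').
  by case: dy; case: dz; (apply: (@run_seq _ _ _ 1 _ 1);
    [exact: run_push || exact: run_skip|exact: run_push || exact: run_skip]).
rewrite /moveX; cbv zeta beta; set body := Case _ _ _ _.
(* One more entry on the counter means one more code consumed; keeping the rest of the run abstract
   makes the induction on the tree go through. *)
have H : forall c N s', run (While RC body) (Store l x (if dy then rev (code v) ++ y else y)
       (if dz then rev (code v) ++ z else z) c) N s' ->
    run (While RC body) (Store l (code v ++ x) y z (true :: c)) (8 * size (code v) + N) s'.
  elim: v x y z => [|a IHa b IHb] x y z c N s' r /=.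
    apply: (@run_le _ _ (3 + N).+1); first lia.
    apply: run_whileT r; first by [].
    by apply: run_caseF; [reflexivity|exact: q].
  apply: (@run_le _ _ (5 + (8 * size (code a) + (8 * size (code b) + N))).+1).
    by rewrite size_cat; lia.
  apply: run_whileT => //=.
    apply: run_caseT => /=; first by rewrite -catA.
    by apply: (@run_seq _ _ _ 2 _ 2); [apply: (@run_seq _ _ _ 1 _ 1); apply: run_push|apply: q].
  apply: IHa; apply: IHb; apply: (eq_ind _ (fun s => run _ s N s') r).
  by congr Store; [case: (dy)|case: (dz)] => //; rewrite rev_cons rev_cat cat_rcons catA.
apply: (@run_le _ _ (1 + (8 * size (code v) + 1))); first by have := code_gt0 v; lia.
by apply: run_seq (run_push _ _ _) _; apply: H; apply: run_whileN.
Qed.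

(** The loop tests a bit that it pops, so one bit on [RC] is renewed as long as [r] yields bits. The
    contents arrive in reverse order. *)
Definition pour r d :=
  Seq (Push RC true) (While RC (Case r (Seq (Push d true) (Push RC true))
                                       (Seq (Push d false) (Push RC true)) Skip)).

Lemma run_pour r d s : r <> d -> r <> RC -> d <> RC -> gC s = [::] ->
  run (pour r d) s (5 * (size (get s r)).+1) (set (set s r [::]) d (rev (get s r) ++ get s d)).
Proof.
move=> rd rC dC cs; rewrite /pour; set body := Case _ _ _ _.
suff H : forall s, gC s = [:: true] -> run (While RC body) s (4 * (size (get s r)) + 4)
    (set (set (set s RC [::]) r [::]) d (rev (get s r) ++ get s d)).
  apply: (@run_le _ _ (1 + (4 * (size (get s r)) + 4))); first lia.
  apply: run_seq (run_push _ _ _) _; have e : gC (set s RC (true :: get s RC)) = [:: true] by case: (s) cs => ? ? ? ? ? /= ->.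
  have := H _ e.
  by case: (s) cs => ? ? ? ? ? /= ->; case: (r) rC => // _; case: (d) dC.
move=> {cs}s cs; move E: (get s r) => w; elim: w s cs E => [|b w IH] s cs E.
  apply: (@run_le _ _ (2 + 1).+1); first lia.
  apply: run_whileT; first exact: cs.
    apply: run_caseN; last exact: run_skip.
    by case: (r) rC E.
  have -> : set (set (set s RC [::]) r [::]) d (rev [::] ++ get s d) = set s RC [::].
    by case: (s) cs E => ? ? ? ? ? /= _; case: (r) rd rC => //= rd _ ->; case: (d) rd dC.
  exact: run_whileN.
apply: (@run_le _ _ (3 + (4 * size w + 4)).+1); first by rewrite /=; lia.
have Er : get (set s RC [::]) r = b :: w by case: (r) rC E.
apply: (@run_whileT _ _ _ [::] 3 (set (set (set s r w) d (b :: get s d)) RC [:: true])); first exact: cs.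
  have e : run (Seq (Push d b) (Push RC true)) (set (set s RC [::]) r w) (1 + 1)
               (set (set (set s r w) d (b :: get s d)) RC [:: true]).
    apply: run_seq; first exact: run_push.
    have -> : set (set (set s r w) d (b :: get s d)) RC [:: true] =
       set (set (set (set s RC [::]) r w) d (b :: get (set (set s RC [::]) r w) d)) RC [:: true].
      by case: (s) => ? ? ? ? ?; case: (r) rd rC => // rd _; case: (d) rd dC.
    have e1 : [:: true] = true :: get (set (set (set s RC [::]) r w) d
                (b :: get (set (set s RC [::]) r w) d)) RC.
      by case: (s) => ? ? ? ? ?; case: (r) rd rC => // rd _; case: (d) rd dC.
    by rewrite {1}e1; apply: run_push.
  by case: b Er e {E} => Er e; [apply: run_caseT Er e|apply: run_caseF Er e].
have := IH (set (set (set s r w) d (b :: get s d)) RC [:: true]).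
have -> : get (set (set (set s r w) d (b :: get s d)) RC [:: true]) r = w.
  by case: (s) => ? ? ? ? ?; case: (r) rd rC => // rd _; case: (d) rd dC.
move=> /(_ erefl erefl) H; apply: (eq_ind _ (fun s' => run _ _ _ s') H).
rewrite rev_cons cat_rcons; by case: (s) => ? ? ? ? ?; case: (r) rd rC => // rd _; case: (d) rd dC.
Qed.

Lemma run_pourYX l x y z : run (pour RY RX) (Store l x (rev y) z [::]) (5 * (size y).+1)
  (Store l (y ++ x) [::] z [::]).
Proof.
by have := @run_pour RY RX (Store l x (rev y) z [::]); rewrite /= revK size_rev; apply.
Qed.
Lemma run_pourZX l x y z : run (pour RZ RX) (Store l x y (rev z) [::]) (5 * (size z).+1)
  (Store l (z ++ x) y [::] [::]).
Proof.
by have := @run_pour RZ RX (Store l x y (rev z) [::]); rewrite /= revK size_rev; apply.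
Qed.

Definition dropX := moveX false false.
(** [moveX] leaves reversed copies; pouring them back restores the order. *)
Definition dupX := Seq (moveX true true) (Seq (pour RY RX) (pour RZ RX)).
Definition swapX := Seq (moveX true false) (Seq (moveX false true) (Seq (pour RY RX) (pour RZ RX))).

Lemma run_drop v l x : run dropX (stk l (code v ++ x)) (10 * size (code v)) (stk l x).
Proof. exact: run_moveX. Qed.

Lemma run_dup v l x :
  run dupX (stk l (code v ++ x)) (30 * size (code v)) (stk l (code v ++ code v ++ x)).
Proof.
have g0 := code_gt0 v.
apply: (@run_le _ _ (10 * size (code v) + (5 * (size (code v)).+1 + 5 * (size (code v)).+1))); first lia.
apply: run_seq (run_moveX true true _ _ _ _ _) _; rewrite !cats0.
exact: run_seq (run_pourYX _ _ _ _) (run_pourZX _ _ _ _).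
Qed.

Lemma run_swap v w l x : run swapX (stk l (code v ++ code w ++ x))
  (20 * (size (code v) + size (code w))) (stk l (code w ++ code v ++ x)).
Proof.
have g0 := code_gt0 v; have g1 := code_gt0 w.
apply: (@run_le _ _ (10 * size (code v) + (10 * size (code w) +
   (5 * (size (code v)).+1 + 5 * (size (code w)).+1)))); first lia.
apply: run_seq (run_moveX true false _ _ _ _ _) _; rewrite cats0.
apply: run_seq (run_moveX false true _ _ _ _ _) _; rewrite cats0.
exact: run_seq (run_pourYX _ _ _ _) (run_pourZX _ _ _ _).
Qed.

Class Enc (A : Type) := enc : A -> tree.
#[global] Hint Mode Enc ! : typeclass_instances.
Definition sz A {EA : Enc A} (a : A) := size (code (enc a)).

Lemma sz_gt0 A {EA : Enc A} (a : A) : 0 < sz a. Proof. exact: code_gt0. Qed.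

(** As the base is at least 2, a larger exponent absorbs constants, sums and products, so a single
    exponent expresses every polynomial bound. *)
Definition pbd A {EA : Enc A} (h : A -> nat) := exists c, forall a, h a <= (sz a + 2) ^ c.

(* [f] is computed in place on top of the stack [RX], leaving untouched whatever lies below. *)
Definition pt A B {EA : Enc A} {EB : Enc B} (f : A -> B) := exists p c, forall a l x,
  run p (stk l (code (enc a) ++ x)) ((sz a + 2) ^ c) (stk l (code (enc (f a)) ++ x)).

Section Bounds.
Context {A : Type} {EA : Enc A}.
Implicit Types (h : A -> nat).

Lemma pbd_le h h' : (forall a, h a <= h' a) -> pbd h' -> pbd h.
Proof. by move=> le [c H]; exists c => a; apply: leq_trans (H a). Qed.
Lemma pbd_const k : pbd (fun _ : A => k).
Proof.
exists k => a; apply: leq_trans (ltnW (ltn_expl k (_ : 1 < 2))) _ => //.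
by case: k => // k; rewrite leq_exp2r //; lia.
Qed.
Lemma pbd_sz : pbd (fun a : A => sz a).
Proof. by exists 1 => a; rewrite expn1 leq_addr. Qed.
Lemma pow_mono m c c' : c <= c' -> (m + 2) ^ c <= (m + 2) ^ c'.
Proof. by move=> le; apply: leq_pexp2l => //; lia. Qed.
Lemma pbd_add h h' : pbd h -> pbd h' -> pbd (fun a => h a + h' a).
Proof.
move=> [c H] [c' H']; exists (maxn c c').+1 => a; rewrite expnS.
have l1 := leq_trans (H a) (pow_mono (sz a) (leq_maxl c c')).
have l2 := leq_trans (H' a) (pow_mono (sz a) (leq_maxr c c')).
by apply: leq_trans (leq_add l1 l2) _; rewrite addnn -mul2n leq_mul2r leq_addl orbT.
Qed.
Lemma pbd_mul h h' : pbd h -> pbd h' -> pbd (fun a => h a * h' a).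
Proof. by move=> [c H] [c' H']; exists (c + c') => a; rewrite expnD leq_mul. Qed.
Lemma pbd_exp h k : pbd h -> pbd (fun a => h a ^ k).
Proof.
move=> [c H]; exists (c * k) => a; rewrite expnM.
by case: k => // k; rewrite leq_exp2r.
Qed.
Lemma pbd_S h : pbd h -> pbd (fun a => (h a).+1).
Proof.
by move=> H; apply: pbd_le (pbd_add H (pbd_const 1)) => a; rewrite addn1.
Qed.
End Bounds.

Lemma pt_of A B {EA : Enc A} {EB : Enc B} (f : A -> B) p h : pbd h ->
  (forall a l x, run p (stk l (code (enc a) ++ x)) (h a) (stk l (code (enc (f a)) ++ x))) -> pt f.
Proof. by move=> [c H] r; exists p, c => a l x; apply: run_le (H a) _. Qed.

Lemma run_size p l v w N : run p (stk l v) N (stk l w) -> size w <= size v + N.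
Proof. by move=> [t le /exec_hgt]; rewrite /hgt /=; lia. Qed.

(** A program writes at most one bit per operation, so its running time also bounds the growth of
    the value. *)
Lemma pt_sz A B {EA : Enc A} {EB : Enc B} (f : A -> B) : pt f -> pbd (fun a => sz (f a)).
Proof.
move=> [p [c H]]; apply: pbd_le (pbd_add pbd_sz (_ : pbd (fun a => (sz a + 2) ^ c))) => [a|].
  by have := run_size (H a [::] [::]); rewrite !cats0.
by exists c.
Qed.

Lemma pbd_comp A B {EA : Enc A} {EB : Enc B} (f : A -> B) (h : B -> nat) :
  pt f -> pbd h -> pbd (fun a => h (f a)).
Proof.
move=> pf [c H]; apply: pbd_le (_ : pbd (fun a => (sz (f a) + 2) ^ c)) => [a|]; first exact: H.
by apply: pbd_exp; apply: pbd_add (pt_sz pf) (pbd_const _).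
Qed.

Lemma pt_ex A B {EA : Enc A} {EB : Enc B} (f : A -> B) : pt f -> exists p h, pbd h /\
  forall a l x, run p (stk l (code (enc a) ++ x)) (h a) (stk l (code (enc (f a)) ++ x)).
Proof. by move=> [p [c H]]; exists p, (fun a => (sz a + 2) ^ c); split=> //; exists c. Qed.

#[global] Instance Enc_prod A B (EA : Enc A) (EB : Enc B) : Enc (A * B) :=
  fun p => Node (enc p.1) (enc p.2).
#[global] Instance Enc_bool : Enc bool := fun b => if b then Node Leaf Leaf else Leaf.
#[global] Instance Enc_unit : Enc unit := fun _ => Leaf.
#[global] Instance Enc_seq A (EA : Enc A) : Enc (seq A) :=
  foldr (fun a t => Node (enc a) t) Leaf.

Lemma sz_pair A B {EA : Enc A} {EB : Enc B} (a : A) (b : B) : sz (a, b) = (sz a + sz b).+1.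
Proof. by rewrite /sz /= size_cat. Qed.
Lemma sz_nil A {EA : Enc A} : sz ([::] : seq A) = 1. Proof. by []. Qed.
Lemma sz_cons A {EA : Enc A} (a : A) s : sz (a :: s) = (sz a + sz s).+1.
Proof. by rewrite /sz /= size_cat. Qed.
Lemma sz_bool (b : bool) : sz b <= 3. Proof. by case: b. Qed.

Section Closure.
Context {A B : Type} {EA : Enc A} {EB : Enc B}.

Lemma pt_ext (f g : A -> B) : f =1 g -> pt f -> pt g.
Proof. by move=> e [p [c H]]; exists p, c => a l x; rewrite -e. Qed.

Lemma pt_recode (f : A -> B) : (forall a, enc (f a) = enc a) -> pt f.
Proof.
move=> e; apply: (pt_of (p := Skip) (pbd_const 1)) => a l x; rewrite e; exact: run_skip.
Qed.

End Closure.

Lemma pt_id A {EA : Enc A} : pt (fun a : A => a). Proof. exact: pt_recode. Qed.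

Lemma pt_comp A B C {EA : Enc A} {EB : Enc B} {EC : Enc C} (f : B -> C) (g : A -> B) :
  pt f -> pt g -> pt (fun a => f (g a)).
Proof.
move=> /pt_ex [p [h [bh H]]] pg; have [q [k [bk K]]] := pt_ex pg.
apply: (pt_of (p := Seq q p) (pbd_add bk (pbd_comp pg bh))) => a l x.
exact: run_seq (K a l x) (H _ _ _).
Qed.

Lemma run_tree v : exists p, forall l x, run p (stk l x) (2 * size (code v)) (stk l (code v ++ x)).
Proof.
elim: v => [|a [p H] b [q K]].
  by exists (Push RX false) => l x; apply: run_le (run_push _ _ _).
exists (Seq q (Seq p (Push RX true))) => l x /=; rewrite size_cat -catA.
apply: (@run_le _ _ (2 * size (code b) + (2 * size (code a) + 1))); first lia.
exact: run_seq (K _ _) (run_seq (H _ _) (run_push _ _ _)).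
Qed.

Lemma pt_const A B {EA : Enc A} {EB : Enc B} (b : B) : pt (fun _ : A => b).
Proof.
have [p H] := run_tree (enc b).
apply: (pt_of (p := Seq dropX p) (h := fun a => 10 * sz a + 2 * sz b)).
  by apply: pbd_add (pbd_const _); apply: pbd_mul (pbd_const _) pbd_sz.
by move=> a l x; apply: run_seq (run_drop _ _ _) (H _ _).
Qed.

(** [g] runs on a copy above the argument, [f] on the argument swapped to the top; one further
    [true] makes the two adjacent codes the code of a pair. *)
Lemma pt_pair A B C {EA : Enc A} {EB : Enc B} {EC : Enc C} (f : A -> B) (g : A -> C) :
  pt f -> pt g -> pt (fun a => (f a, g a)).
Proof.
move=> /pt_ex [p [h [bh H]]] pg; have [q [k [bk K]]] := pt_ex pg.
apply: (pt_of (p := Seq dupX (Seq q (Seq swapX (Seq p (Push RX true)))))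
  (h := fun a => 30 * sz a + (k a + (20 * (sz (g a) + sz a) + (h a + 1))))).
  have bg := pt_sz pg; have b0 := @pbd_sz A EA.
  by do !(assumption || apply: pbd_add || apply: pbd_mul || apply: pbd_const).
move=> a l x; apply: run_seq (run_dup _ _ _) _; apply: run_seq (K _ _ _) _.
apply: run_seq (run_swap _ _ _ _) _; apply: run_seq (H _ _ _) _.
by rewrite /= -catA; apply: run_push.
Qed.

Lemma pt_fst A B {EA : Enc A} {EB : Enc B} : pt (@fst A B).
Proof.
apply: (pt_of (p := Case RX (Seq swapX dropX) Skip Skip) (h := fun a => 30 * sz a)).
  by apply: pbd_mul (pbd_const _) pbd_sz.
move=> [a b] l x; rewrite sz_pair /=.
apply: (@run_le _ _ (20 * (sz a + sz b) + 10 * sz b).+1); first lia.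
apply: run_caseT; [reflexivity|] => /=; rewrite -catA.
by apply: run_seq (run_swap _ _ _ _) (run_drop _ _ _).
Qed.

Lemma pt_snd A B {EA : Enc A} {EB : Enc B} : pt (@snd A B).
Proof.
apply: (pt_of (p := Case RX dropX Skip Skip) (h := fun a => 30 * sz a)).
  by apply: pbd_mul (pbd_const _) pbd_sz.
move=> [a b] l x; rewrite sz_pair /=.
apply: (@run_le _ _ (10 * sz a).+1); first lia.
by apply: run_caseT; [reflexivity|] => /=; rewrite -catA; apply: run_drop.
Qed.

Lemma pt_if A B {EA : Enc A} {EB : Enc B} (c : A -> bool) (f g : A -> B) :
  pt c -> pt f -> pt g -> pt (fun a => if c a then f a else g a).
Proof.
move=> /pt_ex [r [m [bm M]]] /pt_ex [p [h [bh H]]] /pt_ex [q [k [bk K]]].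
apply: (pt_of (p := Seq dupX (Seq r (Case RX (Seq (Seq dropX dropX) p) q Skip)))
  (h := fun a => 30 * sz a + (m a + (20 + h a + k a).+1))).
  apply: pbd_add; first by apply: pbd_mul (pbd_const _) pbd_sz.
  by apply: pbd_add => //; apply: pbd_S; apply: pbd_add => //; apply: pbd_add => //; apply: pbd_const.
move=> a l x; apply: run_seq (run_dup _ _ _) _; apply: run_seq (M _ _ _) _.
case: (c a) => /=.
  apply: run_caseT; [reflexivity|] => /=; apply: (@run_le _ _ (10 * 1 + 10 * 1 + h a)); first lia.
  apply: run_seq (H _ _ _); apply: run_seq; first exact: (@run_drop Leaf).
  exact: (@run_drop Leaf).
by apply: run_caseF; [reflexivity|] => /=; apply: run_le (K _ _ _); lia.
Qed.

Lemma pt_cons A B {EA : Enc A} {EB : Enc B} (f : A -> B) (g : A -> seq B) :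
  pt f -> pt g -> pt (fun a => f a :: g a).
Proof.
move=> pf pg; apply: (pt_comp (f := fun p : B * seq B => p.1 :: p.2)) (pt_pair pf pg).
exact: pt_recode.
Qed.

(** The leading bit of the code of [l a] tells the empty list from a nonempty one. *)
Lemma pt_case A B T {EA : Enc A} {EB : Enc B} {ET : Enc T} (l : A -> seq T) (f : A -> B)
    (g : A -> T -> seq T -> B) :
  pt l -> pt f -> pt (fun p : A * (T * seq T) => g p.1 p.2.1 p.2.2) ->
  pt (fun a => if l a is x :: r then g a x r else f a).
Proof.
move=> /pt_ex [r [m [bm M]]] /pt_ex [p [h [bh H]]] pg.
have pl : pt l by exact: pt_of bm M.
have [q [k [bk K]]] : exists q k, [/\ pbd k & forall a x s lf w, l a = x :: s ->
    run q (stk lf (code (enc x) ++ code (enc s) ++ code (enc a) ++ w)) (k a) (stk lf (code (enc (g a x s)) ++ w))].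
  have [q [k [bk K]]] := pt_ex pg; case: bk => d D.
  (* The test has consumed the leading bit of [x :: s]. Pushing it again restores the code, which is
     also that of the pair [(x, s)]; after a swap, another [true] forms [(a, (x, s))]. *)
  exists (Seq (Push RX true) (Seq swapX (Seq (Push RX true) q))).
  exists (fun a => 1 + (20 * ((sz (l a)) + sz a) + (1 + (sz a + sz (l a) + 3) ^ d))); split.
    have bl := pt_sz pl; have b0 := @pbd_sz A EA.
    by do !(assumption || apply: pbd_add || apply: pbd_mul || apply: pbd_exp || apply: pbd_const).
  move=> a x s lf w e; apply: run_seq (run_push _ _ _) _.
  have -> : set (stk lf (code (enc x) ++ code (enc s) ++ code (enc a) ++ w)) RX (true ::
      get (stk lf (code (enc x) ++ code (enc s) ++ code (enc a) ++ w)) RX) =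
     stk lf (code (enc (l a)) ++ code (enc a) ++ w) by rewrite e /= -catA.
  apply: run_seq (run_swap _ _ _ _) _; apply: run_seq (run_push _ _ _) _.
  have := K (a, (x, s)) lf w => /=; rewrite -catA e.
  apply: run_le; apply: leq_trans (D _) _; rewrite sz_pair sz_pair sz_cons /=.
  by case: (d) => // d'; rewrite leq_exp2r; lia.
apply: (pt_of (p := Seq dupX (Seq r (Case RX q p Skip)))
  (h := fun a => 30 * sz a + (m a + (k a + h a).+1))).
  apply: pbd_add; first by apply: pbd_mul (pbd_const _) pbd_sz.
  by apply: pbd_add => //; apply: pbd_S; apply: pbd_add.
move=> a lf w; apply: run_seq (run_dup _ _ _) _; apply: run_seq (M _ _ _) _.
case E: (l a) => [|x s] /=.
  by apply: run_caseF; [reflexivity|] => /=; apply: run_le (H _ _ _); lia.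
apply: run_caseT; [reflexivity|] => /=; rewrite -catA; apply: run_le (K _ _ _ _ _ E); lia.
Qed.

(** The list [l e] acts as a unary counter. The bound [h] on all iterates is essential: a
    polynomial-time step may double the size of its argument, and iterates could then grow
    exponentially. *)
Lemma pt_iter E A T {EE : Enc E} {EA : Enc A} {ET : Enc T} (f : A -> A) (l : E -> seq T)
    (g : E -> A) (h : E -> nat) : pt f -> pt l -> pt g -> pbd h ->
  (forall e i, i <= size (l e) -> sz (iter i f (g e)) <= h e) ->
  pt (fun e => iter (size (l e)) f (g e)).
Proof.
move=> pf pl pg bh H; have [r [m [bm M]]] := pt_ex pl; have [p [c P]] := pf.
have [q [k [bk K]]] := pt_ex pg.
pose body := Case RX (Seq dropX (Seq swapX (Seq p (Seq swapX (Push RC true))))) Skip Skip.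
have core lf w Hh L : forall (s : seq T) a, (forall i, i <= size s -> sz (iter i f a) <= Hh) -> sz s <= L ->
    run (While RC body) (Store lf (code (enc s) ++ code (enc a) ++ w) [::] [::] [:: true])
      (size s * (100 + 100 * L + 100 * Hh + (Hh + 2) ^ c) + 4) (stk lf (code (enc (iter (size s) f a)) ++ w)).
  move EK: (100 + 100 * L + _ + _) => KK; elim=> [|x s IH] a {}H leL.
    rewrite /= (_ : 4 = (2 + 1).+1) //; apply: run_whileT; [reflexivity| |exact: run_whileN].
    by apply: run_caseF; [reflexivity|exact: run_skip].
  rewrite /= mulSn -addnA.
  move: leL; rewrite sz_cons => leL.
  have h0 := H 0 isT; have h1 := H 1 isT; rewrite /= in h0 h1.
  apply: (@run_le _ _ ((10 * sz x + (20 * (sz s + sz a) + ((sz a + 2) ^ c + (20 * (sz (f a) + sz s) + 1)))).+1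
      + (size s * KK + 4)).+1).
    have : (sz a + 2) ^ c <= (Hh + 2) ^ c by case: (c) => // d; rewrite leq_exp2r; lia.
    by rewrite -EK; lia.
  rewrite -iterS iterSr; apply: run_whileT; [reflexivity| |].
    apply: run_caseT; [reflexivity|] => /=; rewrite -catA.
    apply: run_seq (run_drop _ _ _) _; apply: run_seq (run_swap _ _ _ _) _.
    apply: run_seq (P _ _ _) _; apply: run_seq (run_swap _ _ _ _) _; exact: run_push.
  by apply: IH; [move=> i le; have := H i.+1; rewrite iterSr; apply|lia].
apply: (pt_of (p := Seq dupX (Seq q (Seq swapX (Seq r (Seq (Push RC true) (While RC body))))))
 (h := fun a => 30 * sz a + (k a + (20 * (sz (g a) + sz a) + (m a + (1 + (sz (l a) * (100 + 100 * sz (l a) + 100 * h a + (h a + 2) ^ c) + 4))))))).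
  have b0 := @pbd_sz E EE; have bl := pt_sz pl; have bg := pt_sz pg.
  by do !(assumption || apply: pbd_add || apply: pbd_mul || apply: pbd_exp || apply: pbd_const).
move=> a lf w; apply: run_seq (run_dup _ _ _) _; apply: run_seq (K _ _ _) _.
apply: run_seq (run_swap _ _ _ _) _; apply: run_seq (M _ _ _) _.
apply: run_seq (run_push _ _ _) _.
apply: run_le (core _ _ (h a) (sz (l a)) _ _ (H a) (leqnn _)).
rewrite leq_add2r leq_mul2r; apply/orP; right.
by elim: (l a) => // x s IH; rewrite sz_cons /=; have := sz_gt0 x; lia.
Qed.

(** The environment is carried along unchanged as a component of the iterated value. *)
Lemma pt_iter_env E A T {EE : Enc E} {EA : Enc A} {ET : Enc T} (F : E -> A -> A) (l : E -> seq T)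
    (g : E -> A) (h : E -> nat) : pt (fun p : E * A => F p.1 p.2) -> pt l -> pt g -> pbd h ->
  (forall e i, i <= size (l e) -> sz (iter i (F e) (g e)) <= h e) ->
  pt (fun e => iter (size (l e)) (F e) (g e)).
Proof.
move=> pF pl pg bh H.
have e i e' a : iter i (fun p : E * A => (p.1, F p.1 p.2)) (e', a) = (e', iter i (F e') a).
  by elim: i => //= i ->.
apply: (pt_ext (f := fun e' => (iter (size (l e')) (fun p : E * A => (p.1, F p.1 p.2)) (e', g e')).2)).
  by move=> e'; rewrite e.
apply: pt_comp; first exact: pt_snd.
apply: (@pt_iter _ _ _ _ _ _ _ _ _ (fun e => (sz e + h e).+1)) => //.
- exact: pt_pair (pt_fst) pF.
- exact: pt_pair pt_id pg.
- by apply: pbd_S; apply: pbd_add => //; apply: pbd_sz.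
- by move=> e' i le; rewrite e sz_pair ltnS leq_add2l H.
Qed.

Lemma pt_comp2 A B C D {EA : Enc A} {EB : Enc B} {EC : Enc C} {ED : Enc D} (g : B -> C -> D)
    (f1 : A -> B) (f2 : A -> C) : pt (fun p : B * C => g p.1 p.2) -> pt f1 -> pt f2 ->
  pt (fun a => g (f1 a) (f2 a)).
Proof. by move=> pg p1 p2; apply: (pt_comp pg (pt_pair p1 p2)). Qed.

Lemma pt_comp3 A B C D F {EA : Enc A} {EB : Enc B} {EC : Enc C} {ED : Enc D} {EF : Enc F}
    (g : B -> C -> D -> F) (f1 : A -> B) (f2 : A -> C) (f3 : A -> D) :
  pt (fun p : B * (C * D) => g p.1 p.2.1 p.2.2) -> pt f1 -> pt f2 -> pt f3 ->
  pt (fun a => g (f1 a) (f2 a) (f3 a)).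
Proof. by move=> pg p1 p2 p3; apply: (pt_comp pg (pt_pair p1 (pt_pair p2 p3))). Qed.

Lemma pt_fst1 A B C {EA : Enc A} {EB : Enc B} {EC : Enc C} (f : A -> B * C) :
  pt f -> pt (fun a => (f a).1).
Proof. exact: pt_comp pt_fst. Qed.
Lemma pt_snd1 A B C {EA : Enc A} {EB : Enc B} {EC : Enc C} (f : A -> B * C) :
  pt f -> pt (fun a => (f a).2).
Proof. exact: pt_comp pt_snd. Qed.

Lemma pt_pairl A B {EA : Enc A} {EB : Enc B} (a : A) : pt (@pair A B a).
Proof. exact: pt_pair (pt_const a) pt_id. Qed.
Lemma pt_consl A {EA : Enc A} (a : A) : pt (cons a).
Proof. exact: pt_cons (pt_const a) pt_id. Qed.

(* One hint per construction turns the closure properties into a search guided by the syntax of the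
   function. *)
Create HintDb pt.
#[global] Hint Extern 0 (pt (pair _)) => simple eapply pt_pairl : pt.
#[global] Hint Extern 0 (pt (cons _)) => simple eapply pt_consl : pt.
#[global] Hint Extern 0 (pt (fun _ => (_, _))) => simple eapply pt_pair : pt.
#[global] Hint Extern 0 (pt (fun _ => fst _)) => simple eapply pt_fst1 : pt.
#[global] Hint Extern 0 (pt (fun _ => snd _)) => simple eapply pt_snd1 : pt.
#[global] Hint Extern 0 (pt (fun _ => if _ then _ else _)) => simple eapply pt_if : pt.
#[global] Hint Extern 0 (pt (fun _ => _ :: _)) => simple eapply pt_cons : pt.
#[global] Hint Extern 0 (pt fst) => simple eapply pt_fst : pt.
#[global] Hint Extern 0 (pt snd) => simple eapply pt_snd : pt.
#[global] Hint Extern 0 (pt (fun _ => _)) => simple eapply pt_id || simple eapply pt_const : pt.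
Ltac pts := lazymatch goal with |- pt _ => solve [eauto 60 with pt nocore] end.

Create HintDb pbd.
#[global] Hint Resolve pbd_const pbd_sz pbd_add pbd_mul pbd_exp pbd_S pt_sz : pbd.
Ltac pbds := lazymatch goal with |- pbd _ => solve [eauto 60 with pbd pt nocore] end.

(** * Polynomial-time list functions *)

Lemma size_sz T {ET : Enc T} (s : seq T) : size s <= sz s.
Proof. by elim: s => // x s IH; rewrite sz_cons /=; have := sz_gt0 x; lia. Qed.

Lemma sz_seq T {ET : Enc T} (s : seq T) : sz s = (sumn [seq (sz x).+1 | x <- s]).+1.
Proof. by elim: s => // x s IH; rewrite sz_cons IH /=; lia. Qed.

Lemma sz_cat T {ET : Enc T} (s t : seq T) : sz (s ++ t) + 1 = sz s + sz t.
Proof. by rewrite !sz_seq map_cat sumn_cat; lia. Qed.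
Lemma sz_rev T {ET : Enc T} (s : seq T) : sz (rev s) = sz s.
Proof. by rewrite !sz_seq map_rev sumn_rev. Qed.
Lemma sz_take T {ET : Enc T} k (s : seq T) : sz (take k s) <= sz s.
Proof. by have := @sz_cat _ ET (take k s) (drop k s); rewrite cat_take_drop; have := @sz_gt0 _ (Enc_seq ET) (drop k s); lia. Qed.
Lemma sz_drop T {ET : Enc T} k (s : seq T) : sz (drop k s) <= sz s.
Proof. by have := @sz_cat _ ET (take k s) (drop k s); rewrite cat_take_drop; have := @sz_gt0 _ (Enc_seq ET) (take k s); lia. Qed.

Lemma pt_foldl E A T {EE : Enc E} {EA : Enc A} {ET : Enc T} (f : E -> A -> T -> A) (l : E -> seq T)
    (g : E -> A) (h : E -> nat) : pt (fun p : E * (A * T) => f p.1 p.2.1 p.2.2) -> pt l -> pt g -> pbd h ->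
  (forall e i, i <= size (l e) -> sz (foldl (f e) (g e) (take i (l e))) <= h e) ->
  pt (fun e => foldl (f e) (g e) (l e)).
Proof.
move=> pf pl pg bh H.
pose F e (p : A * seq T) := if p.2 is x :: s then (f e p.1 x, s) else p.
have FE i e a s : iter i (F e) (a, s) = (foldl (f e) a (take i s), drop i s).
  elim: i a s => [|i IH] a s; first by rewrite take0 drop0.
  by rewrite iterSr; case: s => [|x s]; rewrite IH //= !(take0, drop0).
apply: (pt_ext (f := fun e => (iter (size (l e)) (F e) (g e, l e)).1)).
  by move=> e; rewrite FE take_size.
apply: pt_fst1; apply: (@pt_iter_env _ _ _ _ _ _ F l _ (fun e => (h e + sz (l e)).+1)) => //.
- apply: (pt_case (g := fun (p : E * (A * seq T)) x s => (f p.1 p.2.1 x, s))); try pts.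
  apply: pt_pair; last by pts.
  by apply: (pt_comp3 (g := f)); pts.
- pts.
- pbds.
- move=> e i le; rewrite FE sz_pair ltnS leq_add ?H //; exact: sz_drop.
Qed.

Lemma pt_rev E T {EE : Enc E} {ET : Enc T} (l : E -> seq T) : pt l -> pt (fun e => rev (l e)).
Proof.
move=> pl.
have e (s acc : seq T) : foldl (fun acc x => x :: acc) acc s = catrev s acc by elim: s acc => //=.
apply: (pt_ext (f := fun e => foldl (fun acc x => x :: acc) [::] (l e))); first by move=> a; rewrite e.
apply: (@pt_foldl _ _ _ _ _ _ (fun _ acc x => x :: acc) _ _ (fun e => sz (l e))); try pts; try pbds.
by move=> a i le; rewrite e -/(rev _) sz_rev; apply: sz_take.
Qed.

Lemma sz_map_le A T {EA : Enc A} {ET : Enc T} (g : T -> A) N K (s : seq T) :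
  (forall x, sz x <= N -> sz (g x) < K) -> sz s <= N -> sz (map g s) <= (size s * K).+1.
Proof.
move=> H; elim: s => //= x s IH; rewrite !sz_cons mulSn => le.
by have := H x; have := IH; lia.
Qed.

Lemma pt_map E A T {EE : Enc E} {EA : Enc A} {ET : Enc T} (f : E -> T -> A) (l : E -> seq T) :
  pt (fun p : E * T => f p.1 p.2) -> pt l -> pt (fun e => map (f e) (l e)).
Proof.
move=> pf pl.
have e (g : T -> A) (s : seq T) acc : foldl (fun acc x => g x :: acc) acc s = catrev (map g s) acc.
  by elim: s acc => //=.
apply: (pt_ext (f := fun e => rev (foldl (fun acc x => f e x :: acc) [::] (l e)))).
  by move=> a; rewrite e -/(rev _) revK.
have [c H] := pt_sz pf.
apply: pt_rev.
apply: (@pt_foldl _ _ _ _ _ _ (fun e acc x => f e x :: acc) _ _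
  (fun e => (sz (l e) * ((sz e + sz (l e) + 3) ^ c).+1).+1)) => //; try pts; try pbds.
  by apply: pt_cons; [apply: (pt_comp2 (g := f)); pts|pts].
move=> a i le; rewrite e -/(rev _) sz_rev.
apply: leq_trans (sz_map_le (N := sz (l a)) (K := ((sz a + sz (l a) + 3) ^ c).+1) _ (sz_take _ _)) _.
  move=> x lex; rewrite ltnS; apply: leq_trans (H (a, x)) _; rewrite sz_pair /=.
  by case: (c) => // d; rewrite leq_exp2r //; lia.
rewrite ltnS leq_mul2r; apply/orP; right.
by apply: leq_trans (size_sz _) (sz_take _ _).
Qed.

Lemma pt_cat E T {EE : Enc E} {ET : Enc T} (l r : E -> seq T) :
  pt l -> pt r -> pt (fun e => l e ++ r e).
Proof.
move=> pl pr.
have e (s acc : seq T) : foldl (fun acc x => x :: acc) acc s = rev s ++ acc.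
  by rewrite -catrevE; elim: s acc => //=.
apply: (pt_ext (f := fun e => foldl (fun acc x => x :: acc) (r e) (rev (l e)))).
  by move=> a; rewrite e revK.
apply: (@pt_foldl _ _ _ _ _ _ (fun _ acc x => x :: acc) _ _ (fun e => sz (l e) + sz (r e)));
  try pts; try pbds; first exact: pt_rev.
move=> a i le; rewrite e; have := @sz_cat _ ET (rev (take i (rev (l a)))) (r a).
by have := @sz_take _ ET i (rev (l a)); rewrite !sz_rev; lia.
Qed.
#[global] Hint Extern 0 (pt (fun _ => rev _)) => simple eapply pt_rev : pt.
#[global] Hint Extern 0 (pt (fun _ => _ ++ _)) => simple eapply pt_cat : pt.

Lemma sz_flatten_take T {ET : Enc T} i (ll : seq (seq T)) : sz (flatten (take i ll)) <= sz ll.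
Proof.
elim: ll i => [|l ll IH] [|i] //=; rewrite sz_cons.
by have := IH i; have := @sz_cat _ ET l (flatten (take i ll)); lia.
Qed.

Lemma pt_flatten E T {EE : Enc E} {ET : Enc T} (ll : E -> seq (seq T)) :
  pt ll -> pt (fun e => flatten (ll e)).
Proof.
move=> pl.
have e (s : seq (seq T)) acc : foldl (fun acc x => acc ++ x) acc s = acc ++ flatten s.
  by elim: s acc => [|x s IH] acc //=; rewrite ?cats0 // IH catA.
apply: (pt_ext (f := fun e => foldl (fun acc x => acc ++ x) [::] (ll e))).
  by move=> a; rewrite e.
apply: (@pt_foldl _ _ _ _ _ _ (fun _ acc x => acc ++ x) _ _ (fun e => sz (ll e)));
  try pts; try pbds.
by move=> a i le; rewrite e; apply: sz_flatten_take.
Qed.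

Lemma pt_behead E T {EE : Enc E} {ET : Enc T} (l : E -> seq T) : pt l -> pt (fun e => behead (l e)).
Proof.
move=> pl; apply: (pt_ext (f := fun e => if l e is x :: r then r else [::])); first by move=> e; case: (l e).
by apply: pt_case; pts.
Qed.

Lemma pt_head E T {EE : Enc E} {ET : Enc T} x0 (l : E -> seq T) : pt l -> pt (fun e => head x0 (l e)).
Proof.
move=> pl; apply: (pt_ext (f := fun e => if l e is x :: r then x else x0)); first by move=> e; case: (l e).
by apply: pt_case; pts.
Qed.
#[global] Hint Extern 0 (pt (fun _ => flatten _)) => simple eapply pt_flatten : pt.
#[global] Hint Extern 0 (pt (fun _ => behead _)) => simple eapply pt_behead : pt.
#[global] Hint Extern 0 (pt (fun _ => head _ _)) => simple eapply pt_head : pt.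

Lemma pt_drop E T U {EE : Enc E} {ET : Enc T} {EU : Enc U} (k : E -> seq U) (l : E -> seq T) :
  pt k -> pt l -> pt (fun e => drop (size (k e)) (l e)).
Proof.
move=> pk pl; have e i (s : seq T) : iter i behead s = drop i s.
  by elim: i s => [|i IH] s; rewrite ?drop0 // iterSr IH; case: s.
apply: (pt_ext (f := fun e => iter (size (k e)) behead (l e))); first by move=> a; rewrite e.
apply: (@pt_iter_env _ _ _ _ _ _ (fun _ s => behead s) k l (fun e => sz (l e))); try pts; try pbds.
by move=> a i _; rewrite e; apply: sz_drop.
Qed.

Lemma pt_nth E T {EE : Enc E} {ET : Enc T} x0 (l : E -> seq T) i : pt l -> pt (fun e => nth x0 (l e) i).
Proof.
move=> pl; apply: (pt_ext (f := fun e => head x0 (iter i behead (l e)))).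
  by move=> e; elim: i (l e) => [|i IH] s; [case: s|rewrite iterSr IH; case: s => [|x s] //=; rewrite nth_nil].
by apply: pt_head; elim: i => //= i IH; apply: pt_behead.
Qed.
#[global] Hint Extern 0 (pt (fun _ => nth _ _ _)) => simple eapply pt_nth : pt.
#[global] Hint Extern 0 (pt (fun _ => drop (size _) _)) => simple eapply pt_drop : pt.

Lemma pt_const_map E A I {EE : Enc E} {EA : Enc A} (f : I -> E -> A) (s : seq I) :
  (forall i, pt (f i)) -> pt (fun e => [seq f i e | i <- s]).
Proof. by move=> pf; elim: s => [|i s IH] /=; [apply: pt_const|apply: pt_cons]. Qed.

Lemma pt_const_big E A I {EE : Enc E} {EA : Enc A} (op : A -> A -> A) x0 (f : I -> E -> A) (s : seq I) :
  pt (fun p : A * A => op p.1 p.2) -> (forall i, pt (f i)) ->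
  pt (fun e => foldr op x0 [seq f i e | i <- s]).
Proof.
move=> po pf; elim: s => [|i s IH] /=; first exact: pt_const.
exact: (pt_comp2 (g := op)).
Qed.

Lemma pt_neg E {EE : Enc E} (c : E -> bool) : pt c -> pt (fun e => ~~ c e).
Proof.
move=> pc; apply: (pt_ext (f := fun e => if c e then false else true)); first by move=> e; case: (c e).
pts.
Qed.
Lemma pt_and E {EE : Enc E} (c d : E -> bool) : pt c -> pt d -> pt (fun e => c e && d e).
Proof. by move=> pc pd; rewrite /andb; pts. Qed.
Lemma pt_or E {EE : Enc E} (c d : E -> bool) : pt c -> pt d -> pt (fun e => c e || d e).
Proof. by move=> pc pd; rewrite /orb; pts. Qed.
Lemma pt_xor E {EE : Enc E} (c d : E -> bool) : pt c -> pt d -> pt (fun e => c e (+) d e).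
Proof.
move=> pc pd; apply: (pt_ext (f := fun e => if c e then ~~ d e else d e)); first by move=> e; case: (c e).
by apply: pt_if => //; apply: pt_neg.
Qed.
#[global] Hint Extern 0 (pt (fun _ => ~~ _)) => simple eapply pt_neg : pt.
#[global] Hint Extern 0 (pt (fun _ => _ && _)) => simple eapply pt_and : pt.
#[global] Hint Extern 0 (pt (fun _ => _ || _)) => simple eapply pt_or : pt.
#[global] Hint Extern 0 (pt (fun _ => _ (+) _)) => simple eapply pt_xor : pt.

Lemma pt_nilp E T {EE : Enc E} {ET : Enc T} (l : E -> seq T) : pt l -> pt (fun e => nilp (l e)).
Proof.
move=> pl; apply: (pt_ext (f := fun e => if l e is x :: r then false else true)); first by move=> e; case: (l e).
by apply: pt_case; pts.
Qed.
#[global] Hint Extern 0 (pt (fun _ => nilp _)) => simple eapply pt_nilp : pt.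

Lemma pt_all E T {EE : Enc E} {ET : Enc T} (f : E -> T -> bool) (l : E -> seq T) :
  pt (fun p : E * T => f p.1 p.2) -> pt l -> pt (fun e => all (f e) (l e)).
Proof.
move=> pf pl.
have e (g : T -> bool) (s : seq T) b : foldl (fun b x => b && g x) b s = b && all g s.
  by elim: s b => [|x s IH] b /=; rewrite ?andbT // IH andbA.
apply: (pt_ext (f := fun e => foldl (fun b x => b && f e x) true (l e))); first by move=> a; rewrite e.
apply: (@pt_foldl _ _ _ _ _ _ (fun e b x => b && f e x) _ _ (fun e => 3)); try pts; try pbds.
  by apply: pt_and; [pts|apply: (pt_comp2 (g := f)); pts].
by move=> a i _; apply: sz_bool.
Qed.

(* Codes are prefix-free, so equality of the two topmost values is equality of bit strings. *)
Definition clear r := Seq (Push RC true) (While RC (Case r (Push RC true) (Push RC true) Skip)).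
Definition differ := Seq (clear RY) (Seq (clear RZ) (Push RX false)).
Definition eqX :=
  Seq (moveX true false) (Seq (moveX false true) (Seq (Push RC true) (While RC
   (Case RY (Case RZ (Push RC true) differ differ)
            (Case RZ differ (Push RC true) differ)
            (Case RZ differ differ (Seq (Push RX false) (Seq (Push RX false) (Push RX true)))))))).

Lemma run_clear r s : r <> RC -> gC s = [::] -> run (clear r) s (3 * size (get s r) + 5) (set s r [::]).
Proof.
move=> rC; case: s => L X Y Z C /= cs; subst C.
apply: (@run_le _ _ (1 + (3 * size (get (Store L X Y Z [::]) r) + 4))); first lia.
apply: run_seq (run_push _ _ _) _.
case: r rC => //= _; 
  [elim: L => [|b l IH]|elim: X => [|b l IH]|elim: Y => [|b l IH]|elim: Z => [|b l IH]].
1,3,5,7: apply: (@run_le _ _ (2 + 1).+1) => //; apply: run_whileT; [reflexivity| |exact: run_whileN].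
1,2,3,4: by apply: run_caseN => //; exact: run_skip.
all: apply: (@run_le _ _ (2 + (3 * size l + 4)).+1); first by rewrite /=; lia.
all: apply: run_whileT IH; first reflexivity.
all: by case: b; [apply: run_caseT|apply: run_caseF]; try reflexivity; apply: run_push.
Qed.

Lemma run_eq l x v w : run eqX (stk l (code v ++ code w ++ x)) (30 * (size (code v) + size (code w)))
  (stk l (code (enc (rev (code v) == rev (code w))) ++ x)).
Proof.
have g0 := code_gt0 v; have g1 := code_gt0 w.
apply: (@run_le _ _ (10 * size (code v) + (10 * size (code w) +
   (1 + (3 * (size (rev (code v)) + size (rev (code w))) + 20))))); first by rewrite !size_rev; lia.
apply: run_seq (run_moveX true false _ _ _ _ _) _; rewrite cats0.
apply: run_seq (run_moveX false true _ _ _ _ _) _; rewrite cats0.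
apply: run_seq (run_push _ _ _) _ => /=.
move: (rev (code v)) (rev (code w)) => s t {v w g0 g1}.
have D s' t' : run differ (Store l x s' t' [::]) (3 * (size s' + size t') + 11) (Store l (false :: x) [::] [::] [::]).
  apply: (@run_le _ _ ((3 * size s' + 5) + ((3 * size t' + 5) + 1))); first lia.
  by apply: run_seq (run_clear _ _) _ => //; apply: run_seq (run_clear _ _) (run_push _ _ _).
elim: s t => [|a s IH] [|b t] /=.
- apply: (@run_le _ _ (5 + 1).+1); first lia.
  apply: run_whileT; [reflexivity| |exact: run_whileN].
  apply: run_caseN => //; apply: run_caseN => //; apply: (@run_seq _ _ _ 1 _ 2); first exact: run_push.
  by apply: (@run_seq _ _ _ 1 _ 1); apply: run_push.
- apply: (@run_le _ _ ((3 * (0 + size t) + 11).+2 + 1).+1); first lia.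
  apply: run_whileT; [reflexivity| |exact: run_whileN].
  by apply: run_caseN => //; case: b; [apply: run_caseT|apply: run_caseF]; try reflexivity; apply: D.
- apply: (@run_le _ _ ((3 * (size s + 0) + 11).+2 + 1).+1); first lia.
  apply: run_whileT; [reflexivity| |exact: run_whileN].
  by case: a; [apply: run_caseT|apply: run_caseF]; try reflexivity; apply: run_caseN => //; apply: D.
rewrite eqseq_cons; case: eqP => [<-|ne] /=.
  apply: (@run_le _ _ (3 + (3 * (size s + size t) + 20)).+1); first lia.
  apply: run_whileT (IH t); first reflexivity.
  case: a.
    by apply: run_caseT; [reflexivity|]; apply: run_caseT; [reflexivity|]; apply: run_push.
  by apply: run_caseF; [reflexivity|]; apply: run_caseF; [reflexivity|]; apply: run_push.
apply: (@run_le _ _ ((3 * (size s + size t) + 11).+2 + 1).+1); first lia.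
apply: run_whileT; [reflexivity| |exact: run_whileN].
case: a b ne => -[] // _.
  by apply: run_caseT; [reflexivity|]; apply: run_caseF; [reflexivity|]; apply: D.
by apply: run_caseF; [reflexivity|]; apply: run_caseT; [reflexivity|]; apply: D.
Qed.

Lemma code_inj_cat v w s t : code v ++ s = code w ++ t -> v = w /\ s = t.
Proof.
elim: v w s t => [|a IHa b IHb] [|c d] s t //=; first by case.
by case; rewrite -!catA => /IHa [-> /IHb [-> ->]].
Qed.

Lemma code_inj : injective code.
Proof. by move=> v w e; have [] := @code_inj_cat v w [::] [::]; rewrite ?e. Qed.

Lemma pt_eq E (T : eqType) {EE : Enc E} {ET : Enc T} (f g : E -> T) :
  injective (@enc T ET) -> pt f -> pt g -> pt (fun e => f e == g e).
Proof.
move=> inj pf pg; apply: (pt_comp2 (g := fun x y : T => x == y)) => //.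
apply: (pt_of (p := Case RX eqX Skip Skip) (h := fun p : T * T => (30 * sz p).+1)); first by pbds.
move=> [a b] l x; rewrite sz_pair /=; apply: run_caseT; [reflexivity|] => /=; rewrite -catA.
have -> : (a == b) = (rev (code (enc a)) == rev (code (enc b))).
  by apply/eqP/eqP => [->//|/(can_inj revK)/code_inj/inj].
by apply: run_le (run_eq _ _ _ _); rewrite /sz; lia.
Qed.

Lemma enc_inj_unit : injective (@enc unit _). Proof. by case; case. Qed.
Lemma enc_inj_bool : injective (@enc bool _). Proof. by case; case. Qed.
Lemma enc_inj_pair A B {EA : Enc A} {EB : Enc B} : injective (@enc A _) -> injective (@enc B _) ->
  injective (@enc (A * B) _).
Proof. by move=> ia ib [a b] [c d] [/ia -> /ib ->]. Qed.
Lemma enc_inj_seq A {EA : Enc A} : injective (@enc A _) -> injective (@enc (seq A) _).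
Proof. by move=> ia; elim=> [|a s IH] [|b t] //= [/ia -> /IH ->]. Qed.

Definition Enc_fin (S : finType) : Enc S := fun s => enc (nseq (enum_rank s) tt).
Arguments Enc_fin : clear implicits.

Lemma enc_inj_fin (S : finType) : injective (@enc S (Enc_fin S)).
Proof.
move=> s t /(enc_inj_seq enc_inj_unit) e; apply: enum_rank_inj; apply: val_inj => /=.
by rewrite -(size_nseq (enum_rank s) tt) e size_nseq.
Qed.

(** A chain of equality tests over [enum S]. No algorithm for the dependence of [f] on [s] is asked
    for: each [f s] has its own program. This is how arbitrary finite tables enter the machine. *)
Lemma pt_fincase E A (S : finType) {EE : Enc E} {EA : Enc A} {ES : Enc S} (g : E -> S) (f : S -> E -> A) :
  injective (@enc S ES) -> pt g -> (forall s, pt (f s)) -> pt (fun e => f (g e) e).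
Proof.
move=> inj pg pf.
have : forall e, g e \in enum S by move=> e; rewrite mem_enum.
(* If [S] is empty, then [g] shows that [E] is empty, and any program will do. *)
case: (enum S) => [|s0 l] H; first by exists Skip, 0 => a; have := H a; rewrite in_nil.
pose F (l : seq S) e := foldr (fun s r => if g e == s then f s e else r) (f s0 e) l.
apply: (pt_ext (f := F l)) => [e|].
  have := H e; rewrite inE => /orP [/eqP ge|].
    by elim: l {H} => //= [|s l IH]; [rewrite ge|case: eqP => [->|]].
  by elim: l {H} => //= s l IH; rewrite inE; case: eqP => [->|].
rewrite /F; elim: l {H F} => [|s l IH] //=.
by apply: pt_if => //; apply: pt_eq => //; pts.
Qed.

Lemma pt_fin E A (S : finType) {EE : Enc E} {EA : Enc A} {ES : Enc S} (g : E -> S) (f : S -> A) :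
  injective (@enc S ES) -> pt g -> pt (fun e => f (g e)).
Proof.
move=> inj pg; apply: (pt_fincase (f := fun s _ => f s)) => // s; exact: pt_const.
Qed.

(** * Binary arithmetic *)

Definition unb (l : seq bool) := foldr (fun (b : bool) acc => b + acc.*2) 0 l.

Lemma bits_aux_fuel f g n : n <= f -> n <= g -> bits_aux f n = bits_aux g n.
Proof.
elim: f g n => [|f IH] [|g] n //=; rewrite ?leqn0; do ?[by move/eqP -> | by move=> _ /eqP ->].
by move=> l1 l2; case: eqP => // ne; rewrite (IH g) //; lia.
Qed.

Lemma bitsE n : bits n = if n == 0 then [::] else odd n :: bits n./2.
Proof. by case: n => // n; rewrite /bits /=; congr (_ :: _); apply: bits_aux_fuel; lia. Qed.

Lemma bits_double (b : bool) n : bits (b + n.*2) = if (n == 0) && ~~ b then [::] else b :: bits n.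
Proof.
rewrite bitsE addn_eq0 double_eq0 eqb0 andbC; case: ifP => // _.
by rewrite oddD odd_double addbF half_bit_double; case: b.
Qed.

Lemma unb_bits n : unb (bits n) = n.
Proof.
elim/ltn_ind: n => n IH; rewrite bitsE; case: eqP => [->//|ne] /=.
by rewrite IH ?odd_double_half //; lia.
Qed.

Lemma bits_eq0 n : nilp (bits n) = (n == 0).
Proof. by rewrite bitsE; case: eqP. Qed.

(** A number is encoded by its canonical bits, least significant first; results of bitwise
    arithmetic have to lose their high zeros, which sit at the end of the list. *)
Definition trim (l : seq bool) := foldr (fun b acc => if nilp acc && ~~ b then [::] else b :: acc) [::] l.

Lemma bits_unb l : bits (unb l) = trim l.
Proof. by elim: l => //= b l IH; rewrite bits_double -bits_eq0 IH. Qed.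

Lemma unb_lt l : unb l < 2 ^ size l.
Proof. by elim: l => //= b l IH; rewrite expnS; case: b; lia. Qed.

Lemma unb_rcons s b : unb (rcons s b) = unb s + b * 2 ^ size s.
Proof. by elim: s => [|c s IH] /=; rewrite ?muln1 ?addn0 // IH expnS; lia. Qed.


Lemma size_bits_le n k : n < 2 ^ k -> size (bits n) <= k.
Proof.
elim: k n => [|k IH] n lt; rewrite bitsE; first by have -> : n == 0 by lia.
by case: eqP => //= ne; apply: IH; move: lt; rewrite expnS; lia.
Qed.

Lemma bits_lt n : n < 2 ^ size (bits n).
Proof. by rewrite -{1}(unb_bits n); apply: unb_lt. Qed.


#[global] Instance Enc_nat : Enc nat := fun n => enc (bits n).

Lemma enc_inj_nat : injective (@enc nat _).
Proof.
by move=> m n /(enc_inj_seq enc_inj_bool) e; rewrite -(unb_bits m) e unb_bits.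
Qed.

Lemma sz_bits n : sz (bits n) = sz n. Proof. by []. Qed.
Lemma size_bits_sz n : size (bits n) <= sz n. Proof. exact: size_sz. Qed.
Lemma sz_boolseq (s : seq bool) : sz s <= 4 * size s + 1.
Proof. by elim: s => // b s IH; rewrite sz_cons /=; have := sz_bool b; lia. Qed.
Lemma sz_nat_le n k : n < 2 ^ k -> sz n <= 4 * k + 1.
Proof. by move/size_bits_le => le; rewrite -sz_bits; apply: leq_trans (sz_boolseq _) _; lia. Qed.

Lemma pt_bits E {EE : Enc E} (f : E -> nat) : pt f -> pt (fun e => bits (f e)).
Proof. by apply: pt_comp; apply: pt_recode. Qed.

Lemma pt_as A B C {EA : Enc A} {EB : Enc B} {EC : Enc C} (f : A -> B) (g : A -> C) :
  (forall a, enc (f a) = enc (g a)) -> pt g -> pt f.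
Proof. by move=> e [p [c H]]; exists p, c => a l x; rewrite e. Qed.

Lemma pt_unb E {EE : Enc E} (f : E -> seq bool) : pt f -> pt (fun e => unb (f e)).
Proof.
move=> pf; apply: (pt_as (g := fun e => trim (f e))) => [e|].
  by rewrite -bits_unb.
apply: (pt_ext (f := fun e => foldl (fun acc b => if nilp acc && ~~ b then [::] else b :: acc) [::] (rev (f e)))).
  by move=> e; rewrite foldl_rev.
apply: (@pt_foldl _ _ _ _ _ _ (fun _ acc b => if nilp acc && ~~ b then [::] else b :: acc) _ _
  (fun e => 4 * sz (f e) + 1)); try pts; try pbds.
move=> e i le; apply: leq_trans (sz_boolseq _) _; rewrite leq_add2r leq_mul2l /=.
rewrite -[take _ _]revK foldl_rev; apply: leq_trans (_ : size (take i (rev (f e))) <= _).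
  rewrite -[size (take _ _)]size_rev; elim: (rev _) => //= b s IH; case: ifP => //= _.
  by rewrite size_take_min size_rev geq_min size_sz orbT.
Qed.
#[global] Hint Extern 0 (pt (fun _ => bits _)) => simple eapply pt_bits : pt.
#[global] Hint Extern 0 (pt (fun _ => unb _)) => simple eapply pt_unb : pt.

(* Serial processing of two binary numbers with a one-bit memory (carry or borrow). *)
Section Serial.
Variables (cf og : bool -> bool -> bool -> bool).
Definition sstep (p : (seq bool * seq bool) * (bool * seq bool)) :=
  let: ((a, b), (c, o)) := p in
  ((behead a, behead b), (cf (head false a) (head false b) c, og (head false a) (head false b) c :: o)).
(** The concatenation only counts rounds, being at least as long as either number; missing digits
    are read as 0 through [head false]. The output is accumulated with its most significant bit in
    front. *)
Definition serial (ab : seq bool * seq bool) :=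
  iter (size (ab.1 ++ ab.2)) sstep (ab, (false, [::])).

Lemma serial_fin ab : (serial ab).1 = ([::], [::]) /\ size (serial ab).2.2 = size (ab.1 ++ ab.2).
Proof.
rewrite /serial.
have H k : forall s, (iter k sstep s).1 = (drop k s.1.1, drop k s.1.2) /\
    size (iter k sstep s).2.2 = k + size s.2.2.
  elim: k => [|k IH] [[a b] [c o]] //=; first by rewrite !drop0.
  rewrite -iterS iterSr; have [-> ->] := IH (sstep ((a, b), (c, o))); rewrite /= addnS; split=> //.
  by case: (a) => [|? ?]; case: (b) => [|? ?].
have [-> ->] := H (size (ab.1 ++ ab.2)) (ab, (false, [::])); rewrite /= addn0; split=> //.
by rewrite !drop_oversize // size_cat; lia.
Qed.

Hypothesis (pcf : pt (fun p : bool * (bool * bool) => cf p.1 p.2.1 p.2.2))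
  (pof : pt (fun p : bool * (bool * bool) => og p.1 p.2.1 p.2.2)).
Lemma pt_serial E {EE : Enc E} (f g : E -> seq bool) : pt f -> pt g -> pt (fun e => serial (f e, g e)).
Proof.
move=> pf pg; rewrite /serial.
apply: (@pt_iter _ _ _ _ _ _ sstep (fun e => f e ++ g e) (fun e => ((f e, g e), (false, [::])))
  (fun e => sz (f e) + sz (g e) + 3 + 4 * (size (f e) + size (g e)) + 4)); try pts.
- apply: (pt_ext (f := fun p => ((behead p.1.1, behead p.1.2),
    (cf (head false p.1.1) (head false p.1.2) p.2.1, og (head false p.1.1) (head false p.1.2) p.2.1 :: p.2.2)))).
    by case=> [[a b] [c o]].
  apply: pt_pair; first by pts.
  by apply: pt_pair; [apply: (pt_comp3 (g := cf))|apply: pt_cons; [apply: (pt_comp3 (g := og))|]]; pts.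
- apply: pbd_le (_ : pbd (fun e => sz (f e) + sz (g e) + 3 + 4 * (sz (f e) + sz (g e)) + 4)); last by pbds.
  by move=> e; have := @size_sz bool Enc_bool (f e); have := @size_sz bool Enc_bool (g e); lia.
- move=> e i; rewrite /= size_cat => le.
  have: forall s, sz (iter i sstep s).1.1 <= sz s.1.1 /\ sz (iter i sstep s).1.2 <= sz s.1.2 /\
    size (iter i sstep s).2.2 = i + size s.2.2.
    elim: i {le} => [|i IH] // [[a b] [c o]]; rewrite iterSr.
    have [h1 [h2 ->]] := IH (sstep ((a, b), (c, o))); rewrite /= addnS; split; [|split=> //].
      by apply: leq_trans h1 _; case: (a) => // x s; rewrite /= sz_cons; lia.
    by apply: leq_trans h2 _; case: (b) => // x s; rewrite /= sz_cons; lia.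
  move=> /(_ ((f e, g e), (false, [::]))) /=; case: (iter _ _ _) => [[a b] [c o]] /=.
  rewrite addn0 => -[h1 [h2 h3]]; rewrite !sz_pair; have := sz_boolseq o; have := sz_bool c; lia.
Qed.
End Serial.

(** Carry, digit and borrow; the digit of a sum and that of a difference are the same [xor3]. *)
Definition maj a b c := (a && b) || (a && c) || (b && c).
Definition xor3 a b c := a (+) b (+) c.
Definition bor a b c := (~~ a && b) || (~~ a && c) || (b && c).

Lemma add_spec a b : let r := (serial maj xor3 (a, b)).2 in
  unb (rev (r.1 :: r.2)) = unb a + unb b.
Proof.
have [e1 e2] := serial_fin maj xor3 (a, b).
(* The output so far, plus the carry and the unread parts at their place value, always equals the
   sum. *)
pose Inv (s : (seq bool * seq bool) * (bool * seq bool)) :=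
  unb (rev s.2.2) + 2 ^ size s.2.2 * (s.2.1 + unb s.1.1 + unb s.1.2).
have I k : Inv (iter k (sstep maj xor3) ((a, b), (false, [::]))) = unb a + unb b.
  elim: k => [|k <-] /=; first by rewrite /Inv /= mul1n.
  move: (iter _ _ _) => [[x y] [c o]]; rewrite /Inv /= rev_cons unb_rcons size_rev expnS.
  have -> : unb x = head false x + (unb (behead x)).*2 by case: (x).
  have -> : unb y = head false y + (unb (behead y)).*2 by case: (y).
  by case: (head _ x); case: (head _ y); case: c; rewrite /maj /xor3 /=; lia.
have := I (size (a ++ b)); rewrite -[iter _ _ _]/(serial maj xor3 (a, b)) /Inv.
move: e1 e2; case: (serial _ _ _) => [[x y] [c o]] /= [-> ->] _ /=.
by rewrite rev_cons unb_rcons size_rev; lia.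
Qed.

Lemma sub_spec a b : let r := (serial bor xor3 (a, b)).2 in
  r.1 = (unb a < unb b) /\ (unb b <= unb a -> unb (rev r.2) = unb a - unb b).
Proof.
have [e1 e2] := serial_fin bor xor3 (a, b).
(* The invariant is [L = R]. With [k] digits written and nothing left to read it says that [a] plus
   [2 ^ k] times the borrow equals [b] plus the output; as the output is below [2 ^ k], the borrow
   decides [a < b]. *)
pose L (s : (seq bool * seq bool) * (bool * seq bool)) :=
  unb a + 2 ^ size s.2.2 * (s.2.1 + unb s.1.2).
pose R (s : (seq bool * seq bool) * (bool * seq bool)) :=
  unb b + unb (rev s.2.2) + 2 ^ size s.2.2 * unb s.1.1.
have I k : L (iter k (sstep bor xor3) ((a, b), (false, [::]))) = R (iter k (sstep bor xor3) ((a, b), (false, [::]))).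
  elim: k => [|k]; first by rewrite /L /R /= !mul1n; lia.
  rewrite !iterS; move: (iter _ _ _) => [[x y] [c o]]; rewrite /L /R /= rev_cons unb_rcons size_rev expnS.
  have -> : unb x = head false x + (unb (behead x)).*2 by case: (x).
  have -> : unb y = head false y + (unb (behead y)).*2 by case: (y).
  by case: (head _ x); case: (head _ y); case: c; rewrite /bor /xor3 /=; lia.
have := I (size (a ++ b)); rewrite -[iter _ _ _]/(serial bor xor3 (a, b)) /L /R.
move: e1 e2; case: (serial _ _ _) => [[x y] [c o]] /= [-> ->] _ /=.
by have := unb_lt (rev o); rewrite size_rev; case: c; rewrite /= ?muln0 ?muln1 => l e; split; try lia.
Qed.

Lemma pt_maj : pt (fun p : bool * (bool * bool) => maj p.1 p.2.1 p.2.2).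
Proof. rewrite /maj; pts. Qed.
Lemma pt_xor3 : pt (fun p : bool * (bool * bool) => xor3 p.1 p.2.1 p.2.2).
Proof. rewrite /xor3; pts. Qed.
Lemma pt_bor : pt (fun p : bool * (bool * bool) => bor p.1 p.2.1 p.2.2).
Proof. rewrite /bor; pts. Qed.

Section Arith.
Context {E : Type} {EE : Enc E}.
Implicit Types f g : E -> nat.

Lemma pt_addn f g : pt f -> pt g -> pt (fun e => f e + g e).
Proof.
move=> pf pg; pose s e := (serial maj xor3 (bits (f e), bits (g e))).2.
apply: (pt_ext (f := fun e => unb (rev ((s e).1 :: (s e).2)))).
  by move=> e; rewrite add_spec !unb_bits.
have ps : pt s by apply: pt_snd1; apply: pt_serial; [exact: pt_maj|exact: pt_xor3|pts|pts].
apply: (pt_comp (f := fun r : bool * seq bool => unb (rev (r.1 :: r.2)))) ps; pts.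
Qed.

Lemma pt_ltn f g : pt f -> pt g -> pt (fun e => f e < g e).
Proof.
move=> pf pg; apply: (pt_ext (f := fun e => (serial bor xor3 (bits (f e), bits (g e))).2.1)).
  by move=> e; have [-> _] := sub_spec (bits (f e)) (bits (g e)); rewrite !unb_bits.
apply: pt_fst1; apply: pt_snd1; apply: pt_serial; [exact: pt_bor|exact: pt_xor3|pts|pts].
Qed.

Lemma pt_leq f g : pt f -> pt g -> pt (fun e => f e <= g e).
Proof.
move=> pf pg; apply: (pt_ext (f := fun e => ~~ (g e < f e))); first by move=> e; rewrite [RHS]leqNgt.
by apply: pt_neg; apply: pt_ltn.
Qed.

Lemma pt_subn f g : pt f -> pt g -> pt (fun e => f e - g e).
Proof.
move=> pf pg; pose s e := (serial bor xor3 (bits (f e), bits (g e))).2.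
apply: (pt_ext (f := fun e => if f e < g e then 0 else unb (rev (s e).2))).
  move=> e; have [_] := sub_spec (bits (f e)) (bits (g e)); rewrite !unb_bits -/(s e).
  by case: ltnP => [lt _|le -> //]; lia.
have ps : pt s by apply: pt_snd1; apply: pt_serial; [exact: pt_bor|exact: pt_xor3|pts|pts].
apply: pt_if; [exact: pt_ltn|pts|].
apply: (pt_comp (f := fun r : bool * seq bool => unb (rev r.2))) ps; pts.
Qed.

Lemma pt_eqn f g : pt f -> pt g -> pt (fun e => f e == g e).
Proof. by apply: pt_eq; apply: enc_inj_nat. Qed.
End Arith.
#[global] Hint Extern 0 (pt (fun _ => _ + _)) => simple eapply pt_addn : pt.
#[global] Hint Extern 0 (pt (fun _ => _ - _)) => simple eapply pt_subn : pt.
#[global] Hint Extern 0 (pt (fun _ => _ < _)) => simple eapply pt_ltn : pt.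
#[global] Hint Extern 0 (pt (fun _ => _ <= _)) => simple eapply pt_leq : pt.
#[global] Hint Extern 0 (pt (fun _ => _ == _ :> nat)) => simple eapply pt_eqn : pt.

Section Mul.
Context {E : Type} {EE : Enc E}.
Implicit Types f g : E -> nat.

Lemma pt_muln f g : pt f -> pt g -> pt (fun e => f e * g e).
Proof.
move=> pf pg.
(* Horner's rule, starting from the most significant bit. *)
have S e l : foldl (fun acc (b : bool) => acc + acc + if b then g e else 0) 0 l = unb (rev l) * g e.
  elim/last_ind: l => // l b IH; rewrite foldl_rcons IH rev_rcons /=; case: b; lia.
apply: (pt_ext (f := fun e => foldl (fun acc (b : bool) => acc + acc + if b then g e else 0) 0 (rev (bits (f e))))).
  by move=> e; rewrite S revK unb_bits.
apply: (@pt_foldl _ _ _ _ _ _ (fun e acc (b : bool) => acc + acc + if b then g e else 0) _ _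
  (fun e => 4 * (sz (f e) + sz (g e)) + 1)); try pts; try pbds.
  apply: pt_addn; [pts|apply: pt_if; [pts| |pts]].
  by apply: (pt_comp (f := g)); pts.
move=> e i le; rewrite S; apply: sz_nat_le; rewrite expnD.
apply: (@leq_ltn_trans (2 ^ sz (f e) * g e)).
  rewrite leq_mul2r; apply/orP; right; apply: leq_trans (ltnW (unb_lt _)) _.
  rewrite leq_exp2l // size_rev size_take_min size_rev geq_min; apply/orP; right; exact: size_bits_sz.
rewrite ltn_mul2l expn_gt0 /=; apply: leq_trans (bits_lt _) _.
by rewrite leq_exp2l // size_bits_sz.
Qed.

(** Long division in base 2, most significant bit first: [p] holds quotient and remainder of the
    prefix read so far. *)
Definition dstep d (p : nat * nat) (b : bool) :=
  let r := b + (p.2 + p.2) in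
  if d <= r then (1 + (p.1 + p.1), r - d) else (p.1 + p.1, r).

Lemma dstep_spec d l : 0 < d -> foldl (dstep d) (0, 0) l = (unb (rev l) %/ d, unb (rev l) %% d).
Proof.
move=> d0; elim/last_ind: l => [|l b IH]; first by rewrite div0n mod0n.
rewrite foldl_rcons IH rev_rcons /= /dstep /=; set v := unb _.
have E1 := divn_eq v d; have lt := ltn_pmod v d0.
set q := v %/ d in E1 *; set r := v %% d in E1 lt *.
case: leqP => le.
  have -> : b + v.*2 = (q + q).+1 * d + (b + (r + r) - d) by lia.
  have lt' : b + (r + r) - d < d by case: (b) le; lia.
  by rewrite divnMDl // modnMDl divn_small // modn_small // addn0 add1n.
have -> : b + v.*2 = (q + q) * d + (b + (r + r)) by lia.
by rewrite divnMDl // modnMDl divn_small // modn_small // addn0.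
Qed.

(** This has to cover [d = 0] as well, because the sizes of a fold must be bounded for every input;
    there the quotient merely collects ones. *)
Lemma dstep_bound d l : (foldl (dstep d) (0, 0) l).1 < 2 ^ size l /\ (foldl (dstep d) (0, 0) l).2 < 2 ^ size l.
Proof.
elim/last_ind: l => // l b; rewrite foldl_rcons size_rcons /dstep expnS.
by case: (foldl _ _ _) => q r /= [h1 h2]; case: ifP => _ /=; case: b; lia.
Qed.

Lemma pt_divmod f g : pt f -> pt g -> pt (fun e => foldl (dstep (g e)) (0, 0) (rev (bits (f e)))).
Proof.
move=> pf pg; apply: (@pt_foldl _ _ _ _ _ _ (fun e => dstep (g e)) _ _
  (fun e => (4 * sz (f e) + 1 + (4 * sz (f e) + 1)).+1)); try pts; try pbds.
  have -> : (fun p : E * (nat * nat * bool) => dstep (g p.1) p.2.1 p.2.2) =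
    (fun p => if g p.1 <= (if p.2.2 then 1 else 0) + (p.2.1.2 + p.2.1.2)
       then (1 + (p.2.1.1 + p.2.1.1), (if p.2.2 then 1 else 0) + (p.2.1.2 + p.2.1.2) - g p.1)
       else (p.2.1.1 + p.2.1.1, (if p.2.2 then 1 else 0) + (p.2.1.2 + p.2.1.2))) by [].
  have pg1 : pt (fun p : E * (nat * nat * bool) => g p.1) by apply: (pt_comp (f := g)); pts.
  pts.
move=> e i le; have [] := dstep_bound (g e) (take i (rev (bits (f e)))).
case: (foldl _ _ _) => q r /= h1 h2; rewrite sz_pair ltnS.
have lb : 2 ^ size (take i (rev (bits (f e)))) <= 2 ^ sz (f e).
  by rewrite leq_exp2l // size_take_min size_rev geq_min size_bits_sz orbT.
by rewrite leq_add // sz_nat_le //; apply: leq_trans lb.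
Qed.

Lemma pt_divn f g : pt f -> pt g -> pt (fun e => f e %/ g e).
Proof.
move=> pf pg.
apply: (pt_ext (f := fun e => if g e == 0 then 0 else (foldl (dstep (g e)) (0, 0) (rev (bits (f e)))).1)).
  by move=> e; case: eqP => [->|/eqP ne]; rewrite ?divn0 // dstep_spec ?lt0n // revK unb_bits.
apply: pt_if; [pts|pts|apply: pt_fst1; exact: pt_divmod].
Qed.

Lemma pt_modn f g : pt f -> pt g -> pt (fun e => f e %% g e).
Proof.
move=> pf pg.
apply: (pt_ext (f := fun e => if g e == 0 then f e else (foldl (dstep (g e)) (0, 0) (rev (bits (f e)))).2)).
  by move=> e; case: eqP => [->|/eqP ne]; rewrite ?modn0 // dstep_spec ?lt0n // revK unb_bits.
apply: pt_if; [pts|pts|apply: pt_snd1; exact: pt_divmod].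
Qed.
End Mul.
#[global] Hint Extern 0 (pt (fun _ => _ * _)) => simple eapply pt_muln : pt.
#[global] Hint Extern 0 (pt (fun _ => _ %/ _)) => simple eapply pt_divn : pt.
#[global] Hint Extern 0 (pt (fun _ => _ %% _)) => simple eapply pt_modn : pt.

Definition gstep (p : nat * nat) := if p.2 == 0 then p else (p.2, p.1 %% p.2).

Lemma gstep_gcd k p : gcdn (iter k gstep p).1 (iter k gstep p).2 = gcdn p.1 p.2.
Proof.
elim: k p => // k IH p; rewrite iterSr IH /gstep; case: eqP => //= _.
by rewrite gcdn_modr gcdnC.
Qed.

(** Two steps of Euclid's algorithm replace [b] by [b %% r] with [r = a %% b], and [b] is at least
    [r + b %% r], more than twice [b %% r]. So [k + k] steps exhaust [k] bits. *)
Lemma gstep_zero k a b : b < 2 ^ k -> (iter (k + k) gstep (a, b)).2 = 0.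
Proof.
have z j c : iter j gstep (c, 0) = (c, 0) by elim: j => //= j ->.
elim: k a b => [|k IH] a b lt; first by rewrite /=; lia.
rewrite addSn addnS !iterSr; have [->|b0] := eqVneq b 0; first by rewrite /gstep /= z.
have -> : gstep (a, b) = (b, a %% b) by rewrite /gstep /= (negbTE b0).
have [->|r0] := eqVneq (a %% b) 0; first by rewrite /gstep /= z.
have -> : gstep (b, a %% b) = (a %% b, b %% (a %% b)) by rewrite /gstep /= (negbTE r0).
apply: IH; rewrite -lt0n in b0; have lt1 := ltn_pmod a b0.
set r := a %% b in r0 lt1 *; rewrite -lt0n in r0; have lt2 := ltn_pmod b r0.
have := divn_eq b r; have : 0 < b %/ r by rewrite divn_gt0 // ltnW.
by move: lt; rewrite expnS; nia.
Qed.

Lemma pt_gcdn E {EE : Enc E} (f g : E -> nat) : pt f -> pt g -> pt (fun e => gcdn (f e) (g e)).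
Proof.
move=> pf pg.
apply: (pt_ext (f := fun e => (iter (size (bits (g e) ++ bits (g e))) gstep (f e, g e)).1)).
  move=> e; rewrite -[RHS](gstep_gcd (size (bits (g e) ++ bits (g e))) (f e, g e)).
  by rewrite size_cat gstep_zero ?gcdn0 //; apply: bits_lt.
apply: pt_fst1; apply: (@pt_iter _ _ _ _ _ _ gstep _ _
  (fun e => (4 * (sz (f e) + sz (g e)) + 1 + (4 * (sz (f e) + sz (g e)) + 1)).+1)); try pts; try pbds.
  by rewrite /gstep; pts.
move=> e i _.
have: (iter i gstep (f e, g e)).1 <= f e + g e /\ (iter i gstep (f e, g e)).2 <= f e + g e.
  elim: i => [|i [h1 h2]] /=; first by lia.
  rewrite /gstep; case: eqP => //= _; split => //.
  by apply: leq_trans (leq_mod _ _) _.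
case: (iter _ _ _) => a b /= [h1 h2]; rewrite sz_pair.
have: f e + g e < 2 ^ (sz (f e) + sz (g e)).
  have l1 := leq_trans (bits_lt (f e)) (_ : _ <= 2 ^ sz (f e)).
  have l2 := leq_trans (bits_lt (g e)) (_ : _ <= 2 ^ sz (g e)).
  have k1 : f e < 2 ^ sz (f e) by apply: l1; rewrite leq_exp2l // size_bits_sz.
  have k2 : g e < 2 ^ sz (g e) by apply: l2; rewrite leq_exp2l // size_bits_sz.
  by rewrite expnD; nia.
by move=> lt; rewrite ltnS leq_add // sz_nat_le //; apply: leq_ltn_trans lt.
Qed.
#[global] Hint Extern 0 (pt (fun _ => gcdn _ _)) => simple eapply pt_gcdn : pt.

Import GRing.Theory Num.Theory.

(** * Sums over weighted paths *)

(* [(p, q)] stands for the integer [p - q]. *)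
Notation zz := (nat * nat)%type.
Definition zadd (x y : zz) : zz := (x.1 + y.1, x.2 + y.2).
Definition zmul (x y : zz) : zz := (x.1 * y.1 + x.2 * y.2, x.1 * y.2 + x.2 * y.1).
(** Since the two parts of a difference are never cancelled against each other, sizes are controlled
    by [zn], which is additive under [zadd] and multiplicative under [zmul]. *)
Definition zn (x : zz) := x.1 + x.2.
Definition zv (x : zz) : rat := (x.1%:R - x.2%:R)%R.

Lemma zvD x y : zv (zadd x y) = (zv x + zv y)%R.
Proof. by rewrite /zv /zadd /= !natrD; ring. Qed.
Lemma zvM x y : zv (zmul x y) = (zv x * zv y)%R.
Proof. by rewrite /zv /zmul /= !natrD !natrM; ring. Qed.
Lemma znD x y : zn (zadd x y) = zn x + zn y.
Proof. rewrite /zn /zadd /=; lia. Qed.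
Lemma znM x y : zn (zmul x y) = zn x * zn y.
Proof. rewrite /zn /zmul /=; lia. Qed.
Lemma zv1 : zv (1, 0) = 1%R. Proof. by rewrite /zv /= mulr0n subr0 mulr1n. Qed.
Lemma zv0 : zv (0, 0) = 0%R. Proof. by rewrite /zv subrr. Qed.

Lemma pt_zadd E {EE : Enc E} (f g : E -> zz) : pt f -> pt g -> pt (fun e => zadd (f e) (g e)).
Proof. by move=> pf pg; rewrite /zadd; pts. Qed.
Lemma pt_zmul E {EE : Enc E} (f g : E -> zz) : pt f -> pt g -> pt (fun e => zmul (f e) (g e)).
Proof. by move=> pf pg; rewrite /zmul; pts. Qed.
#[global] Hint Extern 0 (pt (fun _ => zadd _ _)) => simple eapply pt_zadd : pt.
#[global] Hint Extern 0 (pt (fun _ => zmul _ _)) => simple eapply pt_zmul : pt.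

Lemma nat_lt_sz (n : nat) : n < 2 ^ sz n.
Proof. by apply: leq_trans (bits_lt n) _; rewrite leq_exp2l // size_bits_sz. Qed.

Lemma zn_lt_sz (x : zz) : zn x < 2 ^ sz x.
Proof.
case: x => p q; rewrite sz_pair expnS expnD /zn /=.
have := nat_lt_sz p; have := nat_lt_sz q; nia.
Qed.

Lemma sz_zz_le (x : zz) k : zn x < 2 ^ k -> sz x <= 8 * k + 3.
Proof.
case: x => p q; rewrite /zn /= => lt; rewrite sz_pair.
have := @sz_nat_le p k; have := @sz_nat_le q k; lia.
Qed.

Lemma sz_list_le T {ET : Enc T} (l : seq T) K :
  (forall i x, onth l i = Some x -> sz x <= K) -> sz l <= size l * K.+1 + 1.
Proof.
elim: l => // x l IH H; rewrite sz_cons /= mulSn.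
have := H 0 x erefl; have := IH (fun i => H i.+1); lia.
Qed.

(** * Weighted lists with merged keys *)

Section Merge.
Context {K : eqType} {EK : Enc K}.
Hypothesis injK : injective (@enc K EK).
Implicit Types (L M : seq (K * zz)) (k : K).

Definition addk L (e : K * zz) :=
  let r := foldl (fun acc x => if x.1 == e.1 then (zadd acc.1 x.2, acc.2) else (acc.1, x :: acc.2))
                 (e.2, [::]) L in (e.1, r.1) :: r.2.
Definition merge M := foldl addk [::] M.

Definition wsum (phi : K -> rat) L : rat := (\sum_(x <- L) zv x.2 * phi x.1)%R.
Definition nsum L : nat := \sum_(x <- L) zn x.2.

Let fold1 (e : K * zz) (z : zz) (B : seq (K * zz)) L :=
  foldl (fun acc x => if x.1 == e.1 then (zadd acc.1 x.2, acc.2) else (acc.1, x :: acc.2)) (z, B) L.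

Let fold1E e z B L : fold1 e z B L =
  (foldl zadd z [seq x.2 | x <- L & x.1 == e.1], rev [seq x <- L | x.1 != e.1] ++ B).
Proof.
rewrite /fold1; elim: L z B => [|x L IH] z B //=; case: eqP => _ /=; rewrite IH //.
by rewrite rev_cons cat_rcons.
Qed.

Lemma zv_foldl z s : zv (foldl zadd z s) = (zv z + \sum_(x <- s) zv x)%R.
Proof.
elim: s z => [|x s IH] z /=; first by rewrite big_nil addr0.
by rewrite IH big_cons zvD [RHS]addrA.
Qed.
Lemma zn_foldl z s : zn (foldl zadd z s) = zn z + \sum_(x <- s) zn x.
Proof.
elim: s z => [|x s IH] z /=; first by rewrite big_nil addn0.
by rewrite IH big_cons znD addnA.
Qed.

Lemma addkE L e : addk L e =
  (e.1, foldl zadd e.2 [seq x.2 | x <- L & x.1 == e.1]) :: rev [seq x <- L | x.1 != e.1].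
Proof. by have := fold1E e e.2 [::] L; rewrite /fold1 /addk => ->; rewrite cats0. Qed.

Lemma wsum_addk phi L e : wsum phi (addk L e) = (wsum phi L + zv e.2 * phi e.1)%R.
Proof.
rewrite addkE /wsum big_cons /= zv_foldl big_map big_filter big_rev big_filter.
rewrite [in RHS](bigID (fun x => x.1 == e.1)) /= mulrDl mulr_suml.
rewrite (eq_bigr (fun i => zv i.2 * phi i.1)%R) => [|x /eqP -> //].
by rewrite -addrA addrC.
Qed.

Lemma nsum_addk L e : nsum (addk L e) = nsum L + zn e.2.
Proof.
rewrite addkE /nsum big_cons /= zn_foldl big_map big_filter big_rev big_filter.
by rewrite [in RHS](bigID (fun x => x.1 == e.1)) /= -addnA addnC.
Qed.

Lemma keys_addk L e : map fst (addk L e) = e.1 :: rev [seq k <- map fst L | k != e.1].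
Proof. by rewrite addkE /= map_rev filter_map. Qed.

Lemma wsum_merge phi M : wsum phi (merge M) = wsum phi M.
Proof.
rewrite /merge; elim/last_ind: M => [|M e IH] //=.
by rewrite foldl_rcons wsum_addk IH /wsum -cats1 big_cat big_seq1.
Qed.

Lemma nsum_merge M : nsum (merge M) = nsum M.
Proof.
rewrite /merge; elim/last_ind: M => [|M e IH] //=.
by rewrite foldl_rcons nsum_addk IH /nsum -cats1 big_cat big_seq1.
Qed.

Lemma uniq_merge M : uniq (map fst (merge M)).
Proof.
rewrite /merge; elim/last_ind: M => [|M e IH] //=.
rewrite foldl_rcons keys_addk /= rev_uniq mem_rev mem_filter eqxx /=.
exact: filter_uniq.
Qed.

Lemma sub_merge M : {subset map fst (merge M) <= map fst M}.
Proof.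
rewrite /merge; elim/last_ind: M => [|M e IH] k //=.
rewrite foldl_rcons keys_addk map_rcons mem_rcons !inE mem_rev mem_filter.
by case: (k == e.1) => //= /IH.
Qed.

Lemma size_merge M : size (merge M) <= size M.
Proof.
by rewrite -(size_map fst) -(size_map fst M); apply: uniq_leq_size (uniq_merge M) (@sub_merge M).
Qed.

Lemma nsum_lt_sz M : nsum M < 2 ^ sz M.
Proof.
elim: M => [|[k z] M IH]; first by rewrite /nsum big_nil expn_gt0.
rewrite /nsum big_cons -/(nsum M) /= sz_cons sz_pair.
have := zn_lt_sz z; rewrite addSn 2!expnS !expnD.
have : 0 < 2 ^ sz k by rewrite expn_gt0.
move: (2 ^ sz k) (2 ^ sz z) (2 ^ sz M) IH => a b c h1 h2 h3.
have : b * c <= a * (b * c) by rewrite leq_pmull.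
have : b + c <= 2 * (b * c) by nia.
by rewrite -mulnA; lia.
Qed.

Lemma sz_bound L K0 B c : (forall k, k \in map fst L -> sz k <= K0) -> nsum L < 2 ^ B ->
  size L <= c -> sz L <= c * (K0 + (8 * B + 3)).+2 + 1.
Proof.
move=> HK HB Hc; apply: leq_trans (sz_list_le (K := (K0 + (8 * B + 3)).+1) _) _.
  elim: L HK HB {Hc} => [|[k z] L IH] HK HB [|i] x //= .
  - move=> [<-]; rewrite sz_pair ltnS leq_add //; first by apply: HK; rewrite inE eqxx.
    by apply: sz_zz_le; apply: leq_ltn_trans HB; rewrite /nsum big_cons leq_addr.
  - apply: IH => [k' kin|]; first by apply: HK; rewrite inE kin orbT.
    by apply: leq_ltn_trans HB; rewrite /nsum big_cons leq_addl.
by rewrite leq_add2r leq_mul2r Hc orbT.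
Qed.

Lemma sz_mem_key L k : k \in map fst L -> sz k <= sz L.
Proof.
elim: L => [|[k' z] L IH] //=; rewrite inE sz_cons sz_pair => /orP [/eqP -> | /IH]; lia.
Qed.

Lemma pt_addk E {EE : Enc E} (f : E -> seq (K * zz)) (g : E -> K * zz) :
  pt f -> pt g -> pt (fun e => addk (f e) (g e)).
Proof.
move=> pf pg; rewrite /addk.
enough (p : pt (fun e => foldl (fun acc x => if x.1 == (g e).1 then (zadd acc.1 x.2, acc.2) else (acc.1, x :: acc.2))
                 ((g e).2, [::]) (f e))) by pts.
apply: (@pt_foldl _ _ _ _ _ _ (fun e (acc : zz * seq (K * zz)) x =>
    if x.1 == (g e).1 then (zadd acc.1 x.2, acc.2) else (acc.1, x :: acc.2)) _ _
  (fun e => (8 * (sz (f e) + sz (g e)) + 3 + sz (f e)).+1)); try pts; try pbds.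
  have pg1 : pt (fun p : E * (zz * seq (K * zz) * (K * zz)) => (g p.1)) by apply: (pt_comp (f := g)); pts.
  by apply: pt_if; [apply: pt_eq => //; pts|pts|pts].
move=> e i le; have := fold1E (g e) (g e).2 [::] (take i (f e)); rewrite /fold1 => ->.
rewrite sz_pair ltnS cats0 sz_rev leq_add //; last first.
  apply: leq_trans (sz_take i (f e)); elim: (take i (f e)) => //= x s IH.
  by case: ifP => _; rewrite !sz_cons; lia.
apply: sz_zz_le; rewrite zn_foldl big_map big_filter.
apply: (@leq_ltn_trans (zn (g e).2 + nsum (take i (f e)))).
  by rewrite leq_add2l /nsum [X in _ <= X](bigID (fun x => x.1 == (g e).1)) /= leq_addr.
have h1 := nsum_lt_sz (take i (f e)).
have h2 : 2 ^ sz (take i (f e)) <= 2 ^ sz (f e) by rewrite leq_exp2l // sz_take.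
have h3 := zn_lt_sz (g e).2.
have h4 : 2 ^ sz (g e).2 <= 2 ^ sz (g e).
  by rewrite leq_exp2l //; case: (g e) => k z; rewrite sz_pair /=; lia.
by rewrite expnD; nia.
Qed.

Lemma pt_merge E {EE : Enc E} (f : E -> seq (K * zz)) : pt f -> pt (fun e => merge (f e)).
Proof.
move=> pf; apply: (@pt_foldl _ _ _ _ _ _ (fun _ => addk) _ _
  (fun e => sz (f e) * (sz (f e) + (8 * sz (f e) + 3)).+2 + 1)); try pts; try pbds.
  by apply: pt_addk; pts.
move=> e i le; rewrite -/(merge _).
apply: sz_bound.
- move=> k /sub_merge kin; apply: sz_mem_key.
  by apply: mem_subseq kin; apply: map_subseq; rewrite -{2}(cat_take_drop i (f e)) prefix_subseq.
- rewrite nsum_merge; apply: leq_trans (nsum_lt_sz _) _; rewrite leq_exp2l //; exact: sz_take.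
- apply: leq_trans (size_merge _) _; rewrite size_take_min geq_min.
  by apply/orP; right; apply: size_sz.
Qed.

Lemma pt_zsum E {EE : Enc E} (f : E -> seq zz) : pt f -> pt (fun e => foldl zadd (0, 0) (f e)).
Proof.
move=> pf; apply: (@pt_foldl _ _ _ _ _ _ (fun _ => zadd) _ _ (fun e => 8 * sz (f e) + 3)); try pts; try pbds.
move=> e i le; apply: sz_zz_le; rewrite zn_foldl add0n.
apply: (@leq_trans (2 ^ sz (take i (f e)))); last by rewrite leq_exp2l // sz_take.
elim: (take i (f e)) => [|z s IH]; first by rewrite big_nil expn_gt0.
rewrite big_cons sz_cons expnS expnD; have := zn_lt_sz z; nia.
Qed.

Section Paths.
Context {E : Type} {EE : Enc E}.
Variables (succ : E -> K -> seq (K * zz)) (valid : E -> K -> Prop) (k0 : E -> K) (T : E -> seq unit)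
  (hk hc : E -> nat).
Hypotheses (pt_succ : pt (fun p : E * K => succ p.1 p.2)) (pt_k0 : pt k0) (pt_T : pt T)
  (hkP : pbd hk) (hcP : pbd hc)
  (valid0 : forall e, valid e (k0 e))
  (valid_succ : forall e k k', valid e k -> k' \in map fst (succ e k) -> valid e k')
  (valid_sz : forall e k, valid e k -> sz k <= hk e)
  (valid_card : forall e (s : seq K), uniq s -> (forall k, k \in s -> valid e k) -> size s <= hc e).

(* [paths] propagates a weighted list of configurations, merging equal ones so that the list stays
   as short as the set of valid configurations. A [phi] that satisfies the recursion given by [succ]
   is conserved, hence its value at [k0] can be read off the final list. *)
Definition expand e L : seq (K * zz) :=
  flatten [seq [seq (s.1, zmul x.2 s.2) | s <- succ e x.1] | x <- L].
Definition pstep e L := merge (expand e L).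
Definition paths e := iter (size (T e)) (pstep e) [:: (k0 e, (1, 0))].

Lemma expand_keys e L k : k \in map fst (expand e L) ->
  exists2 x, x \in map fst L & k \in map fst (succ e x).
Proof.
rewrite /expand map_flatten => /flattenP [s]; rewrite -map_comp => /mapP [x xL ->].
rewrite /= -map_comp => /mapP [y ys ->]; exists x.1; first exact: map_f.
by apply/mapP; exists y.
Qed.

Lemma wsum_expand e phi L : (forall k, phi k = wsum phi (succ e k)) -> wsum phi (expand e L) = wsum phi L.
Proof.
move=> H; rewrite /wsum /expand big_flatten big_map; apply: eq_bigr => x _.
rewrite big_map [in RHS]H /wsum mulr_sumr; apply: eq_bigr => s _ /=.
by rewrite zvM mulrA.
Qed.

Lemma wsum_paths e phi : (forall k, phi k = wsum phi (succ e k)) -> wsum phi (paths e) = phi (k0 e).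
Proof.
move=> H; rewrite /paths; elim: (size _) => [|i IH].
  by rewrite /wsum big_seq1 zv1 mul1r.
by rewrite iterS /pstep wsum_merge wsum_expand.
Qed.

Lemma valid_paths e i k : k \in map fst (iter i (pstep e) [:: (k0 e, (1, 0))]) -> valid e k.
Proof.
elim: i k => [|i IH] k; first by rewrite /= inE => /eqP ->.
by rewrite iterS => /sub_merge /expand_keys [x /IH vx]; apply: valid_succ.
Qed.

(** [mu] is a potential that drops in every round until it is 0; a number of rounds at least its
    initial value thus leaves only final configurations. *)
Lemma paths_final e (mu : K -> nat) : (forall k k', k' \in map fst (succ e k) -> valid e k ->
     mu k' <= (mu k).-1) ->
  mu (k0 e) <= size (T e) -> forall k, k \in map fst (paths e) -> mu k = 0.
Proof.
move=> H le k kin; suff : mu k <= mu (k0 e) - size (T e) by lia.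
move: kin; rewrite /paths => {le}; elim: (size _) k => [|i IH] k.
  by rewrite /= inE subn0 => /eqP ->.
rewrite iterS => /sub_merge /expand_keys [x xin kx].
by have := H _ _ kx (valid_paths xin); have := IH _ xin; lia.
Qed.

Lemma nsum_expand e L N : (forall k, k \in map fst L -> nsum (succ e k) <= N) ->
  nsum (expand e L) <= nsum L * N.
Proof.
move=> H; rewrite /nsum /expand big_flatten big_map.
elim: L H => [|[k z] L IH] H; first by rewrite !big_nil.
rewrite !big_cons mulnDl leq_add //; last by apply: IH => k' kin; apply: H; rewrite inE kin orbT.
rewrite big_map (eq_bigr (fun s => zn z * zn s.2)) => [|s _]; last by rewrite znM.
by rewrite -big_distrr leq_mul2l; apply/orP; right; apply: H; rewrite inE eqxx.
Qed.

(** A round multiplies the total [nsum] of the coefficients by at most [2 ^ B e], so after [i]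
    rounds each coefficient has at most about [i * B e] bits; merging keeps the number of entries
    below [hc e]. *)
Lemma pt_paths : pt paths.
Proof.
have [c Hc] := pt_sz pt_succ.
pose B e := (@sz E EE e + hk e + 3) ^ c.
have HB e k : valid e k -> nsum (succ e k) <= 2 ^ B e.
  move=> vk; apply: leq_trans (ltnW (nsum_lt_sz _)) _; rewrite leq_exp2l //.
  apply: leq_trans (Hc (e, k)) _; rewrite /B sz_pair; have := valid_sz vk.
  by case: (c) => // d h; rewrite leq_exp2r //; lia.
apply: (@pt_iter_env _ _ _ _ _ _ pstep T (fun e => [:: (k0 e, (1, 0))])
   (fun e => (hc e).+1 * (hk e + (8 * (sz (T e) * B e + 1) + 3)).+2 + 1)); try pts.
- apply: pt_merge; apply: pt_flatten.
  apply: (pt_map (f := fun (p : E * seq (K * zz)) x => [seq (s.1, zmul x.2 s.2) | s <- succ p.1 x.1])).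
    apply: (pt_map (f := fun (p : E * seq (K * zz) * (K * zz)) s => (s.1, zmul p.2.2 s.2))).
      pts.
    by apply: (pt_comp2 (g := succ)); pts.
  pts.
- have p1 : pbd B by rewrite /B; pbds.
  pbds.
- move=> e i le; apply: sz_bound.
  + by move=> k /valid_paths; apply: valid_sz.
  + apply: (@leq_ltn_trans (2 ^ (i * B e))).
      elim: i {le} => [|i IH]; first by rewrite /= /nsum big_seq1 mul0n.
      rewrite iterS /pstep nsum_merge mulSn addnC expnD.
      apply: leq_trans (nsum_expand (N := 2 ^ B e) _) _; last by rewrite leq_mul2r IH orbT.
      by move=> k /valid_paths; apply: HB.
    rewrite ltn_exp2l // addn1 ltnS leq_mul2r; apply/orP; right.
    by apply: leq_trans le (size_sz _).
  (* The initial list does not come from [merge]; its single entry is the reason for [(hc e).+1]. *)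
  + case: i le => [|i] // le; apply: leqW; rewrite -(size_map fst).
    apply: valid_card; first exact: uniq_merge.
    by move=> k; apply: (@valid_paths e i.+1).
Qed.
End Paths.
End Merge.

(** * Adding the elements one at a time *)

(* The elements still to be added (in unary), the new element (none or one), the sorted states of
   the elements it has not met yet, and the sorted states of the others. *)
Notation key S := (seq unit * (seq S * (seq S * seq S)))%type.

Section Interaction.
Variables (S C T : finType) (i0 : C -> S) (d1 d2 : T -> S -> S -> S) (b0 : bool) (aS : S -> bool).
Variables (u : C -> rat) (v : T -> rat).
(** A newcomer may meet two elements in either order, and what it does to one does not depend on its
    having met the other: hence only the multiset of states matters. *)
Hypothesis d1_comm : forall t t' c x y, d1 t' (d1 t c x) y = d1 t (d1 t' c y) x.
Hypothesis d2_comm : forall t t' c x y, d2 t' (d1 t c x) y = d2 t' c y.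

(** On the empty domain no state carries the verdict; [b0] supplies it. *)
Definition accept (s : seq S) := if s is [::] then b0 else all aS s.

(* A new element in state [c] interacts in turn with the elements of [todo]; [done] lists the
   states of the elements it has already met. *)
Fixpoint meet (F : seq S -> rat) (c : S) (todo don : seq S) : rat :=
  if todo is x :: todo' then (\sum_t v t * meet F (d1 t c x) todo' (d2 t c x :: don))%R
  else F (c :: don).

Fixpoint grow (m : nat) (s : seq S) : rat :=
  if m is m'.+1 then (\sum_c u c * meet (grow m') (i0 c) s [::])%R else ((accept s)%:R)%R.

Definition psym (F : seq S -> rat) := forall s s', perm_eq s s' -> F s = F s'.

Lemma meet_don F c todo don don' : psym F -> perm_eq don don' -> meet F c todo don = meet F c todo don'.
Proof.
move=> pF; elim: todo c don don' => [|x todo IH] c don don' p /=; first by apply: pF; rewrite perm_cons.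
by apply: eq_bigr => t _; congr (_ * _)%R; apply: IH; rewrite perm_cons.
Qed.

Lemma perm_swap2 (A : eqType) (x y : A) s : perm_eq [:: x, y & s] [:: y, x & s].
Proof. by apply/permPl; exact: (perm_catCA [:: x] [:: y] s). Qed.

Lemma meet_swap F c x y todo don : psym F -> meet F c [:: x, y & todo] don = meet F c [:: y, x & todo] don.
Proof.
move=> pF /=; under eq_bigr do rewrite mulr_sumr.
under [RHS]eq_bigr do rewrite mulr_sumr.
rewrite exchange_big; apply: eq_bigr => t _; apply: eq_bigr => t' _.
rewrite mulrCA d1_comm !d2_comm; do 2 congr (_ * _)%R.
by apply: meet_don => //; apply: perm_swap2.
Qed.

Lemma meet_todo F c todo todo' don : psym F -> perm_eq todo todo' -> meet F c todo don = meet F c todo' don.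
Proof.
move=> pF.
have move1 x s1 s2 c' don' : meet F c' (x :: s1 ++ s2) don' = meet F c' (s1 ++ x :: s2) don'.
  elim: s1 c' don' => // y s1 IH c' don'; rewrite cat_cons meet_swap //.
  by apply: eq_bigr => t _; congr (_ * _)%R; apply: IH.
elim: todo todo' c don => [|x todo IH] todo' c don p.
  by have := perm_size p; case: todo' p.
have xin : x \in todo' by rewrite -(perm_mem p) inE eqxx.
case/splitPr: xin p => s1 s2 p; rewrite -move1.
have p' : perm_eq todo (s1 ++ s2) by move: p; rewrite -[x :: s2]cat1s perm_sym perm_catCA perm_sym /= perm_cons.
by apply: eq_bigr => t _; congr (_ * _)%R; apply: IH.
Qed.

(** This symmetry is what allows lists of states to be kept sorted. *)
Lemma grow_sym m : psym (grow m).
Proof.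
elim: m => [|m IH] s s' p /=.
  rewrite /accept; have := perm_size p; case: s p => [|x s] p; case: s' p => [|x' s'] p // _.
  by rewrite (perm_all _ p).
by apply: eq_bigr => c _; congr (_ * _)%R; apply: meet_todo.
Qed.

Definition leS (x y : S) := enum_rank x <= enum_rank y.
Definition ins (x : S) (l : seq S) := [seq y <- l | leS y x] ++ x :: [seq y <- l | ~~ leS y x].

Lemma leS_trans : transitive leS. Proof. by move=> y x z; apply: leq_trans. Qed.
Lemma leS_anti : antisymmetric leS.
Proof. by move=> x y; rewrite /leS -eqn_leq => /eqP /val_inj /enum_rank_inj. Qed.

Lemma perm_ins x l : perm_eq (ins x l) (x :: l).
Proof. by rewrite /ins -cat1s perm_catCA cat1s perm_cons perm_filterC. Qed.

Lemma ins_sorted x l : sorted leS l -> sorted leS (ins x l).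
Proof.
rewrite !(sorted_pairwise leS_trans) /ins pairwise_cat /= => H.
rewrite !pairwise_filter // andbT; apply/andP; split.
  apply/allrelP => a b; rewrite mem_filter inE => /andP [ax _] /orP [/eqP -> //|].
  rewrite mem_filter => /andP [bx _]; apply: leS_trans ax _.
  by move: bx; rewrite /leS -ltnNge; apply: ltnW.
by apply/allP => b; rewrite mem_filter /leS -ltnNge => /andP [/ltnW].
Qed.

#[local] Instance ES : Enc S := Enc_fin S.

Lemma key_inj : injective (@enc (key S) _).
Proof.
have iS := enc_inj_seq (@enc_inj_fin S).
by apply: enc_inj_pair (enc_inj_seq enc_inj_unit) (enc_inj_pair iS (enc_inj_pair iS iS)).
Qed.
End Interaction.

Section Ins.
Variable S : finType.
#[local] Instance ES_ins : Enc S := Enc_fin S.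
Context {E : Type} {EE : Enc E}.
Lemma pt_filterS (p : S -> bool) (f : E -> seq S) : pt f -> pt (fun e => [seq x <- f e | p x]).
Proof.
move=> pf; apply: (pt_ext (f := fun e => flatten [seq (if p x then [:: x] else [::]) | x <- f e])).
  by move=> e; elim: (f e) => //= x s ->; case: (p x).
apply: pt_flatten; apply: (pt_map (f := fun _ x => if p x then [:: x] else [::])) => //.
by apply: (pt_fin (fun x => if p x then [:: x] else [::]) (@enc_inj_fin S)); pts.
Qed.

Lemma pt_ins x (f : E -> seq S) : pt f -> pt (fun e => ins x (f e)).
Proof.
move=> pf; rewrite /ins; apply: pt_cat; first exact: pt_filterS.
by apply: pt_cons; [pts|exact: pt_filterS].
Qed.
End Ins.

(** * The dynamic programme over sorted lists of states *)

Section Machine.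
Variables (S C T : finType) (i0 : C -> S) (d1 d2 : T -> S -> S -> S) (b0 : bool) (aS : S -> bool).
Context {E : Type} {EE : Enc E}.
Variables (u : C -> E -> zz) (v : T -> E -> zz) (nn : E -> seq unit).
Hypothesis d1_comm : forall t t' c x y, d1 t' (d1 t c x) y = d1 t (d1 t' c y) x.
Hypothesis d2_comm : forall t t' c x y, d2 t' (d1 t c x) y = d2 t' c y.
Hypotheses (pt_u : forall c, pt (u c)) (pt_v : forall t, pt (v t)) (pt_nn : pt nn).
#[local] Instance ES_machine : Enc S := Enc_fin S.
Implicit Types (e : E) (k : key S).

(** The newcomer meets the next element; or it has met all and is filed; or a new element is drawn
    with its 1-type. A final key leads to itself with weight 1, so surplus rounds do no harm. *)
Definition succ e k : seq (key S * zz) :=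
  if k.2.1 is c :: _ then
    if k.2.2.1 is x :: t then
      [seq ((k.1, ([:: d1 tau c x], (t, ins (d2 tau c x) k.2.2.2))), v tau e) | tau <- enum T]
    else [:: ((k.1, ([::], ([::], ins c k.2.2.2))), (1, 0))]
  else if k.1 is _ :: m then
    [seq ((m, ([:: i0 c], (k.2.2.2, [::]))), u c e) | c <- enum C]
  else [:: (k, (1, 0))].

(** The total weight of all ways to complete the configuration: the quantity that [paths]
    conserves. *)
Definition phi e k : rat :=
  let gr := grow i0 d1 d2 b0 aS (fun c => zv (u c e)) (fun t => zv (v t e)) in
  if k.2.1 is c :: _ then meet d1 d2 (fun t => zv (v t e)) (gr (size k.1)) c k.2.2.1 k.2.2.2
  else gr (size k.1) k.2.2.2.

Lemma phi_succ e k : phi e k = wsum (phi e) (succ e k).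
Proof.
set gr := grow i0 d1 d2 b0 aS (fun c => zv (u c e)) (fun t => zv (v t e)).
have sgr m : psym (gr m) by apply: grow_sym.
case: k => m [[|c cur] [todo don]]; rewrite /succ /=.
  case: m => [|x m] /=; first by rewrite /wsum big_seq1 zv1 mul1r.
  by rewrite /wsum big_map big_enum.
case: todo => [|x todo] /=.
  by rewrite /wsum big_seq1 zv1 mul1r /phi /=; apply: sgr; rewrite perm_sym perm_ins.
rewrite /wsum big_map big_enum /phi /=; apply: eq_bigr => t _; congr (_ * _)%R.
by apply: meet_don => //; rewrite perm_sym perm_ins.
Qed.

Definition ksize k := size k.1 + size k.2.1 + size k.2.2.1 + size k.2.2.2.
Definition valid e k : Prop :=
  [/\ ksize k = size (nn e), size k.2.1 <= 1, sorted (@leS S) k.2.2.1, sorted (@leS S) k.2.2.2 &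
     k.2.1 = [::] -> k.2.2.1 = [::]].

Lemma size_ins x l : size (@ins S x l) = (size l).+1.
Proof. by rewrite (perm_size (perm_ins x l)). Qed.

Lemma valid_succ e k k' : valid e k -> k' \in map fst (succ e k) -> valid e k'.
Proof.
case: k => m [[|c [|? ?]] [todo don]]; rewrite /succ /=; last by case.
  case: m => [|x m] [/= s1 s2 s3 s4 s5]; first by rewrite inE => /eqP ->.
  have t0 := s5 erefl; rewrite t0 {s5} in s1 s3 *.
  rewrite -map_comp => /mapP [c _ ->]; split => //=; move: s1; rewrite /ksize /=; lia.
case: todo => [|x todo] [/= s1 s2 s3 s4 s5].
  rewrite inE => /eqP ->; split => //=; last exact: ins_sorted.
  by move: s1; rewrite /ksize /= size_ins; lia.
rewrite -map_comp => /mapP [t _ ->]; split => //=.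
- by move: s1; rewrite /ksize /= size_ins; lia.
- exact: path_sorted s3.
- exact: ins_sorted.
Qed.

(** A bound on the rounds left: each element to come is drawn once, meets at most [size (nn e)]
    others and is filed once. *)
Definition mu e k := size k.1 * (size (nn e) + 2) + (if k.2.1 is [::] then 0 else (size k.2.2.1).+1).

Lemma mu_succ e k k' : k' \in map fst (succ e k) -> valid e k -> mu e k' <= (mu e k).-1.
Proof.
case: k => m [[|c cur] [todo don]]; rewrite /succ /=.
  case: m => [|x m]; first by rewrite inE => /eqP -> _; rewrite /mu.
  rewrite /= -map_comp => /mapP [c _ ->] [/= s1 _ _ _ s5].
  by move: s1; rewrite (s5 erefl) /ksize /mu /= mulSn; lia.
case: todo => [|x todo].
  by rewrite inE => /eqP -> _; rewrite /mu /=; lia.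
by rewrite -map_comp => /mapP [t _ ->] _; rewrite /mu /=; lia.
Qed.

Definition key0 e : key S := (nn e, ([::], ([::], [::]))).
Definition steps e : seq unit := flatten [seq tt :: tt :: nn e | _ <- nn e].

Lemma size_steps e : size (steps e) = mu e (key0 e).
Proof.
rewrite /steps /mu /= addn0; have : forall l : seq unit, size (flatten [seq tt :: tt :: nn e | _ <- l]) = size l * (size (nn e) + 2).
  by elim=> //= _ l IH; rewrite size_cat IH mulSn addn2.
exact.
Qed.

Lemma valid0 e : valid e (key0 e).
Proof. by split => //; rewrite /ksize /= !addn0. Qed.

Lemma size_unit_inj (a b : seq unit) : size a = size b -> a = b.
Proof. by elim: a b => [|[] a IH] [|[] b] //= [/IH ->]. Qed.

Lemma sz_unit (x : unit) : sz x = 1. Proof. by []. Qed.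

Lemma sz_seqS (s : seq S) : sz s <= size s * (2 * #|S| + 2) + 1.
Proof.
elim: s => // x s IH; rewrite sz_cons /= mulSn.
have: sz x <= 2 * #|S| + 1.
  have sn n : sz (nseq n tt) = 2 * n + 1 by elim: n => // n IHn; rewrite /= sz_cons IHn sz_unit; lia.
  have := sn (enum_rank x); rewrite /sz /enc /= /ES_machine /Enc_fin => ->.
  by rewrite leq_add2r leq_mul2l ltnW.
by move: (sz x) (sz s) #|S| IH => a b N; lia.
Qed.

Lemma sz_sequnit (s : seq unit) : sz s = 2 * size s + 1.
Proof. by elim: s => // x s IH; rewrite sz_cons /= IH sz_unit; lia. Qed.

Lemma valid_sz e k : valid e k -> sz k <= 3 * (sz (nn e) * (2 * #|S| + 2) + 1) + 2 * sz (nn e) + 4.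
Proof.
case: k => m [cur [todo don]] [/= s1 _ _ _ _]; rewrite !sz_pair sz_sequnit.
have := size_sz (nn e); have := sz_seqS cur; have := sz_seqS todo; have := sz_seqS don.
rewrite sz_sequnit; move: s1; rewrite /ksize /=; move: (size (nn e)) => N.
by move: (2 * #|S| + 2); nia.
Qed.

(* A sorted list is determined by its multiplicities, whence the polynomial bound on the number
   of configurations. *)
Definition hist N (s : seq S) : {ffun S -> 'I_N.+1} := [ffun x => inord (count_mem x s)].

Lemma hist_inj N (s t : seq S) : size s <= N -> size t <= N -> sorted (@leS S) s -> sorted (@leS S) t ->
  hist N s = hist N t -> s = t.
Proof.
move=> ls lt os ot H; apply: (sorted_eq (@leS_trans S) (@leS_anti S)) => //.
rewrite /perm_eq; apply/allP => x _ /=.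
have := congr1 (fun f : {ffun S -> 'I_N.+1} => nat_of_ord (f x)) H.
by rewrite !ffunE !inordK ?ltnS ?(leq_trans (count_size _ _)) // => ->.
Qed.

Lemma valid_card e (s : seq (key S)) : uniq s -> (forall k, k \in s -> valid e k) ->
  size s <= (sz (nn e)).+1 * ((sz (nn e)).+1 ^ #|S| * ((sz (nn e)).+1 ^ #|S| * (sz (nn e)).+1 ^ #|S|)).
Proof.
move=> us vs; set N := sz (nn e).
pose h k : 'I_N.+1 * ({ffun S -> 'I_N.+1} * ({ffun S -> 'I_N.+1} * {ffun S -> 'I_N.+1})) :=
  (inord (size k.1), (hist N k.2.1, (hist N k.2.2.1, hist N k.2.2.2))).
have hi : {in s &, injective h}.
  move=> k1 k2 /vs v1 /vs v2.
  have sN : size (nn e) <= N by apply: size_sz.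
  case: k1 v1 => m1 [c1 [t1 o1]] [/= a1 a2 a3 a4 _].
  case: k2 v2 => m2 [c2 [t2 o2]] [/= b1 b2 b3 b4 _].
  rewrite /ksize /= in a1 b1; rewrite /h /= => -[/(congr1 val) /=].
  rewrite !inordK; try lia; move=> /size_unit_inj -> h1 h2 h3.
  have so (c : seq S) : size c <= 1 -> sorted (@leS S) c by case: c => [|? [|]].
  rewrite (hist_inj _ _ (so _ a2) (so _ b2) h1); try lia.
  rewrite (hist_inj _ _ a3 b3 h2); try lia.
  by rewrite (hist_inj _ _ a4 b4 h3); try lia.
have := map_inj_in_uniq hi; rewrite us -(size_map h).
move=> /card_uniqP <-; apply: leq_trans (max_card _) _.
by rewrite !card_prod !card_ffun !card_ord.
Qed.

(** The states [c] and [x] are eliminated by case distinction over [S], after which the values of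
    [i0], [d1] and [d2] are constants of the program. *)
Lemma pt_succ : pt (fun p : E * key S => succ p.1 p.2).
Proof.
have iS := @enc_inj_fin S.
rewrite /succ.
apply: (pt_case (l := fun p : E * key S => p.2.2.1)
 (f := fun p => if p.2.1 is _ :: m then
    [seq ((m, ([:: i0 c], (p.2.2.2.2, [::]))), u c p.1) | c <- enum C] else [:: (p.2, (1, 0))])
 (g := fun p c _ => if p.2.2.2.1 is x :: t then
      [seq ((p.2.1, ([:: d1 tau c x], (t, ins (d2 tau c x) p.2.2.2.2))), v tau p.1) | tau <- enum T]
    else [:: ((p.2.1, ([::], ([::], ins c p.2.2.2.2))), (1, 0))])); first by pts.
- apply: (pt_case (l := fun p : E * key S => p.2.1) (f := fun p => [:: (p.2, (1, 0))])
   (g := fun p _ m => [seq ((m, ([:: i0 c], (p.2.2.2.2, [::]))), u c p.1) | c <- enum C])); [pts|pts|].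
  apply: (pt_const_map (f := fun c (q : E * key S * (unit * seq unit)) =>
     ((q.2.2, ([:: i0 c], (q.1.2.2.2.2, [::]))), u c q.1.1))) => c.
  by apply: pt_pair; [pts|apply: (pt_comp (f := u c)); pts].
- apply: (pt_case (l := fun q : E * key S * (S * seq S) => q.1.2.2.2.1)
   (f := fun q => [:: ((q.1.2.1, ([::], ([::], ins q.2.1 q.1.2.2.2.2))), (1, 0))])
   (g := fun q x t => [seq ((q.1.2.1, ([:: d1 tau q.2.1 x], (t, ins (d2 tau q.2.1 x) q.1.2.2.2.2))), v tau q.1.1)
      | tau <- enum T])); first by pts.
    apply: (@pt_fincase _ _ _ _ _ _ (fun q : E * key S * (S * seq S) => q.2.1) (fun c q => [:: ((q.1.2.1, ([::], ([::], ins c q.1.2.2.2.2))), (1, 0))])); [by []|pts|move=> c].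
    have p1 : pt (fun q : E * key S * (S * seq S) => ins c q.1.2.2.2.2) by apply: pt_ins; pts.
    pts.
  apply: (@pt_fincase _ _ _ _ _ _ (fun r : E * key S * (S * seq S) * (S * seq S) => r.1.2.1) (fun c r => [seq ((r.1.1.2.1, ([:: d1 tau c r.2.1], (r.2.2, ins (d2 tau c r.2.1) r.1.1.2.2.2.2))), v tau r.1.1.1)
      | tau <- enum T])); [by []|pts|move=> c].
  apply: (@pt_fincase _ _ _ _ _ _ (fun r : E * key S * (S * seq S) * (S * seq S) => r.2.1) (fun x r => [seq ((r.1.1.2.1, ([:: d1 tau c x], (r.2.2, ins (d2 tau c x) r.1.1.2.2.2.2))), v tau r.1.1.1)
      | tau <- enum T])); [by []|pts|move=> x].
  apply: (pt_const_map (f := fun tau (r : E * key S * (S * seq S) * (S * seq S)) =>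
     ((r.1.1.2.1, ([:: d1 tau c x], (r.2.2, ins (d2 tau c x) r.1.1.2.2.2.2))), v tau r.1.1.1))) => tau.
  apply: pt_pair; last by apply: (pt_comp (f := v tau)); pts.
  have p1 : pt (fun r : E * key S * (S * seq S) * (S * seq S) => ins (d2 tau c x) r.1.1.2.2.2.2).
    by apply: pt_ins; pts.
  pts.
Qed.

Definition final e : seq (key S * zz) := paths succ key0 steps e.
Definition result e : zz :=
  foldl zadd (0, 0) [seq (if accept b0 aS x.1.2.2.2 then x.2 else (0, 0)) | x <- final e].

(** The sum of [phi] over the final list is its value at [key0], which is [grow] from the empty
    list; at the keys reached, all of them final, [phi] is the 0/1 value of [accept]. *)
Lemma result_val e : zv (result e) =
  grow i0 d1 d2 b0 aS (fun c => zv (u c e)) (fun t => zv (v t e)) (size (nn e)) [::].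
Proof.
rewrite /result zv_foldl zv0 add0r big_map.
have := @wsum_paths _ _ succ key0 steps e (phi e) (phi_succ e) ; rewrite /phi /= => <-.
rewrite /wsum -/(final e) big_seq [in RHS]big_seq; apply: eq_bigr => x xin.
have mu0 : mu e x.1 = 0.
  apply: (@paths_final _ _ succ valid key0 steps valid0 valid_succ e (mu e)).
  - by move=> k k' kin vk; apply: mu_succ.
  - by rewrite size_steps.
  - exact: map_f.
move: mu0; case: x {xin} => -[m [[|c cur] [todo don]]] z; rewrite /mu /phi /=; last by lia.
case: m => [|y m] /=; last by rewrite mulSn; lia.
by case: (accept _ _ _); rewrite ?zv0 ?mulr1 ?mulr0.
Qed.

Lemma pt_key0 : pt key0. Proof. rewrite /key0; pts. Qed.

Lemma pt_final : pt final.
Proof.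
have bn : pbd (fun e => sz (nn e)) by pbds.
apply: (@pt_paths _ _ (@key_inj S) _ _ succ valid key0 steps
  (fun e => 3 * (sz (nn e) * (2 * #|S| + 2) + 1) + 2 * sz (nn e) + 4)
  (fun e => (sz (nn e)).+1 * ((sz (nn e)).+1 ^ #|S| * ((sz (nn e)).+1 ^ #|S| * (sz (nn e)).+1 ^ #|S|)))).
- exact: pt_succ.
- exact: pt_key0.
- rewrite /steps; apply: pt_flatten.
  apply: (pt_map (f := fun e (_ : unit) => tt :: tt :: nn e)) => //.
  have p1 : pt (fun p : E * unit => nn p.1) by apply: (pt_comp (f := nn)); pts.
  pts.
- pbds.
- pbds.
- exact: valid0.
- exact: valid_succ.
- exact: valid_sz.
- exact: valid_card.
Qed.

Lemma pt_result : pt result.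
Proof.
apply: pt_zsum.
apply: (pt_map (f := fun (_ : E) (x : key S * zz) => if accept b0 aS x.1.2.2.2 then x.2 else (0, 0))); last exact: pt_final.
apply: pt_if; [|pts|pts].
rewrite /accept; apply: (pt_ext (f := fun p : E * (key S * zz) => if p.2.1.2.2.2 is x :: r then all aS (x :: r) else b0)).
  by move=> p; case: (p.2.1.2.2.2).
apply: (pt_case (l := fun p : E * (key S * zz) => p.2.1.2.2.2) (g := fun _ x r => all aS (x :: r)) (f := fun _ => b0)); [pts|pts|].
apply: (pt_all (f := fun _ x => aS x)); last by pts.
by apply: (pt_fin aS (@enc_inj_fin S)); pts.
Qed.

End Machine.

(** * Weighted sums over sets of atoms *)

Section Wsum.
Variables (A : finType) (wt : A -> bool -> rat).
Implicit Types (X Y B : {set A}) (F : {set A} -> rat).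

Definition Wsum X F : rat := (\sum_(B : {set A} | B \subset X) (\prod_(a in X) wt a (a \in B)) * F B)%R.

Lemma eq_Wsum X F F' : (forall B, B \subset X -> F B = F' B) -> Wsum X F = Wsum X F'.
Proof. by move=> H; apply: eq_bigr => B /H ->. Qed.

Lemma Wsum_split X Y F : [disjoint X & Y] ->
  Wsum (X :|: Y) F = Wsum X (fun B => Wsum Y (fun B' => F (B :|: B'))).
Proof.
move=> dXY; rewrite /Wsum.
rewrite (partition_big (fun B => B :&: X) (fun B => B \subset X)); last by move=> B _; apply: subsetIr.
apply: eq_bigr => B1 /= sB1.
rewrite (reindex_onto (fun B2 => B1 :|: B2) (fun B => B :&: Y)) /=; last first.
  move=> B /andP [sB /eqP <-]; rewrite -setIUr; exact/setIidPl.
have dY B2 : B2 \subset Y -> B2 :&: X = set0.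
  by move=> sB2; apply/setP => a; rewrite !inE; apply/negbTE/negP => /andP [/(subsetP sB2) aY aX];
     have := disjointFr dXY aX; rewrite aY.
have dX : B1 :&: Y = set0.
  by apply/setP => a; rewrite !inE; apply/negbTE/negP => /andP [/(subsetP sB1) aX aY];
     have := disjointFr dXY aX; rewrite aY.
rewrite mulr_sumr; apply: eq_big => [B2|B2 /andP [/andP [H1 /eqP H2] /eqP H3]].
  apply/idP/idP => [/andP [_ /eqP <-]|sB2]; first exact: subsetIr.
  by rewrite setUSS // setIUl (setIidPl sB1) dY // setU0 eqxx setIUl dX set0U (setIidPl sB2) eqxx.
have sB2 : B2 \subset Y by rewrite -H3; apply: subsetIr.
rewrite mulrA; congr (_ * _)%R; rewrite (eq_bigl [predU X & Y]) => [|a]; last by rewrite !inE.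
rewrite bigU //=; congr (_ * _)%R.
  apply: eq_bigr => a aX; rewrite inE; congr wt.
  by case: (boolP (a \in B2)) => [/(subsetP sB2) aY|]; rewrite ?orbF //; have := disjointFr dXY aX; rewrite aY.
apply: eq_bigr => a aY; rewrite inE; congr wt.
by case: (boolP (a \in B1)) => // /(subsetP sB1) aX; have := disjointFr dXY aX; rewrite aY.
Qed.

Lemma Wsum_img (U : finType) (f : U -> A) F : injective f ->
  Wsum (f @: [set: U]) F = (\sum_(C : {set U}) (\prod_u wt (f u) (u \in C)) * F (f @: C))%R.
Proof.
move=> inj; rewrite /Wsum (reindex_onto (fun C : {set U} => f @: C) (fun B => f @^-1: B)) /=; last first.
  move=> B sB; apply/setP => a; apply/imsetP/idP => [[u]|aB]; first by rewrite inE => ? ->.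
  by have /imsetP [u _ e] := subsetP sB _ aB; exists u => //; rewrite inE -e.
apply: eq_big => [C|C _].
  rewrite imsetS ?subsetT //=; apply/eqP/setP => u.
  by rewrite inE (mem_imset _ _ inj).
congr (_ * _)%R; rewrite big_imset /=; last by move=> x y _ _; apply: inj.
by apply: eq_big => [u|u _]; rewrite ?inE // (mem_imset _ _ inj).
Qed.

Lemma Wsum0 F : Wsum set0 F = F set0.
Proof.
rewrite /Wsum (big_pred1 set0) => [|B]; last by rewrite subset0.
by rewrite big_set0 mul1r.
Qed.

Lemma Wsum1 a F : Wsum [set a] F = (wt a true * F [set a] + wt a false * F set0)%R.
Proof.
rewrite /Wsum (bigD1 [set a]) //= (big_pred1 set0) => [|B].
  by rewrite !big_set1 !inE eqxx.
rewrite subset1 /=; case: (eqVneq B set0) => [->|_]; last by rewrite orbF andbN.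
by rewrite orbT /=; apply/eqP => /setP /(_ a); rewrite !inE eqxx.
Qed.

(** Expanding the product over [X] gives one summand per subset. This disposes of atoms whose truth
    does not influence the summand. *)
Lemma Wsum_const X c : Wsum X (fun _ => c) = (\prod_(a in X) (wt a true + wt a false) * c)%R.
Proof.
elim: {X}_.+1 {-2}X (ltnSn #|X|) => // m IH X lt.
have [->|/set0Pn [a aX]] := eqVneq X set0; first by rewrite Wsum0 big_set0 mul1r.
rewrite -{1}(setD1K aX) Wsum_split; last first.
  by rewrite -setI_eq0; apply/eqP/setP => b; rewrite !inE; case: eqP.
rewrite Wsum1 !IH; try by move: lt; rewrite (cardsD1 a X) aX; lia.
by rewrite [in RHS](big_setD1 a) //=; ring.
Qed.
End Wsum.

(** * The recursion on states computes a weighted sum over worlds *)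

Section Types.
(** [inst1 i] places the atoms of a 1-type at [i], [inst2 i j] those of a 2-type at the pair [i],
    [j]; [flip] exchanges the two places. [supp] is the set of elements of an atom. *)
Variables (n q K : nat) (A U1 U2 : finType) (supp : A -> {set 'I_n}).
Variables (inst1 : 'I_n -> U1 -> A) (inst2 : 'I_n -> 'I_n -> U2 -> A) (flip : U2 -> U2).
Hypotheses (inst1_inj : forall i, injective (inst1 i))
  (inst1_img : forall i, inst1 i @: setT = [set a | supp a == [set i]])
  (inst2_inj : forall i j, i != j -> injective (inst2 i j))
  (inst2_img : forall i j, i != j -> inst2 i j @: setT = [set a | supp a == [set i; j]])
  (flipE : forall i j u, inst2 i j (flip u) = inst2 j i u).
Variables (wt : A -> bool -> rat) (w1 : U1 -> bool -> rat) (w2 : U2 -> bool -> rat).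
Hypotheses (wt1 : forall i u b, wt (inst1 i u) b = w1 u b)
  (wt2 : forall i j u b, wt (inst2 i j u) b = w2 u b).

Definition state : finType := ({set U1} * {ffun 'I_q -> 'I_K.+1})%type.
Variables (self : 'I_q -> {set U1} -> bool) (contrib : 'I_q -> {set U1} -> {set U1} -> {set U2} -> bool).
Variables (b0 : bool) (aS : state -> bool).

(* A state: the 1-type and, for every quantifier occurrence, the number of witnesses so far,
   where [K] stands for [K] or more. *)
Definition cap (m : nat) : 'I_K.+1 := inord (minn K m).
(** An element may be a witness for itself, which [self] records before any meeting. *)
Definition i0 (c : {set U1}) : state := (c, [ffun k => cap (self k c)]).
Definition flips (tau : {set U2}) := [set u | flip u \in tau].
Definition d1 (tau : {set U2}) (c x : state) : state :=
  (c.1, [ffun k => cap (c.2 k + contrib k c.1 x.1 tau)]).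
Definition d2 (tau : {set U2}) (c x : state) : state :=
  (x.1, [ffun k => cap (x.2 k + contrib k x.1 c.1 (flips tau))]).

Lemma capE m : cap m = minn K m :> nat.
Proof. by rewrite /cap inordK // ltnS geq_minl. Qed.
Lemma capD m m' : cap (cap m + m') = cap (m + m').
Proof. by apply: val_inj; rewrite /= !capE; lia. Qed.

Lemma d1_comm t t' c x y : d1 t' (d1 t c x) y = d1 t (d1 t' c y) x.
Proof.
rewrite /d1 /=; congr (_, _); apply/ffunP => k; rewrite !ffunE !capD.
by rewrite -!addnA [contrib k _ _ t + _]addnC.
Qed.
Lemma d2_comm t t' c x y : d2 t' (d1 t c x) y = d2 t' c y.
Proof. by []. Qed.

Definition cell (B : {set A}) i : {set U1} := [set u | inst1 i u \in B].
Definition pty (B : {set A}) i j : {set U2} := [set u | inst2 i j u \in B].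
Definition cnt (B : {set A}) (N : seq 'I_n) i k : nat :=
  self k (cell B i) + \sum_(j | (j \in N) && (j != i)) contrib k (cell B i) (cell B j) (pty B i j).
Definition st (B : {set A}) N i : state := (cell B i, [ffun k => cap (cnt B N i k)]).

Definition A12 := [set a | (0 < #|supp a| <= 2)].
Definition accF (B : {set A}) : bool :=
  if n == 0 then b0 else [forall i, aS (st B (enum 'I_n) i)].

Let u1 (C : {set U1}) := (\prod_u w1 u (u \in C))%R.
Let u2 (C : {set U2}) := (\prod_u w2 u (u \in C))%R.
Let F B : rat := ((accF B)%:R)%R.
Let gr m s := grow i0 d1 d2 b0 aS u1 u2 m s.

(* [rest ls]: the atoms over one or two elements not decided yet when the elements [ls] have been
   added; [restw i td dn]: likewise while the new element [i] has met [dn] but not [td]. *)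
Definition sset (l : seq 'I_n) : {set 'I_n} := [set x in l].
Definition rest (ls : seq 'I_n) := [set a in A12 | ~~ (supp a \subset sset ls)].
Definition restw i (td dn : seq 'I_n) := [set a in A12 |
  ~~ (supp a \subset sset (i :: td ++ dn)) || has (fun j => supp a == [set i; j]) td].

Lemma st_eq B B' N N' i : cell B i = cell B' i -> (forall j, j != i -> (j \in N) = (j \in N')) ->
  (forall j, j \in N -> j != i -> cell B j = cell B' j /\ pty B i j = pty B' i j) -> st B N i = st B' N' i.
Proof.
move=> e1 e2 e3; rewrite /st e1; congr (_, _); apply/ffunP => k; rewrite !ffunE /cnt e1; congr (cap (_ + _)).
apply: eq_big => [j|j /andP [jN ji]]; last by have [-> ->] := e3 _ jN ji.
by case: (eqVneq j i) => [|ne]; rewrite ?andbF ?andbT // e2.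
Qed.

Lemma supp_inst1 i u : supp (inst1 i u) = [set i].
Proof.
have : inst1 i u \in inst1 i @: setT by apply: imset_f; rewrite inE.
by rewrite inst1_img inE => /eqP.
Qed.
Lemma supp_inst2 i j u : i != j -> supp (inst2 i j u) = [set i; j].
Proof.
move=> ne; have : inst2 i j u \in inst2 i j @: setT by apply: imset_f; rewrite inE.
by rewrite inst2_img // inE => /eqP.
Qed.

Lemma set2_eq (T : finType) (a b c d : T) : [set a; b] = [set c; d] -> (a == c) && (b == d) || (a == d) && (b == c).
Proof.
move=> /setP e; have := e a; have := e b; have := e c; have := e d; rewrite !inE !eqxx /= ?orbT.
rewrite ![_ == a]eq_sym ![_ == b]eq_sym.
by case: (a == c); case: (a == d); case: (b == c); case: (b == d).
Qed.

Section AddPair.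
Variables (B : {set A}) (i j : 'I_n) (tau : {set U2}).
Hypotheses (ij : i != j) (Bij : forall a, a \in B -> supp a != [set i; j]).
Let B' := B :|: inst2 i j @: tau.

Lemma cell_add k : cell B' k = cell B k.
Proof.
apply/setP => u; rewrite !inE; case: (inst1 k u \in B) => //=; apply/negbTE/imsetP => -[u' _ e].
have := supp_inst2 u' ij; rewrite -e supp_inst1 => /(congr1 (fun s : {set 'I_n} => #|s|)).
by rewrite cards1 cards2 ij.
Qed.

Lemma pty_add a b : a != b -> [set a; b] != [set i; j] -> pty B' a b = pty B a b.
Proof.
move=> ab ne; apply/setP => u; rewrite !inE; case: (inst2 a b u \in B) => //=.
apply/negbTE/imsetP => -[u' _ e]; move/eqP: ne; apply.
by rewrite -(supp_inst2 u' ij) -e supp_inst2.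
Qed.

Lemma pty_add_ij : pty B' i j = tau.
Proof.
apply/setP => u; rewrite !inE (mem_imset _ _ (inst2_inj ij)).
by case: (boolP (inst2 i j u \in B)) => // /Bij; rewrite supp_inst2 // eqxx.
Qed.

Lemma pty_add_ji : pty B' j i = flips tau.
Proof.
apply/setP => u; rewrite !inE -flipE (mem_imset _ _ (inst2_inj ij)).
by case: (boolP (inst2 i j (flip u) \in B)) => // /Bij; rewrite supp_inst2 // eqxx.
Qed.
End AddPair.

Lemma cntS B N x i k : x \notin N -> x != i ->
  cnt B (x :: N) i k = cnt B N i k + contrib k (cell B i) (cell B x) (pty B i x).
Proof.
move=> xN xi; rewrite /cnt (bigD1 x) /=; last by rewrite inE eqxx xi.
rewrite -addnA [contrib _ _ _ _ + _]addnC; congr (_ + (_ + _)); apply: eq_bigl => j.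
rewrite inE; case: (eqVneq j x) => [->|_] /=; last by rewrite andbT.
by rewrite (negbTE xN) !andbF.
Qed.

(** [HV] is the induction hypothesis of [grow_map]. For the next [j] in [td], the atoms over exactly
    [i] and [j] are split off and summed over as a 2-type; they alter no cell and no other pair, so
    only the counters of [i] and [j] move. A counter covers precisely the elements already met. *)
Lemma meet_map m i (td dn : seq 'I_n) (B : {set A}) :
  uniq (i :: td ++ dn) ->
  (forall (ls : seq 'I_n) (B' : {set A}), perm_eq ls (i :: td ++ dn) -> (forall a, a \in B' -> supp a \subset sset ls) ->
     gr m (map (st B' ls) ls) = Wsum wt (rest ls) (fun B'' => F (B' :|: B''))) ->
  (forall a, a \in B -> supp a \subset sset (i :: td ++ dn)) ->
  (forall a j, a \in B -> j \in td -> supp a != [set i; j]) ->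
  meet d1 d2 u2 (gr m) (st B (i :: dn) i) (map (st B (td ++ dn)) td) (map (st B (i :: td ++ dn)) dn) =
  Wsum wt (restw i td dn) (fun B' => F (B :|: B')).
Proof.
elim: td dn B => [|j td IH] dn B /= un HV sB nB.
  have -> : restw i [::] dn = rest (i :: dn) by apply/setP => a; rewrite !inE orbF.
  by rewrite -HV.
have [ij jdn jtd itd] : [/\ i != j, j \notin dn, j \notin td & i \notin td ++ dn].
  case/and3P: un; rewrite inE negb_or => /andP [-> ->]; rewrite mem_cat negb_or => /andP [-> ->].
  by [].
have idn : i \notin dn by move: itd; rewrite mem_cat negb_or => /andP [].
have restE : restw i (j :: td) dn = inst2 i j @: setT :|: restw i td (j :: dn).
  apply/setP => a; rewrite inst2_img // !inE /=.
  case: eqP => [e|_] /=; first by rewrite e cards2 ij orbT.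
  have -> // : sset (i :: j :: td ++ dn) = sset (i :: td ++ j :: dn).
  by apply/setP => x; rewrite !inE !mem_cat !inE; do 3 case: (x == _) => //=; rewrite ?orbT.
rewrite restE Wsum_split; last first.
  rewrite inst2_img // -setI_eq0; apply/eqP/setP => a; rewrite !inE.
  case: eqP => //= e; rewrite e; apply/negbTE; rewrite negb_and negb_or negbK; apply/orP; right.
  apply/andP; split.
    by apply/subsetP => x; rewrite !inE mem_cat inE => /orP [] /eqP ->; rewrite eqxx ?orbT.
  apply/hasPn => x xtd; apply/eqP => /set2_eq; rewrite eqxx /= => /orP [/eqP e'|/andP [/eqP e' _]].
    by move: jtd; rewrite e' xtd.
  by move: itd; rewrite e' mem_cat xtd.
rewrite Wsum_img; last exact: inst2_inj.
apply: eq_bigr => tau _; congr (_ * _)%R; first by apply: eq_bigr => x _; rewrite wt2.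
under eq_Wsum => B' _ do rewrite setUA.
set B1 := B :|: _.
have nBij a : a \in B -> supp a != [set i; j] by move=> aB; apply: nB; rewrite ?inE ?eqxx.
have cE k : cell B1 k = cell B k by apply: cell_add.
have pE a b : a != b -> [set a; b] != [set i; j] -> pty B1 a b = pty B a b by apply: pty_add.
have ne2 a b : a \notin [:: i; j] -> [set a; b] != [set i; j].
  rewrite !inE negb_or => /andP [n1 n2]; apply/eqP => /set2_eq.
  by rewrite (negbTE n1) (negbTE n2).
have pm : perm_eq (i :: td ++ j :: dn) (i :: j :: td ++ dn).
  by rewrite perm_cons perm_catC /= perm_cons perm_catC.
rewrite -IH; first 1 last.
- by rewrite (perm_uniq pm) /= un.
- move=> ls B' p; apply: HV; exact: perm_trans p pm.
- have <- : sset (i :: j :: td ++ dn) = sset (i :: td ++ j :: dn).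
    by apply/setP => x; rewrite !in_set (perm_mem pm).
  move=> a; rewrite inE => /orP [/sB //|/imsetP [x _ ->]]; rewrite supp_inst2 //.
  by apply/subsetP => y; rewrite !inE => /orP [] ->; rewrite ?orbT.
- move=> a k; rewrite inE => /orP [aB ktd|/imsetP [x _ ->] ktd].
    by apply: nB; rewrite // inE ktd orbT.
  rewrite supp_inst2 //; apply/eqP => /set2_eq; rewrite eqxx /= => /orP [/eqP e|/andP [/eqP e _]].
    by move: jtd; rewrite e ktd.
  by move: itd; rewrite e mem_cat ktd.
congr meet.
- rewrite /d1 /st /= cE; congr (_, _); apply/ffunP => k; rewrite !ffunE.
  have -> : cnt B1 (i :: j :: dn) i k = cnt B1 (j :: i :: dn) i k.
    by congr (_ + _); apply: eq_bigl => x; rewrite !inE orbCA.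
  rewrite [in RHS]cntS; [|by rewrite inE negb_or eq_sym ij|by rewrite eq_sym].
  rewrite capD !cE pty_add_ij //.
  congr (cap (_ + _)); rewrite /cnt !cE; congr (_ + _); apply: eq_bigr => x /andP [xi ix].
  rewrite cE pE //; first by rewrite eq_sym.
  apply/eqP => /set2_eq; rewrite eqxx /= => /orP [/eqP e|/andP [/eqP e _]].
    by move: xi; rewrite e inE eq_sym (negbTE ij) (negbTE jdn).
  by move: ij; rewrite e eqxx.
- apply/eq_in_map => k ktd; have kij : k \notin [:: i; j].
    rewrite !inE negb_or; apply/andP; split; apply/eqP => e.
      by move: itd; rewrite mem_cat -e ktd.
    by move: jtd; rewrite -e ktd.
  apply: st_eq => [|x _|x _ xk]; rewrite ?cE //.
    by rewrite !inE !mem_cat inE orbCA.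
  by rewrite pE //; [rewrite eq_sym|exact: ne2].
rewrite /=; congr (_ :: _).
  rewrite /d2 /st /= cE; congr (_, _); apply/ffunP => k; rewrite !ffunE.
  have -> : cnt B1 (i :: td ++ j :: dn) j k = cnt B1 (i :: td ++ dn) j k.
    congr (_ + _); apply: eq_bigl => x; rewrite !inE !mem_cat inE.
    by case: (x == j); rewrite ?andbF.
  have -> : cnt B (j :: td ++ dn) j k = cnt B (td ++ dn) j k.
    by congr (_ + _); apply: eq_bigl => x; rewrite !inE; case: (x == j); rewrite ?andbF.
  rewrite [in RHS]cntS // capD !cE pty_add_ji //.
  congr (cap (_ + _)); rewrite /cnt !cE; congr (_ + _); apply: eq_bigr => x /andP [xi ix].
  rewrite cE pE //; first by rewrite eq_sym.
  apply/eqP => /set2_eq; rewrite eqxx /= => /orP [/andP [/eqP e _]|/eqP e].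
    by move: ij; rewrite e eqxx.
  by move: itd; rewrite -e xi.
apply/eq_in_map => k kdn; have kij : k \notin [:: i; j].
  rewrite !inE negb_or; apply/andP; split; apply/eqP => e; first by move: idn; rewrite -e kdn.
  by move: jdn; rewrite -e kdn.
apply: st_eq => [|x _|x _ xk]; rewrite ?cE //.
  by rewrite !inE !mem_cat inE; do 2 case: (x == _) => //=; rewrite ?orbT.
by rewrite pE //; [rewrite eq_sym|exact: ne2].
Qed.

(** A new element brings the atoms over itself alone, chosen by its 1-type; those shared with one
    earlier element are left to [meet_map]. *)
Lemma grow_map (us ls : seq 'I_n) (B : {set A}) : uniq (ls ++ us) -> (forall i, i \in ls ++ us) ->
  (forall a, a \in B -> supp a \subset sset ls) ->
  gr (size us) (map (st B ls) ls) = Wsum wt (rest ls) (fun B' => F (B :|: B')).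
Proof.
elim: us ls B => [|i us IH] ls B; rewrite ?cats0 => un lsall sB.
  have -> : rest ls = set0.
    apply/setP => a; rewrite !inE; apply/negbTE; rewrite negb_and negbK; apply/orP; right.
    by apply/subsetP => x _; rewrite inE.
  rewrite Wsum0 setU0 /gr /= /F; congr (_%:R)%R; congr nat_of_bool.
  have sz : size ls = n.
    transitivity (size (enum 'I_n)); last exact: size_enum_ord.
    apply: perm_size; apply: uniq_perm => //; first exact: enum_uniq.
    by move=> x; rewrite lsall mem_enum.
  have n0 : (n == 0) = nilp ls by rewrite /nilp sz.
  have aE s : accept b0 aS s = if nilp s then b0 else all aS s by case: s.
  rewrite aE /nilp size_map -/(nilp ls) /accF n0; case: ifP => // _.
  rewrite all_map; apply/allP/forallP => H j; last first.
    move=> _ /=; have := H j; rewrite (_ : st B _ j = st B ls j) //.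
    by apply: st_eq => // k _; rewrite lsall mem_enum.
  have := H j (lsall j); rewrite /= (_ : st B ls j = st B (enum 'I_n) j) //.
  by apply: st_eq => // k _; rewrite lsall mem_enum.
have inls : i \notin ls by move: un; rewrite cat_uniq /= => /and3P [_ /norP []].
(* An atom over one or two elements not all in [ls] is over [i] alone, or over [i] and one element
   of [ls], or involves an element outside [i :: ls]. *)
have restE : rest ls = inst1 i @: setT :|: restw i ls [::].
  apply/setP => a; rewrite inst1_img !inE cats0 /=.
  case: (boolP (supp a \subset sset ls)) => [sa|nsa] /=; rewrite ?andbF ?andbT.
    symmetry; apply/norP; split.
      by apply: contra inls => /eqP e; have := subsetP sa i; rewrite e !inE eqxx => /(_ isT).
    apply/negP => /andP [_ /orP [/negP|/hasP [j jls /eqP e]]].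
      by apply; apply: subset_trans sa _; apply/subsetP => x; rewrite !inE orbC => ->.
    by move: inls; have := subsetP sa i; rewrite e !inE eqxx => /(_ isT) ->.
  case: eqP => [e|/eqP ne]; first by rewrite e cards1.
  case a12: (0 < #|supp a| <= 2) => //=; symmetry.
  case: (boolP (supp a \subset _)) => //= sa.
  have ia : i \in supp a.
    apply: contraR nsa => nia; apply/subsetP => x xa; have := subsetP sa x xa.
    by rewrite !inE; case: eqP => [ex|//]; rewrite -ex xa in nia.
  have : #|supp a :\ i| <= 1 by case/andP: a12 => _; rewrite (cardsD1 i) ia add1n ltnS.
  have [e|/set0Pn [j]] := eqVneq (supp a :\ i) set0.
    by move: ne; rewrite -(setD1K ia) e setU0 eqxx.
  move=> jin; rewrite (cardsD1 j) jin => c1.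
  have e : supp a :\ i = [set j].
    by apply/eqP; rewrite eq_sym eqEcard sub1set jin cards1 (cardsD1 j) jin.
  apply/hasP; exists j; last by rewrite -(setD1K ia) e.
  have := subsetP sa j; move: jin; rewrite !inE => /andP [/negbTE -> ->] /(_ isT).
  by [].
rewrite restE Wsum_split; last first.
  rewrite inst1_img // -setI_eq0; apply/eqP/setP => a; rewrite !inE.
  case: eqP => //= e; rewrite e; apply/negbTE; rewrite negb_and negb_or negbK; apply/orP; right.
  apply/andP; split; first by apply/subsetP => x; rewrite !inE => ->.
  apply/hasPn => x xls; apply/eqP => /(congr1 (fun s : {set 'I_n} => x \in s)); rewrite !inE eqxx orbT => /eqP e'.
  by move: inls; rewrite -e' xls.
rewrite Wsum_img; last exact: inst1_inj.
rewrite /gr /=; apply: eq_bigr => C _; congr (_ * _)%R; first by apply: eq_bigr => x _; rewrite wt1.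
under eq_Wsum => B' _ do rewrite setUA.
set B1 := B :|: _.
have c1 k : k != i -> cell B1 k = cell B k.
  move=> ki; apply/setP => x; rewrite !inE; case: (_ \in B) => //=; apply/negbTE/imsetP => -[y _ e].
  by have := supp_inst1 i y; rewrite -e supp_inst1 => /set1_inj e'; rewrite e' eqxx in ki.
have ci : cell B1 i = C.
  apply/setP => x; rewrite !inE (mem_imset _ _ (@inst1_inj i)).
  case: (boolP (_ \in B)) => // /sB; rewrite supp_inst1 => /subsetP /(_ i).
  by rewrite !inE eqxx (negbTE inls) => /(_ isT).
have p1 a b : a != b -> pty B1 a b = pty B a b.
  move=> ab; apply/setP => x; rewrite !inE; case: (_ \in B) => //=; apply/negbTE/imsetP => -[y _ e].
  have := supp_inst1 i y; rewrite -e supp_inst2 // => /(congr1 (fun s : {set 'I_n} => #|s|)).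
  by rewrite cards1 cards2 ab.
rewrite -[in RHS](@meet_map (size us)).
- rewrite /= cats0; congr meet.
    rewrite /i0 /st ci; congr (_, _); apply/ffunP => k; rewrite !ffunE /cnt ci; congr cap.
    by rewrite big1 ?addn0 // => x; rewrite inE => /andP [/eqP ->]; rewrite eqxx.
  apply/eq_in_map => k kls; have ki : k != i by apply: contraNneq inls => <-.
  apply: st_eq => [|//|x xls xk]; first by rewrite c1.
  by split; [rewrite c1 //; apply: contraNneq inls => <-|rewrite p1 // eq_sym].
- rewrite cats0 /= inls; move: un; by rewrite cat_uniq => /andP [].
- move=> ls' B' p; rewrite cats0 in p; apply: IH => [|x].
    rewrite -(perm_uniq (s1 := ls ++ i :: us)) //.
    by rewrite perm_sym -cat_rcons perm_cat2r (perm_trans p) // perm_sym perm_rcons.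
  have := lsall x; rewrite !mem_cat inE (perm_mem p) inE.
  by case: (x == i); rewrite ?orbT.
- move=> a; rewrite inE cats0 => /orP [/sB h|/imsetP [x _ ->]].
    by apply: subset_trans h _; apply/subsetP => x; rewrite !inE orbC => ->.
  by rewrite supp_inst1 sub1set !inE eqxx.
- move=> a j; rewrite inE => /orP [/sB h|/imsetP [x _ ->]] jls.
    by apply/eqP => e; move: h; rewrite e => /subsetP /(_ i); rewrite !inE eqxx (negbTE inls) => /(_ isT).
  rewrite supp_inst1; apply/eqP => /setP /(_ j); rewrite !inE eqxx orbT => /eqP e.
  by move: inls; rewrite -e jls.
Qed.

Theorem grow_Wsum : grow i0 d1 d2 b0 aS u1 u2 n [::] = Wsum wt A12 F.
Proof.
have := @grow_map (enum 'I_n) [::] set0; rewrite /= size_enum_ord.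
rewrite /gr => -> //.
- have -> : rest [::] = A12.
    apply/setP => a; rewrite !inE; case: (boolP (_ < _ <= _)) => //= /andP [c0 _].
    have s0 : sset [::] = set0 by apply/setP => x; rewrite !inE.
    by apply/negP => /subset_leq_card; rewrite s0 cards0 leqNgt c0.
  by apply: eq_Wsum => B _; rewrite set0U.
- exact: enum_uniq.
- by move=> i; rewrite mem_enum.
- by move=> a; rewrite inE.
Qed.
End Types.

(** * Two-variable formulas with counting *)

Lemma tag_ext (P : Type) (ar : P -> nat) (T : Type) (x y : {R : P & (ar R).-tuple T}) :
  tag x = tag y -> tval (tagged x) = tval (tagged y) -> x = y.
Proof.
case: x y => [R t] [R' t'] /= e; subst R' => /= e; congr (existT _ _ _); exact: val_inj.
Qed.

Lemma eq_nseq (T : eqType) m (s : seq T) x : size s = m -> (forall y, y \in s -> y = x) -> s = nseq m x.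
Proof. by move=> <- H; apply/all_pred1P/allP => y /H ->; apply/eqP. Qed.

Section Formulas.
Variables (P : finType) (ar : P -> nat).
Implicit Types (f g : c2form ar) (o k : nat).

Fixpoint nq f := match f with
  | FNeg g => nq g
  | FAnd g h => nq g + nq h
  | FEx _ g | FCnt _ _ g => (nq g).+1
  | _ => 0 end.

(* The quantifier occurrences in preorder: [None] for an existential, [Some k] for an "exactly k"
   quantifier, then the bound variable, the scope, and the number of the first occurrence in the scope. *)
Definition quant := (option nat * var * c2form ar * nat)%type.
Fixpoint qlist o f : seq quant := match f with
  | FNeg g => qlist o g
  | FAnd g h => qlist o g ++ qlist (o + nq g) h
  | FEx v g => (None, v, g, o.+1) :: qlist o.+1 g
  | FCnt k v g => (Some k, v, g, o.+1) :: qlist o.+1 g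
  | _ => [::] end.

Lemma size_qlist o f : size (qlist o f) = nq f.
Proof. by elim: f o => //= [f IH g IH' o|v f IH o|k v f IH o]; rewrite ?size_cat ?IH ?IH'. Qed.

Definition chk (kd : option nat) (c : nat) := if kd is Some k then c == k else 0 < c.

(* Evaluation outside the scopes of quantifiers: [qv z o] is the value of the occurrence [o]
   at the element assigned to its free variable [z]. *)
Fixpoint sev (av : forall R, (ar R).-tuple var -> bool) (eqv : bool) (qv : var -> nat -> bool) o f :=
  match f with
  | FAtom R t => av R t
  | FEq u v => (u == v) || eqv
  | FNeg g => ~~ sev av eqv qv o g
  | FAnd g h => sev av eqv qv o g && sev av eqv qv (o + nq g) h
  | FEx v _ | FCnt _ v _ => qv (~~ v) o
  end.

Lemma eq_sev av av' eqv qv qv' o f : (forall R t, av R t = av' R t) ->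
  (forall z k, qv z k = qv' z k) -> sev av eqv qv o f = sev av' eqv qv' o f.
Proof. by move=> e1 e2; elim: f o => //= [f IH|f IH g IH'] o; rewrite IH ?IH'. Qed.

Variable Gamma : c2form ar.
Definition dfl : quant := (None, vx, FEq ar vx vx, 0).
Definition QL := qlist 0 Gamma.
Definition ent k := nth dfl QL k.
Notation q := (nq Gamma).

(** Expresses that [f] sits in [Gamma] as a subformula whose quantifier occurrences are numbered
    from [o] on. *)
Definition occ o f := forall k, k < nq f -> (ent (o + k) = nth dfl (qlist o f) k) /\ (o + k < q).

Lemma occ_and1 o g h : occ o (FAnd g h) -> occ o g.
Proof.
move=> H k lt; have /= := H k; rewrite nth_cat size_qlist lt; apply.
exact: ltn_addr.
Qed.
Lemma occ_and2 o g h : occ o (FAnd g h) -> occ (o + nq g) h.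
Proof.
move=> H k lt; have /= := H (nq g + k); rewrite nth_cat size_qlist.
have -> : (nq g + k < nq g) = false by rewrite ltnNge leq_addr.
rewrite addKn addnA; apply.
by rewrite ltn_add2l.
Qed.
Lemma occ_ex o v g : occ o (FEx v g) -> occ o.+1 g.
Proof. by move=> H k lt; have /= := H k.+1; rewrite addnS addSn; apply. Qed.
Lemma occ_cnt o m v g : occ o (FCnt m v g) -> occ o.+1 g.
Proof. by move=> H k lt; have /= := H k.+1; rewrite addnS addSn; apply. Qed.
Lemma occ_Gamma : occ 0 Gamma. Proof. by move=> k lt; rewrite add0n. Qed.

Lemma occ_nth o f k : occ o f -> k < nq f ->
  occ (nth dfl (qlist o f) k).2 (nth dfl (qlist o f) k).1.2.
Proof.
elim: f o k => //= [f IH g IH'|v f IH|m v f IH] o k H.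
- move=> lt; rewrite nth_cat size_qlist; case: ltnP => le; first by apply: IH; first exact: occ_and1 H.
  by apply: IH'; [exact: occ_and2 H|rewrite ltn_subLR].
- case: k => [_|k lt] /=; first exact: occ_ex H.
  by apply: IH => //; exact: occ_ex H.
- case: k => [_|k lt] /=; first exact: occ_cnt H.
  by apply: IH => //; exact: occ_cnt H.
Qed.

Lemma occ_ent k : k < q -> occ (ent k).2 (ent k).1.2.
Proof. by move=> lt; apply: occ_nth; first exact: occ_Gamma. Qed.

Section Eval.
Variable n : nat.
(* The atoms [inr (a, k)] are the guesses: occurrence [k] holds when its free variable is [a]. *)
Definition atom : finType := (gatom ar n + 'I_n * 'I_q)%type.
Implicit Types (B : {set atom}) (e : var -> 'I_n).

Definition ga R (t : (ar R).-tuple 'I_n) : gatom ar n := Tagged (fun R => (ar R).-tuple 'I_n) t.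
Definition om_of B : world ar n := [set a | inl a \in B].
Definition gv B (i : 'I_n) k := if insub k is Some k' then inr (i, k') \in B else false.
Definition sevB B e o f := sev (fun R t => inl (ga (map_tuple e t)) \in B) (e false == e true)
  (fun z k => gv B (e z) k) o f.
Definition two (v : var) (b a : 'I_n) : var -> 'I_n := fun u => if u == v then b else a.
Definition truth (om : world ar n) k (a : 'I_n) :=
  chk (ent k).1.1.1 #|[pred b | sat om (Some \o two (ent k).1.1.2 b a) (ent k).1.2]|.
Definition true_guess B := forall a (k : 'I_q), (inr (a, k) \in B) = truth (om_of B) k a.
(** Each guess is compared only with the guesses for the outermost quantifiers inside its scope;
    this is the condition that counters of pairs can verify. *)
Definition self_guess B := forall a (k : 'I_q), (inr (a, k) \in B) =
  chk (ent k).1.1.1 #|[pred b | sevB B (two (ent k).1.1.2 b a) (ent k).2 (ent k).1.2]|.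

Lemma sat_atom (om : world ar n) e R t : sat om (Some \o e) (FAtom t) = (@ga R (map_tuple e t) \in om).
Proof.
rewrite /=; have -> : pmap id (map (Some \o e) t) = val (map_tuple e t).
  by rewrite /= map_comp map_pK.
by rewrite valK.
Qed.

Lemma updE e v b : upd (Some \o e) v (Some b) = Some \o two v b (e (~~ v)).
Proof.
by apply: functional_extensionality => u; rewrite /upd /two /=; case: u v => -[].
Qed.

Lemma gv_ord B i k (lt : k < q) : gv B i k = (inr (i, Ordinal lt) \in B).
Proof. by rewrite /gv insubT. Qed.

Lemma ent_root o f : occ o f -> match f with
  | FEx v g => ent o = (None, v, g, o.+1) /\ o < q
  | FCnt k v g => ent o = (Some k, v, g, o.+1) /\ o < q | _ => True end.
Proof. by case: f => // [v g|k v g] H; have := H 0 isT; rewrite addn0. Qed.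

Lemma FEq_sat om e (u v : var) : sat om (Some \o e) (FEq ar u v) = (u == v) || (e false == e true).
Proof. by rewrite /=; case: u v => -[]; rewrite ?eqxx //= eq_sym. Qed.

Lemma card_exists (p : pred 'I_n) : (0 < #|p|) = [exists b, p b].
Proof. by apply/card_gt0P/existsP. Qed.

(** Serves both directions of [guessP]: a correct guess is the value of the quantified subformula at
    once, a self-consistent one by the induction hypothesis for the scope. *)
Lemma sev_sat B : true_guess B \/ self_guess B -> forall f o, occ o f -> forall e,
  sevB B e o f = sat (om_of B) (Some \o e) f.
Proof.
move=> G; have gvE kd v f o a : ent o = (kd, v, f, o.+1) -> o < q ->
    (forall e, sevB B e o.+1 f = sat (om_of B) (Some \o e) f) ->
    gv B a o = chk kd #|[pred b | sat (om_of B) (Some \o two v b a) f]|.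
  move=> E lt H; rewrite gv_ord; case: G => ->; rewrite /truth /= E //=.
  by congr chk; apply: eq_card => b; rewrite !inE H.
elim=> [R t|u v|f IH|f IH g IH'|v f IH|m v f IH] o H e.
- by rewrite sat_atom inE.
- by rewrite FEq_sat.
- by rewrite /sevB /= -/(sevB B e o f) IH.
- rewrite /sevB /= -/(sevB B e o f) -/(sevB B e (o + nq f) g) (IH _ (occ_and1 H)).
  by rewrite (IH' _ (occ_and2 H)).
- have [E lt] := ent_root H; rewrite /sevB /= (gvE _ _ _ _ _ E lt (IH _ (occ_ex H))) /= card_exists.
  by apply: eq_existsb => b; rewrite updE.
- have [E lt] := ent_root H; rewrite /sevB /= (gvE _ _ _ _ _ E lt (IH _ (occ_cnt H))) /=.
  by congr (_ == m); apply: eq_card => b; rewrite !inE updE.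
Qed.

(* By induction on nesting, self-consistent guesses are correct. *)
Lemma guessP B : self_guess B <-> true_guess B.
Proof.
split=> H a k; rewrite H /truth; congr chk; apply: eq_card => b; rewrite !inE.
  by apply: sev_sat (occ_ent _) _ => //; right.
by symmetry; apply: sev_sat (occ_ent _) _ => //; left.
Qed.

Lemma sat_closed (om : world ar n) bnd f (env env' : var -> option 'I_n) :
  closed_under bnd f -> (forall u, bnd u -> env u = env' u) -> sat om env f = sat om env' f.
Proof.
elim: f bnd env env' => [R t|u v|f IH|f IH g IH'|v f IH|m v f IH] bnd env env' /=.
- move=> /allP H E; have -> : map env t = map env' t; last by [].
  by apply/eq_in_map => u /H /E.
- by move=> /andP [/[swap] /[swap] H1 H2] E; rewrite (E _ H1) (E _ H2).
- by move=> c E; rewrite (IH _ _ _ c E).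
- by move=> /andP [c1 c2] E; rewrite (IH _ _ _ c1 E) (IH' _ _ _ c2 E).
- move=> c E; apply: eq_existsb => b; apply: (IH _ _ _ c) => u; rewrite /upd.
  by case: eqP => //= _; apply: E.
- move=> c E; congr (_ == _); apply: eq_card => b; rewrite !inE; apply: (IH _ _ _ c) => u; rewrite /upd.
  by case: eqP => //= _; apply: E.
Qed.

(** Evaluation by types needs both variables assigned; for a sentence any assignment will do. *)
Lemma models_at (om : world ar n) e : sentence Gamma -> models om Gamma = sat om (Some \o e) Gamma.
Proof. by move=> s; apply: sat_closed s _. Qed.

(* Types of the atoms over no, one, two elements; in [U2], [false] and [true] stand for the two
   elements. *)
Definition U0 : finType := {R : P | ar R == 0}.
Definition U1 : finType := ({R : P | 0 < ar R} + 'I_q)%type.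
Definition mixed (x : {R : P & (ar R).-tuple bool}) := (true \in tagged x) && (false \in tagged x).
Definition U2 : finType := {x : {R : P & (ar R).-tuple bool} | mixed x}.

(** Looks up an atom of [R] whose arguments all denote one element of 1-type [c]; nullary atoms are
    found in [g]. *)
Definition inA (g : {set U0}) (c : {set U1}) (R : P) :=
  if insub R is Some R0 then R0 \in g else
  if insub R is Some R1 then inl R1 \in c else false.
Definition inQ (c : {set U1}) k := if insub k is Some k' then inr k' \in c else false.
Definition ev1 (g : {set U0}) (c : {set U1}) o f := sev (fun R t => inA g c R) true (fun z k => inQ c k) o f.
(** [v] denotes the element of type [c'], the other variable a different one of type [c], hence
    [false] for equality. An atom in which only one of the variables occurs is not [mixed] and is
    looked up in a 1-type. *)
Definition ev2 (g : {set U0}) (v : var) (c c' : {set U1}) (tau : {set U2}) o f :=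
  sev (fun R t => if insub (Tagged (fun R => (ar R).-tuple bool) (map_tuple (fun z => z == v) t)) is Some x
                  then x \in tau else inA g (if v \in t then c' else c) R)
      false (fun z k => inQ (if z == v then c' else c) k) o f.

Lemma nil_proof (R0 : U0) : size ([::] : seq 'I_n) == ar (val R0).
Proof. by rewrite (eqP (valP R0)). Qed.
Definition inst0 (R0 : U0) : atom := inl (ga (Tuple (nil_proof R0))).
Definition inst1 (i : 'I_n) (u : U1) : atom := match u with
  | inl R1 => inl (ga (nseq_tuple (ar (val R1)) i))
  | inr k => inr (i, k) end.
Definition inst2 (i j : 'I_n) (x : U2) : atom :=
  inl (ga (map_tuple (fun b : bool => if b then j else i) (tagged (val x)))).
Definition supp (a : atom) : {set 'I_n} := match a with
  | inl a => [set i in tagged a]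
  | inr (i, _) => [set i] end.

Lemma flip_proof (x : U2) : mixed (Tagged (fun R => (ar R).-tuple bool) (map_tuple negb (tagged (val x)))).
Proof.
case: x => -[R t] /= /andP [h1 h2]; apply/andP; split.
  by rewrite -[true]/(~~ false); apply: map_f.
by rewrite -[false]/(~~ true); apply: map_f.
Qed.
Definition flip (x : U2) : U2 := exist (fun y => mixed y) _ (flip_proof x).

Lemma ga_inj R (t t' : (ar R).-tuple 'I_n) : ga t = ga t' -> t = t'.
Proof. by move/eqP; rewrite eq_Tagged => /eqP. Qed.

Lemma flipE i j x : inst2 i j (flip x) = inst2 j i x.
Proof.
rewrite /inst2 /flip /=; congr (inl (ga _)); apply: val_inj; rewrite /= -map_comp.
by apply: eq_map => -[].
Qed.

Lemma inl_ext (x y : gatom ar n) : tag x = tag y -> tval (tagged x) = tval (tagged y) -> inl x = inl y :> atom.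
Proof. by move=> e1 e2; rewrite (tag_ext e1 e2). Qed.

Lemma inst0_inj : injective inst0.
Proof. by move=> R R' /(congr1 (fun a : atom => if a is inl b then tag b else val R)) /= /val_inj. Qed.

Lemma inst1_inj i : injective (inst1 i).
Proof.
move=> [R|k] [R'|k'] //=; last by case=> ->.
by move/(congr1 (fun a : atom => if a is inl b then tag b else val R)) => /= /val_inj ->.
Qed.

Lemma inst2_inj i j : i != j -> injective (inst2 i j).
Proof.
move=> ij x y e; apply: val_inj; apply: tag_ext.
  exact: (congr1 (fun a : atom => if a is inl b then tag b else tag (val x)) e).
have /= := congr1 (fun a : atom => if a is inl b then val (tagged b) else [::]) e; apply: inj_map.
by case=> -[] // eij; rewrite eij eqxx in ij.
Qed.

Lemma inst0_img : inst0 @: setT = [set a | supp a == set0].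
Proof.
apply/setP => a; rewrite inE; apply/imsetP/eqP => [[R0 _ ->]|].
  by apply/setP => i; rewrite !inE.
case: a => [[R t]|[i k]] /= e; last by have := set11 i; rewrite e inE.
have t0 : val t = [::].
  have : forall i, i \in tval t = false.
    by move=> i; have := congr1 (fun s : {set 'I_n} => i \in s) e; rewrite !inE.
  by rewrite /=; case: (tval t) => [|x s] // /(_ x); rewrite mem_head.
have R0 : ar R == 0 by rewrite -(size_tuple t) -[size t]/(size (val t)) t0.
by exists (exist (fun R => ar R == 0) R R0); [by rewrite inE|exact: inl_ext].
Qed.

Lemma inst1_img i : inst1 i @: setT = [set a | supp a == [set i]].
Proof.
apply/setP => a; rewrite inE; apply/imsetP/eqP => [[[[R h]|k] _ ->]|] //.
  by apply/setP => j; rewrite !inE /= mem_nseq h.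
case: a => [[R t]|[j k]] /= e; last by exists (inr k); rewrite ?inE // (set1_inj e).
have h : 0 < ar R.
  rewrite -(size_tuple t); have := set11 i; rewrite -e inE /= -index_mem.
  exact: leq_ltn_trans.
exists (inl (exist (fun R => 0 < ar R) R h)); [by rewrite inE|apply: inl_ext => //=].
apply: eq_nseq (size_tuple t) _ => x xt; apply/set1P; by rewrite -e inE.
Qed.

Lemma inst2_img i j : i != j -> inst2 i j @: setT = [set a | supp a == [set i; j]].
Proof.
move=> ij; apply/setP => a; rewrite inE; apply/imsetP/eqP => [[[[R t] /= h] _ ->]|].
  have /andP [h1 h2] := h; apply/setP => x; rewrite !inE /=; apply/mapP/orP => [[b _ ->]|].
    by case: b; rewrite eqxx; [right|left].
  by case=> /eqP ->; [exists false|exists true].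
case: a => [[R t]|[k k']] /= e; last first.
  by have := cards2 i j; rewrite -e cards1 ij.
have h : mixed (Tagged (fun R => (ar R).-tuple bool) (map_tuple (fun x => x == j) t)).
  have i_t : i \in t by have : i \in [set i; j] by [rewrite !inE eqxx]; rewrite -e inE.
  have j_t : j \in t by have : j \in [set i; j] by [rewrite !inE eqxx orbT]; rewrite -e inE.
  apply/andP; split; apply/mapP; first by exists j; rewrite ?eqxx.
  by exists i => //; apply/esym/negbTE.
exists (exist (fun y => mixed y) _ h); [by rewrite inE|apply: inl_ext => //=].
rewrite -map_comp -[LHS]map_id; apply/eq_in_map => x xt /=.
have : x \in [set i; j] by rewrite -e inE.
by case/set2P => ->; rewrite ?eqxx // (negbTE ij).
Qed.

Definition gset B : {set U0} := [set R0 | inst0 R0 \in B].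

Lemma inA_cell B a R (t : (ar R).-tuple 'I_n) : (forall x, x \in t -> x = a) ->
  inA (gset B) (cell inst1 B a) R = (inl (ga t) \in B).
Proof.
move=> H; rewrite /inA; case: insubP => [R0 _ eR|].
  rewrite inE; congr (_ \in B); rewrite /inst0; subst R; congr (inl (ga _)); apply: val_inj => /=.
  by symmetry; apply: size0nil; rewrite size_tuple; apply: (eqP (valP R0)).
rewrite -lt0n => R0; rewrite insubT inE; congr (_ \in B) => /=; congr (inl (ga _)); apply: val_inj => /=.
by symmetry; apply: eq_nseq (size_tuple t) H.
Qed.

Lemma inQ_cell B a k : inQ (cell inst1 B a) k = gv B a k.
Proof. by rewrite /inQ /gv; case: insubP => // k' _ _; rewrite inE. Qed.

Lemma ev1E B a o f : ev1 (gset B) (cell inst1 B a) o f = sevB B (fun _ => a) o f.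
Proof.
rewrite /sevB eqxx; apply: eq_sev => [R t|z k]; last exact: inQ_cell.
by apply: inA_cell => x /mapP [].
Qed.

Lemma ev2E B v a b o f : a != b ->
  ev2 (gset B) v (cell inst1 B a) (cell inst1 B b) (pty inst2 B a b) o f = sevB B (two v b a) o f.
Proof.
move=> ab; rewrite /sevB (_ : (_ == _) = false); last first.
  by rewrite /two; case: v => /=; rewrite ?(negbTE ab) // eq_sym (negbTE ab).
apply: eq_sev => [R t|z k]; last by rewrite /two; case: (z == v); rewrite inQ_cell.
case: insubP => [x _ ex|].
  rewrite inE; congr (_ \in B); rewrite /inst2 ex /=; congr (inl (ga _)); apply: val_inj => /=.
  by rewrite -map_comp.
rewrite /= negb_and => H.
have -> : (if v \in t then cell inst1 B b else cell inst1 B a) = cell inst1 B (if v \in t then b else a).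
  by case: ifP.
apply: inA_cell => x /mapP [z zt ->]; rewrite /two.
case: (boolP (v \in t)) => vt.
  case: eqP => // zv; case/orP: H => /mapP; case; first by exists v; rewrite ?eqxx.
  by exists z => //; case: eqP.
by case: eqP => // zv; move: vt; rewrite -zv zt.
Qed.

End Eval.
End Formulas.

(** * Acceptance means correct guesses and a model *)

Section Counting.
Variables (P : finType) (ar : P -> nat) (Gamma : c2form ar).
Notation q := (nq Gamma).
Notation U0 := (U0 ar).
Notation U1 := (U1 Gamma).
Notation U2 := (U2 ar).
Notation ent := (ent Gamma).

(* Larger than every [k] of a quantifier, so capping does not change the verdict of [chk]. *)
Definition Kb := (foldr maxn 0 [seq odflt 0 x.1.1.1 | x <- QL Gamma]).+1.
Definition self (g : {set U0}) (k : 'I_q) (c : {set U1}) := ev1 g c (ent k).2 (ent k).1.2.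
Definition contrib (g : {set U0}) (k : 'I_q) (c c' : {set U1}) (tau : {set U2}) :=
  ev2 g (ent k).1.1.2 c c' tau (ent k).2 (ent k).1.2.
(** Every guess must agree with its counter. The second condition evaluates the sentence with both
    variables at this element; once the guesses are right, all elements give the same answer. *)
Definition aS (g : {set U0}) (s : state q Kb U1) :=
  [forall k : 'I_q, (inr k \in s.1) == chk (ent k).1.1.1 (s.2 k)] && ev1 g s.1 0 Gamma.
Definition om0 (g : {set U0}) : world ar 0 := [set ga (Tuple (nil_proof 0 R0)) | R0 in g].
Definition b0 (g : {set U0}) := models (om0 g) Gamma.

Lemma kind_le (s : seq (quant ar)) k d : odflt 0 (nth d s k).1.1.1 <= maxn (odflt 0 d.1.1.1) (foldr maxn 0 [seq odflt 0 x.1.1.1 | x <- s]).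
Proof.
elim: s k => [|x s IH] [|k] /=; rewrite ?maxn0 //; first by lia.
by have := IH k; lia.
Qed.

Lemma chk_cap (k : 'I_q) c : chk (ent k).1.1.1 (cap Kb c) = chk (ent k).1.1.1 c.
Proof.
rewrite capE; have := kind_le (QL Gamma) k (dfl ar); rewrite -/(ent k) /= max0n.
rewrite -ltnS -/Kb; case: (ent k).1.1.1 => [m|] /= lt.
  by case: (leqP c Kb) => // l; apply/eqP/eqP; lia.
by rewrite /Kb; lia.
Qed.

Section Size.
Variable n : nat.
Notation atom := (atom Gamma n).
Notation I1 := (@inst1 _ _ Gamma n).
Notation I2 := (@inst2 _ _ Gamma n).
Notation sup := (@supp _ _ Gamma n).
Implicit Types B : {set atom}.
Notation acc g := (accF I1 I2 (self g) (contrib g) (b0 g) (aS g)).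

Lemma cntE B k a : cnt I1 I2 (self (gset B)) (contrib (gset B)) B (enum 'I_n) a k =
  #|[pred b | sevB B (two (ent k).1.1.2 b a) (ent k).2 (ent k).1.2]|.
Proof.
(* The witness [a] itself is counted by [self], all others by [contrib]. *)
rewrite -sum1_card big_mkcond (bigD1 a) //= /cnt; congr (_ + _).
  rewrite /self ev1E inE; have -> : two (ent k).1.1.2 a a = fun _ => a.
    by apply: functional_extensionality => u; rewrite /two; case: eqP.
  by case: sevB.
apply: eq_big => [b|b /andP [_ ba]]; first by rewrite mem_enum.
by rewrite /contrib ev2E 1?eq_sym // inE; case: sevB.
Qed.

Definition guess_ok B := [forall a : 'I_n, [forall k : 'I_q, (inr (a, k) \in B) == truth Gamma (om_of B) k a]].

Lemma guess_okP B : reflect (true_guess B) (guess_ok B).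
Proof.
apply: (iffP forallP) => [H a k|H a]; first by have /forallP /(_ k) /eqP := H a.
by apply/forallP => k; apply/eqP.
Qed.

Lemma acc_models0 B : n = 0 -> models (om_of B) Gamma = b0 (gset B) /\ guess_ok B.
Proof.
move=> n0; split; last by apply/forallP => a; have := ltn_ord a; rewrite {2}n0.
rewrite /b0; move: B; rewrite n0 => B; congr models; apply/setP => -[R t]; rewrite inE.
have t0 : val t = [::] by case: (val t) => // -[].
have R0 : ar R == 0 by rewrite -(size_tuple t) -[size t]/(size (val t)) t0.
apply/idP/imsetP => [tB|[R' R'g ->]]; last by move: R'g; rewrite inE.
have e : existT (fun i : P => (ar i).-tuple 'I_0) R t = ga (Tuple (nil_proof 0 (exist (fun R => ar R == 0) R R0 : U0))).
  by apply: tag_ext.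
by exists (exist (fun R => ar R == 0) R R0); rewrite // inE /inst0 -e.
Qed.

(** The counters at all elements together say [self_guess], which [guessP] turns into correctness;
    then the value of the sentence at one element is its truth. *)
Lemma acc_models B : sentence Gamma -> acc (gset B) B = models (om_of B) Gamma && guess_ok B.
Proof.
move=> sG; rewrite /accF; case: eqP => [/(acc_models0 B) [-> ->]|/eqP n0]; first by rewrite andbT.
have i0 : 'I_n by apply: (Ordinal (n := n) (m := 0)); rewrite lt0n.
have ckE B' i (k : 'I_q) : chk (ent k).1.1.1 (cap Kb (cnt I1 I2 (self (gset B')) (contrib (gset B')) B' (enum 'I_n) i k))
  = chk (ent k).1.1.1 #|[pred b | sevB B' (two (ent k).1.1.2 b i) (ent k).2 (ent k).1.2]|.
  by rewrite chk_cap cntE.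
apply/forallP/andP => [H|[mG /guess_okP tg] i].
  have sg : self_guess B.
    move=> a k; have /andP [/forallP /(_ k) /eqP + _] := H a.
    by rewrite /= inE ffunE ckE.
  have tg := proj1 (guessP B) sg; split; last by apply/guess_okP.
  have /andP [_] := H i0.
  by rewrite ev1E (sev_sat (or_introl tg) (@occ_Gamma _ _ Gamma)) (models_at _ (fun _ => i0) sG).
have sg := proj2 (guessP B) tg; apply/andP; split.
  by apply/forallP => k; rewrite /= inE ffunE ckE -sg.
by rewrite ev1E (sev_sat (or_introl tg) (@occ_Gamma _ _ Gamma)) -(models_at _ (fun _ => i) sG).
Qed.

Variables (w wb : P -> rat).
Definition wt R (b : bool) := if b then w R else wb R.
(** Guesses weigh 1 whether true or false, so a world keeps its weight when guesses are added. *)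
Definition w1 (u : U1) b : rat := match u with inl R1 => wt (val R1) b | inr _ => 1%R end.
Definition w2 (x : U2) b := wt (tag (val x)) b.
Definition wtA (a : atom) b : rat := match a with inl a => wt (tag a) b | inr _ => 1%R end.

Lemma card_tag R : #|[set a : gatom ar n | tag a == R]| = n ^ ar R.
Proof.
have -> : [set a : gatom ar n | tag a == R] = @ga _ ar n R @: setT.
  apply/setP => a; rewrite inE; apply/eqP/imsetP => [|[t _ ->] //].
  by case: a => R' t /= e; subst R'; exists t.
by rewrite card_imset ?cardsT ?card_tuple ?card_ord //; apply: ga_inj.
Qed.

Lemma prod_tag (om : world ar n) :
  (\prod_(R : P) (w R ^+ Ncount R om * wb R ^+ (n ^ ar R - Ncount R om)) =
   \prod_(a : gatom ar n) wt (tag a) (a \in om))%R.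
Proof.
rewrite (partition_big (fun a : gatom ar n => tag a) predT) //=; apply: eq_bigr => R _.
rewrite (bigID (fun a => a \in om)) /=; congr (_ * _)%R.
  rewrite -prodr_const; apply: eq_big => [a|a]; first by rewrite !inE andbC.
  by rewrite inE => /andP [-> /eqP ->].
have -> : n ^ ar R - Ncount R om = #|[set a : gatom ar n | tag a == R] :\: om|.
  rewrite -card_tag cardsD; congr (_ - _); rewrite /Ncount; apply: eq_card => a.
  by rewrite !inE andbC.
rewrite -prodr_const; apply: eq_big => [a|a]; first by rewrite !inE andbC.
by rewrite !inE => /andP [/negbTE -> /eqP ->].
Qed.

Lemma WFOMC_atoms : WFOMC Gamma w wb n =
  Wsum wtA setT (fun B => ((models (om_of B) Gamma && guess_ok B)%:R)%R).
Proof.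
have e : [set: atom] = inl @: setT :|: inr @: setT.
  by apply/setP => -[a|a]; rewrite !inE; apply/esym/orP; [left|right]; apply: imset_f; rewrite inE.
rewrite e Wsum_split; last first.
  by rewrite -setI_eq0; apply/eqP/setP => x; rewrite !inE; apply/negbTE/andP => -[/imsetP [a _ ->] /imsetP [b _]].
rewrite Wsum_img => [|a b [//]]; rewrite /WFOMC big_mkcond; apply: eq_bigr => om _.
rewrite Wsum_img => [|a b [//]].
(* The only set of guesses that is accepted together with [om]. *)
pose G : {set 'I_n * 'I_q} := [set x : 'I_n * 'I_q | truth Gamma om x.2 x.1].
have omE (C : {set 'I_n * 'I_q}) : om_of (inl @: om :|: inr @: C : {set atom}) = om.
  apply/setP => a; rewrite !inE (mem_imset _ _ (_ : injective inl)); last by move=> x y [].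
  by rewrite orbC; case: imsetP => [[x _]|].
rewrite (bigD1 G) //= [X in (_ + X)%R]big1 => [|C CG].
  rewrite addr0 omE (_ : guess_ok _) ?andbT; last first.
    apply/guess_okP => a k; rewrite omE !inE (mem_imset _ _ (_ : injective inr)) ?inE; last by move=> x y [].
    by case: imsetP => [[x _]|].
  rewrite [X in (_ * (X * _))%R]big1 // mul1r prod_tag; case: (models _ _); rewrite ?mulr1 ?mulr0 //.
rewrite [guess_ok _](_ : _ = false) ?andbF ?mulr0 //; apply: contraNF CG => /guess_okP tg.
apply/eqP/setP => -[a k]; have := tg a k; rewrite omE !inE (mem_imset _ _ (_ : injective inr)); last by move=> x y [].
by case: imsetP => [[x _]|_ /= ->].
Qed.

Definition A3 : {set atom} := [set a | 2 < #|supp a|].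

(** Atoms are separated by the number of their elements: those without elements are fixed first as
    [g], those over one or two are handled by [grow], and the others are not read by acceptance and
    come out as a factor by [Wsum_const]. *)
Theorem WFOMC_grow : sentence Gamma -> WFOMC Gamma w wb n =
  ((\prod_(a in A3) (wtA a true + wtA a false)) *
   \sum_(g : {set U0}) (\prod_(R0 : U0) wt (val R0) (R0 \in g)) *
     grow (i0 Kb (self g)) (d1 (contrib g)) (d2 (@flip _ ar) (contrib g)) (b0 g) (aS g)
       (fun C => \prod_u w1 u (u \in C)) (fun t => \prod_u w2 u (u \in t)) n [::])%R.
Proof.
move=> sG; rewrite WFOMC_atoms.
have e : [set: atom] = (@inst0 _ _ Gamma n @: setT :|: A12 sup) :|: A3.
  apply/setP => a; rewrite inst0_img !inE -cards_eq0; case: (#|supp a|) => [|[|[|m]]] //.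
rewrite e Wsum_split; last first.
  rewrite -setI_eq0; apply/eqP/setP => a; rewrite inst0_img !inE -cards_eq0.
  by case: (#|supp a|) => [|[|[|m]]].
rewrite Wsum_split; last first.
  rewrite -setI_eq0; apply/eqP/setP => a; rewrite inst0_img !inE -cards_eq0.
  by case: (#|supp a|) => [|[|[|m]]].
rewrite Wsum_img; last exact: inst0_inj.
rewrite mulr_sumr; apply: eq_bigr => g _; rewrite mulrCA; congr (_ * _)%R.
rewrite (@grow_Wsum n q Kb atom U1 U2 sup I1 I2 (@flip _ ar)
   _ (@inst1_img _ _ Gamma n) _ (@inst2_img _ _ Gamma n) (@flipE _ _ Gamma n) wtA w1 w2); first last.
- by [].
- by move=> i [R1|k].
- exact: inst2_inj.
- exact: inst1_inj.
transitivity (Wsum wtA (A12 sup) (fun B1 => \prod_(a in A3) (wtA a true + wtA a false) * (acc g B1)%:R))%R; last first.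
  by rewrite /Wsum mulr_sumr; apply: eq_bigr => B _; rewrite mulrCA.
apply: eq_Wsum => B1 sB1; rewrite -Wsum_const; apply: eq_Wsum => B2 sB2; congr (nat_of_bool _)%:R%R.
set B := _ :|: B1 :|: B2.
have B12 a : 0 < #|supp a| <= 2 -> (a \in B) = (a \in B1).
  move=> /andP [s0 s2]; rewrite /B !inE (_ : (a \in inst0 Gamma n @: _) = false) /=; last first.
    apply/negbTE/imsetP => -[R0 _ eR]; move: s0.
    have : a \in inst0 Gamma n @: setT by rewrite eR imset_f ?inE.
    by rewrite inst0_img inE => /eqP ->; rewrite cards0.
  rewrite (_ : (a \in B2) = false) ?orbF //; apply/negP => /(subsetP sB2).
  by rewrite inE ltnNge s2.
have i0B i u : (I1 i u \in B) = (I1 i u \in B1).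
  by rewrite B12 // (supp_inst1 (@inst1_img _ _ Gamma n)) cards1.
have i2B i j u : i != j -> (I2 i j u \in B) = (I2 i j u \in B1).
  by move=> ij; rewrite B12 // (supp_inst2 (@inst2_img _ _ Gamma n)) // cards2 ij.
have gB : gset B = g.
  apply/setP => R0; have c1 : supp (@inst0 _ _ Gamma n R0) = set0.
    have : inst0 Gamma n R0 \in @inst0 _ _ Gamma n @: setT by apply: imset_f; rewrite inE.
    by rewrite inst0_img inE => /eqP.
  rewrite /B !inE (mem_imset _ _ (@inst0_inj _ _ Gamma n)).
  rewrite (_ : (_ \in B1) = false) ?orbF; last first.
    by apply/negP => /(subsetP sB1); rewrite inE c1 cards0.
  rewrite (_ : (_ \in B2) = false) ?orbF //.
  by apply/negP => /(subsetP sB2); rewrite inE c1 cards0.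
rewrite -acc_models // gB /accF; case: eqP => // _; apply: eq_forallb => i; congr (aS g _).
have cE j : cell I1 B j = cell I1 B1 j.
  by apply/setP => u; rewrite [LHS]inE [RHS]inE i0B.
apply: st_eq => // j _ ji; split=> //.
by apply/setP => u; rewrite [LHS]inE [RHS]inE i2B // eq_sym.
Qed.
End Size.
End Counting.

(** * Input, output and the final bound *)

(** The input is reversed first since the encoded list is built from its end; each bit puts its own
    code and then the [true] of a list cell on [RX]. *)
Definition load :=
  Seq (pour RL RY) (Seq (Push RX false) (Seq (Push RC true) (While RC
    (Case RY (Seq (Seq (Push RX false) (Seq (Push RX false) (Push RX true))) (Seq (Push RX true) (Push RC true)))
             (Seq (Push RX false) (Seq (Push RX true) (Push RC true))) Skip)))).

Definition unload :=
  Seq (Seq (Push RC true) (While RC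
    (Case RX (Case RX (Seq (Seq (Case RX Skip Skip Skip) (Case RX Skip Skip Skip)) (Seq (Push RY true) (Push RC true)))
                      (Seq (Push RY false) (Push RC true)) Skip) Skip Skip))) (pour RY RL).

Lemma run_load (s : seq bool) : run load (start s) (20 * size s + 20) (stk [::] (code (enc s))).
Proof.
apply: (@run_le _ _ (5 * (size s).+1 + (1 + (1 + (7 * size s + 4))))); first lia.
apply: run_seq; first exact: (@run_pour RL RY (start s)).
apply: run_seq (run_push _ _ _) _; apply: run_seq (run_push _ _ _) _ => /=.
rewrite cats0; set body := Case _ _ _ _.
enough (H : forall w acc, run (While RC body) (Store [::] (code (enc (acc : seq bool))) w [::] [:: true])
    (7 * size w + 4) (stk [::] (code (enc (rev w ++ acc))))).
  by have := H (rev s) [::]; rewrite revK cats0 size_rev; apply.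
move=> {}s acc; elim: s acc => [|b s IH] acc.
  apply: (@run_le _ _ (2 + 1).+1) => //; apply: run_whileT; [reflexivity| |exact: run_whileN].
  by apply: run_caseN => //; exact: run_skip.
apply: (@run_le _ _ (6 + (7 * size s + 4)).+1); first by rewrite /=; lia.
apply: run_whileT; first reflexivity; last first.
  by rewrite rev_cons cat_rcons; exact: IH.
case: b => /=.
  apply: run_caseT; [reflexivity|] => /=.
  apply: (@run_seq _ _ _ 3 _ 2).
    apply: (@run_seq _ _ _ 1 _ 2); first exact: run_push.
    by apply: (@run_seq _ _ _ 1 _ 1); apply: run_push.
  by apply: (@run_seq _ _ _ 1 _ 1); apply: run_push.
apply: (@run_le _ _ 4) => //; apply: run_caseF; [reflexivity|] => /=.
apply: (@run_seq _ _ _ 1 _ 2); first exact: run_push.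
by apply: (@run_seq _ _ _ 1 _ 1); apply: run_push.
Qed.

Lemma run_unload (s : seq bool) : run unload (stk [::] (code (enc s))) (20 * size s + 20) (start s).
Proof.
apply: (@run_le _ _ ((1 + (9 * size s + 4)) + 5 * (size s).+1)); first lia.
apply: (@run_seq _ _ _ _ (Store [::] [::] (rev s) [::] [::])); last first.
  by have := @run_pour RY RL (Store [::] [::] (rev s) [::] [::]); rewrite /= revK cats0 size_rev; apply.
apply: run_seq (run_push _ _ _) _ => /=; set body := Case _ _ _ _.
enough (H : forall acc, run (While RC body) (Store [::] (code (enc s)) acc [::] [:: true])
    (9 * size s + 4) (Store [::] [::] (rev s ++ acc) [::] [::])) by by have := H [::]; rewrite cats0.
elim: s => [|b s IH] acc.
  apply: (@run_le _ _ (2 + 1).+1) => //; apply: run_whileT; [reflexivity| |exact: run_whileN].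
  by apply: run_caseF; [reflexivity|]; exact: run_skip.
apply: (@run_le _ _ (8 + (9 * size s + 4)).+1); first by rewrite /=; lia.
rewrite rev_cons cat_rcons; apply: run_whileT (IH _); first reflexivity.
case: b => /=.
  apply: run_caseT; [reflexivity|] => /=; apply: run_caseT; [reflexivity|] => /=.
  apply: (@run_seq _ _ _ 4 _ 2).
    by apply: (@run_seq _ _ _ 2 _ 2); (apply: run_caseF; [reflexivity|exact: run_skip]).
  by apply: (@run_seq _ _ _ 1 _ 1); apply: run_push.
apply: (@run_le _ _ 4) => //.
apply: run_caseT; [reflexivity|] => /=; apply: run_caseF; [reflexivity|] => /=.
by apply: (@run_seq _ _ _ 1 _ 1); apply: run_push.
Qed.

Theorem pt_tm (f : seq bool -> seq bool) : pt f -> exists (M : TM) (c : nat), forall inp, 0 < size inp ->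
  exists t, t <= (size inp).+1 ^ c /\ tm_computes M t inp (f inp).
Proof.
move=> pf; have [p [h [bh H]]] := pt_ex pf.
have [M HM] := exec_tm (Seq load (Seq p unload)); exists M.
have bT : pbd (fun s : seq bool => (100 * (sz s + ((20 * sz s + 20) + (h s + (20 * sz (f s) + 20)))).+1 ^ 2).+1) by pbds.
case: bT => c Hc; exists (c * 8) => inp i0.
have r : run (Seq load (Seq p unload)) (start inp) ((20 * size inp + 20) + (h inp + (20 * size (f inp) + 20))) (start (f inp)).
  apply: run_seq (run_load inp) _; apply: run_seq; last exact: run_unload.
  by have := H inp [::] [::]; rewrite !cats0.
have [t le e] := r; have [k lek kc] := HM _ _ _ e; exists k; split => //.
apply: leq_trans lek _; apply: leq_trans (_ : (sz inp + 2) ^ c <= _); last first.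
  rewrite mulnC expnM; case: (c) => // d; rewrite leq_exp2r //.
  (* The fourth power of [(size inp).+1] dominates [4 * size inp + 3] from length 1 on; for an empty
     input the base would be 1. *)
  apply: leq_trans (_ : 4 * size inp + 3 <= _); first by have := sz_boolseq inp; lia.
  apply: leq_trans (_ : (size inp).+1 ^ 4 <= _); last by rewrite leq_exp2l.
  rewrite !expnS expn0; move: i0; case: (size inp) => // m _; nia.
apply: leq_trans (Hc inp); rewrite ltnS leq_mul2l leq_exp2r //= ltnS.
have := @size_sz bool Enc_bool inp; have := @size_sz bool Enc_bool (f inp); lia.
Qed.

(** * Parsing the instance *)

Definition ustep (p : seq unit * seq bool) :=
  if p.2 is b :: s then (if b then (tt :: p.1, s) else p) else p.
Definition parse_un s := iter (size s) ustep ([::], s).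

Lemma parse_unE n s : parse_un (nseq n true ++ false :: s) = (nseq n tt, false :: s).
Proof.
have fix1 k u : iter k ustep (u, false :: s) = (u, false :: s) by elim: k => //= k ->.
rewrite /parse_un size_cat size_nseq /= addnC iterD.
have -> : forall u, iter n ustep (u, nseq n true ++ false :: s) = (nseq n tt ++ u, false :: s).
  elim: n => // n IH u; rewrite iterSr IH; congr (_, _).
  by rewrite -[tt :: u]/(nseq 1 tt ++ u) catA -nseqD addn1.
by rewrite cats0.
Qed.

Lemma pt_ustep : pt ustep.
Proof.
apply: (pt_case (l := fun p : seq unit * seq bool => p.2) (f := fun p => p)
  (g := fun p (b : bool) s => if b then (tt :: p.1, s) else p)); pts.
Qed.

Lemma pt_parse_un : pt parse_un.
Proof.
apply: (@pt_iter _ _ _ _ _ _ ustep (fun s : seq bool => s) (fun s => ([::], s)) (fun s => 2 * sz s + 2 + sz s)); try pts; try pbds.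
  exact: pt_ustep.
move=> s i le; have : forall p : seq unit * seq bool, sz (iter i ustep p) <= sz p + 2 * i.
  elim: i {le} => [|i IH] p; first by rewrite muln0 addn0.
  rewrite iterS /ustep; have := IH p; case: (iter i ustep p) => u [|[] s'] /=; rewrite ?sz_pair ?sz_cons ?sz_nil; try lia.
  by have -> : sz tt = 1 by []; lia.
move=> /(_ ([::], s)); rewrite sz_pair sz_nil; have := @size_sz bool Enc_bool s; lia.
Qed.

(** The flag records that the terminating pair has been passed; from then on the step idles, so the
    length of the input can serve as the number of rounds. *)
Definition nstep (p : bool * (seq bool * seq bool)) :=
  if p.1 then p else
  if p.2.2 is b :: s then
    if s is x :: s' then (if b then (false, (x :: p.2.1, s')) else (true, (p.2.1, s'))) else p
  else p.
Definition parse_nat s : nat * seq bool :=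
  let r := iter (size s) nstep (false, ([::], s)) in (unb (rev r.2.1), r.2.2).

Lemma parse_natE m s : parse_nat (enc_nat m ++ s) = (m, s).
Proof.
have fix1 k acc : iter k nstep (true, (acc, s)) = (true, (acc, s)) by elim: k => //= k ->.
have H l acc k : size l < k ->
  iter k nstep (false, (acc, flatten [seq [:: true; b] | b <- l] ++ [:: false; false] ++ s)) = (true, (rev l ++ acc, s)).
  elim: l acc k => [|b l IH] acc [|k] // lt; rewrite iterSr /=; first by rewrite /nstep /= fix1.
  by rewrite {2}/nstep /= IH // rev_cons cat_rcons.
rewrite /parse_nat /enc_nat -catA H /=; first by rewrite cats0 revK unb_bits.
rewrite !size_cat size_flatten /shape -map_comp /=.
by have -> : sumn [seq (size \o (fun b => [:: true; b])) b | b <- bits m] = 2 * size (bits m);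
  [elim: (bits m) => //= b l ->|]; lia.
Qed.

Lemma pt_nstep : pt nstep.
Proof.
rewrite /nstep; apply: pt_if; [pts|pts|].
apply: (pt_case (l := fun p : bool * (seq bool * seq bool) => p.2.2) (f := fun p => p)
  (g := fun p (b : bool) s => if s is x :: s' then (if b then (false, (x :: p.2.1, s')) else (true, (p.2.1, s'))) else p));
  [pts|pts|].
apply: (pt_case (l := fun q : bool * (seq bool * seq bool) * (bool * seq bool) => q.2.2) (f := fun q => q.1)
  (g := fun q (x : bool) s' => if q.2.1 then (false, (x :: q.1.2.1, s')) else (true, (q.1.2.1, s')))); pts.
Qed.

Lemma pt_parse_nat E {EE : Enc E} (f : E -> seq bool) : pt f -> pt (fun e => parse_nat (f e)).
Proof.
apply: (pt_comp (f := parse_nat)); rewrite /parse_nat.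
enough (pr : pt (fun s => iter (size s) nstep (false, ([::], s)))).
  by apply: (pt_comp (f := fun r : bool * (seq bool * seq bool) => (unb (rev r.2.1), r.2.2)) _ pr); pts.
apply: (@pt_iter _ _ _ _ _ _ nstep (fun s : seq bool => s) (fun s => (false, ([::], s))) (fun s => 10 * sz s + 20)); try pts; try pbds.
  exact: pt_nstep.
move=> s i le; have : forall p, sz (iter i nstep p).2 <= sz p.2.
  elim: i {le} => [|i IH] p //; apply: leq_trans (IH p); rewrite iterS /nstep.
  case: (iter i nstep p) => [[] [acc [|b [|x s']]]] //=; case: b => /=; rewrite !sz_pair !sz_cons; lia.
move=> /(_ (false, ([::], s))); case: (iter _ _ _) => b r /=; rewrite !sz_pair sz_nil.
by have := sz_bool b; lia.
Qed.

Import Order.TTheory.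

#[global] Hint Extern 0 (pt (fun _ => parse_nat _)) => simple eapply pt_parse_nat : pt.

(* Sign, absolute value of the numerator, denominator. *)
Notation ratd := (bool * (nat * nat))%type.
Definition rat_data (x : rat) : ratd := ((numq x < 0)%R, (`|numq x|%N, `|denq x|%N)).

Definition parse_rat s : ratd * seq bool :=
  ((head false s, ((parse_nat (behead s)).1, (parse_nat (parse_nat (behead s)).2).1)),
   (parse_nat (parse_nat (behead s)).2).2).

Lemma parse_ratE x s : parse_rat (enc_rat x ++ s) = (rat_data x, s).
Proof.
have -> : enc_rat x ++ s = (numq x < 0)%R :: (enc_nat `|numq x| ++ (enc_nat `|denq x| ++ s)).
  by rewrite /enc_rat /enc_int -catA cat_cons.
rewrite /parse_rat [head _ _]/= [behead _]/=; by rewrite !parse_natE.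
Qed.

Lemma pt_parse_rat E {EE : Enc E} (f : E -> seq bool) : pt f -> pt (fun e => parse_rat (f e)).
Proof. by move=> pf; rewrite /parse_rat; pts. Qed.
#[global] Hint Extern 0 (pt (fun _ => parse_rat _)) => simple eapply pt_parse_rat : pt.

Fixpoint parse_ws (I : Type) (l : seq I) s : seq (ratd * ratd) :=
  if l is _ :: l' then
    ((parse_rat s).1, (parse_rat (parse_rat s).2).1) :: parse_ws l' (parse_rat (parse_rat s).2).2
  else [::].

Lemma parse_wsE (I : Type) (w wb : I -> rat) l :
  parse_ws l (flatten [seq enc_rat (w R) ++ enc_rat (wb R) | R <- l]) = [seq (rat_data (w R), rat_data (wb R)) | R <- l].
Proof.
elim: l => // R l IH; rewrite [flatten _](esym (catA (enc_rat (w R)) (enc_rat (wb R)) _)).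
set s := flatten _ in IH *; rewrite [parse_ws _ _](_ : _ =
  ((parse_rat (enc_rat (w R) ++ (enc_rat (wb R) ++ s))).1,
   (parse_rat (parse_rat (enc_rat (w R) ++ (enc_rat (wb R) ++ s))).2).1) ::
   parse_ws l (parse_rat (parse_rat (enc_rat (w R) ++ (enc_rat (wb R) ++ s))).2).2) //.
by rewrite parse_ratE [(_, _).2]/= parse_ratE [(_, _).2]/= IH.
Qed.

Lemma pt_parse_ws (I : Type) (l : seq I) E {EE : Enc E} (f : E -> seq bool) : pt f -> pt (fun e => parse_ws l (f e)).
Proof.
elim: l f => [|R l IH] f pf; first exact: (pt_const ([::] : seq (ratd * ratd))).
apply: (pt_ext (f := fun e => ((parse_rat (f e)).1, (parse_rat (parse_rat (f e)).2).1) ::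
  parse_ws l (parse_rat (parse_rat (f e)).2).2)) => //.
by apply: pt_cons; [pts|apply: IH; pts].
Qed.

(** * Unary exponents and powers *)

Section Unary.
Context {E : Type} {EE : Enc E}.

(** Exponents are kept in unary because [zpow] iterates that often; they are polynomial in the
    domain size, the arities being fixed. *)
Definition upow (l : seq unit) k : seq unit := iter k (fun acc => flatten [seq l | _ <- acc]) [:: tt].
Lemma size_upow l k : size (upow l k) = size l ^ k.
Proof.
elim: k => //= k IH; rewrite expnSr -IH.
by elim: (upow l k) => //= _ s IHs; rewrite size_cat IHs mulSn.
Qed.
Lemma pt_upow (f : E -> seq unit) k : pt f -> pt (fun e => upow (f e) k).
Proof.
move=> pf; elim: k => [|k IH] /=; first by pts.
apply: pt_flatten; apply: (pt_map (f := fun e (_ : unit) => f e)) => //.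
by apply: (pt_comp (f := f)) => //; exact: pt_fst.
Qed.

(** Adds up the lengths [0, 1, ...] of a growing list, which gives a binomial coefficient. *)
Definition tri (l : seq unit) : seq unit :=
  (foldl (fun acc _ => (acc.1 ++ acc.2, tt :: acc.2)) ([::], [::]) l).1.
Lemma size_tri_aux (l : seq unit) : let r := foldl (fun acc (_ : unit) => (acc.1 ++ acc.2, tt :: acc.2)) ([::], [::]) l in
  size r.1 = 'C(size l, 2) /\ size r.2 = size l.
Proof.
elim/last_ind: l => [|l x [IH1 IH2]] //=; rewrite foldl_rcons /= size_cat IH1 IH2 size_rcons.
by rewrite binS bin1.
Qed.
Lemma size_tri l : size (tri l) = 'C(size l, 2). Proof. by case: (size_tri_aux l). Qed.
Lemma pt_tri (f : E -> seq unit) : pt f -> pt (fun e => tri (f e)).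
Proof.
move=> pf; apply: pt_fst1.
apply: (@pt_foldl _ _ _ _ _ _ (fun _ (acc : seq unit * seq unit) (_ : unit) => (acc.1 ++ acc.2, tt :: acc.2)) _ _
  (fun e => 2 * (sz (f e) * sz (f e)) + 2 * sz (f e) + 3)); try pts; try pbds.
move=> e i le; have [h1 h2] := size_tri_aux (take i (f e)).
move: h1 h2; case: (foldl _ _ _) => a b /= h1 h2; rewrite sz_pair !sz_sequnit h1 h2 bin2 size_takel //.
have := @size_sz unit Enc_unit (f e); move: le; rewrite -divn2.
have := leq_div (i * i.-1) 2; nia.
Qed.

Definition urep c (l : seq unit) : seq unit := iter c (cat l) [::].
Lemma size_rep c l : size (urep c l) = c * size l.
Proof. by elim: c => //= c IH; rewrite size_cat IH mulSn. Qed.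
Lemma pt_rep c (f : E -> seq unit) : pt f -> pt (fun e => urep c (f e)).
Proof. by move=> pf; elim: c => [|c IH] /=; [pts|apply: pt_cat]. Qed.

Definition zpow (z : zz) (k : seq unit) : zz := iter (size k) (zmul z) (1, 0).
Lemma zv_zpow z k : zv (zpow z k) = (zv z ^+ size k)%R.
Proof. by rewrite /zpow; elim: (size k) => [|m IH] /=; rewrite ?zv1 // zvM IH exprS. Qed.
Lemma zpow_nat d k : zpow (d, 0) k = (d ^ size k, 0).
Proof. by rewrite /zpow; elim: (size k) => //= m ->; rewrite /zmul /= !muln0 !mul0n !addn0 expnS. Qed.
Lemma pt_zpow (f : E -> zz) (g : E -> seq unit) : pt f -> pt g -> pt (fun e => zpow (f e) (g e)).
Proof.
move=> pf pg; apply: (@pt_iter_env _ _ _ _ _ _ (fun e => zmul (f e)) g (fun _ => (1, 0))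
  (fun e => 8 * (sz (f e) * sz (g e) + 1) + 3)); try pts; try pbds.
  by apply: pt_zmul; [apply: (pt_comp (f := f)) => //; exact: pt_fst|exact: pt_snd].
move=> e i le; apply: sz_zz_le; apply: (@leq_ltn_trans (2 ^ (sz (f e) * i))).
  elim: i {le} => [|i IH]; first by rewrite muln0.
  by rewrite iterS znM mulnS expnD leq_mul // ltnW // zn_lt_sz.
rewrite ltn_exp2l // addn1 ltnS leq_mul2l; apply/orP; right.
by apply: leq_trans le (size_sz _).
Qed.
End Unary.

Lemma zv_prod (I : Type) (f : I -> zz) (l : seq I) :
  zv (foldr zmul (1, 0) [seq f i | i <- l]) = (\prod_(i <- l) zv (f i))%R.
Proof. by elim: l => [|i l IH] /=; rewrite ?big_nil ?zv1 // big_cons zvM IH. Qed.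
Lemma zv_sum (I : Type) (f : I -> zz) (l : seq I) :
  zv (foldr zadd (0, 0) [seq f i | i <- l]) = (\sum_(i <- l) zv (f i))%R.
Proof. by elim: l => [|i l IH] /=; rewrite ?big_nil ?zv0 // big_cons zvD IH. Qed.

Lemma dvdn_foldr (l : seq nat) x : x \in l -> x %| foldr muln 1 l.
Proof.
elim: l => //= y l IH; rewrite inE => /orP [/eqP ->|/IH h]; first exact: dvdn_mulr.
exact: dvdn_mull.
Qed.

Lemma pt_enc_nat E {EE : Enc E} (f : E -> nat) : pt f -> pt (fun e => enc_nat (f e)).
Proof.
move=> pf; rewrite /enc_nat; apply: pt_cat; last by pts.
by apply: pt_flatten; apply: (pt_map (f := fun (_ : E) (b : bool) => [:: true; b])); pts.
Qed.
#[global] Hint Extern 0 (pt (fun _ => enc_nat _)) => simple eapply pt_enc_nat : pt.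

(** One of the two truncated differences is 0, so their sum is the absolute value. Dividing by the
    gcd yields the reduced fraction, on which [enc_rat] is defined. *)
Definition enc_frac (z : zz) (d : nat) : seq bool :=
  (z.1 < z.2) :: enc_nat ((z.1 - z.2 + (z.2 - z.1)) %/ gcdn (z.1 - z.2 + (z.2 - z.1)) d) ++
                 enc_nat (d %/ gcdn (z.1 - z.2 + (z.2 - z.1)) d).

Lemma enc_fracE z d : 0 < d -> enc_rat (zv z / d%:R)%R = enc_frac z d.
Proof.
case: z => p q d0; rewrite /zv /enc_frac /=; set a := p - q + (q - p); set g := gcdn a d.
have g0 : 0 < g by rewrite gcdn_gt0 d0 orbT.
pose n : int := ((-1) ^+ (p < q) * (a %/ g)%:Z)%R.
have ga : a %/ g * g = a by rewrite divnK // dvdn_gcdl.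
have gd : d %/ g * g = d by rewrite divnK // dvdn_gcdr.
have d'0 : 0 < d %/ g by rewrite divn_gt0 // dvdn_leq // dvdn_gcdr.
have e : ((p%:R - q%:R) / d%:R = n%:~R / (d %/ g)%:Z%:~R :> rat)%R.
  have g0' : (g%:R != 0 :> rat)%R by rewrite pnatr_eq0 -lt0n.
  have eN : (n%:~R * g%:R = p%:R - q%:R :> rat)%R.
    rewrite /n rmorphM /= rmorphXn /= rmorphN1 -mulrA.
    have -> : ((a %/ g)%:Z%:~R * g%:R = a%:R :> rat)%R by rewrite -natrM ga.
    rewrite /a; case: ltnP => lt.
      have -> : p - q = 0 by lia.
      by rewrite add0n expr1 natrB ?(ltnW lt) // mulN1r opprB.
    have -> : q - p = 0 by lia.
    by rewrite addn0 expr0 mul1r natrB.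
  have ed : (d%:R = (d %/ g)%:R * g%:R :> rat)%R by rewrite -natrM gd.
  by rewrite -eN {1}ed -mulf_div divff // mulr1.
have cop : coprime `|n| `|Posz (d %/ g)|.
  rewrite /n abszM abszX /= exp1n mul1n ?absz_nat /coprime.
  by rewrite -(eqn_pmul2r g0) muln_gcdl ga gd mul1n.
have nn : numq (n%:~R / (d %/ g)%:Z%:~R)%R = n.
  by rewrite coprimeq_num // gtr0_sg ?mul1r // ltz_nat.
have dd : `|denq (n%:~R / (d %/ g)%:Z%:~R)%R| = d %/ g.
  by rewrite coprimeq_den //; case: eqP => [e0|_]; [move: d'0; case: e0 => ->|rewrite absz_nat].
rewrite e /enc_rat nn dd /enc_int; have -> : `|n| = a %/ g.
  by rewrite /n abszM abszX /= exp1n mul1n ?absz_nat.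
congr (_ :: _); rewrite /n; case: ltnP => lt.
  rewrite expr1 mulN1r oppr_lt0 ltz_nat divn_gt0 // dvdn_leq ?dvdn_gcdl //; rewrite /a; lia.
by rewrite expr0 mul1r; apply/negbTE; rewrite -leNgt.
Qed.

Lemma pt_enc_frac E {EE : Enc E} (f : E -> zz) (g : E -> nat) : pt f -> pt g -> pt (fun e => enc_frac (f e) (g e)).
Proof. by move=> pf pg; rewrite /enc_frac; pts. Qed.

(** * Numbers of atoms by their distinct elements *)

Section Exponents.
Variables (P : finType) (ar : P -> nat) (Gamma : c2form ar) (n : nat).
Notation gatom := (gatom ar n).
Implicit Types (R : P).

(* [e3 R] is the number of atoms of [R] with at least three distinct elements. *)
Definition gsupp (a : gatom) : {set 'I_n} := supp (Gamma := Gamma) (inl a).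
Definition c2 R := #|[set x : U2 ar | tag (val x) == R]|.
Definition small R := if ar R == 0 then 1 else n.
Definition e3 R := n ^ ar R - (small R + c2 R * 'C(n, 2)).

Lemma card_supp1 R : #|[set a : gatom | (tag a == R) && (#|gsupp a| <= 1)]| = small R.
Proof.
rewrite /small; case: eqP => [R0|/eqP Rp].
  transitivity (n ^ ar R); last by rewrite R0.
  rewrite -(card_tag ar n R); apply: eq_card => a; rewrite !inE.
  case: eqP => //= e; case: a e => R' t /= e; subst R'.
  have -> : gsupp (Tagged (fun R => (ar R).-tuple 'I_n) t) = set0; last by rewrite cards0.
  apply/setP => i; rewrite !inE /=; apply/negbTE/negP => it.
  have := index_mem i t; rewrite it size_tuple => lt.
  by have := leq_trans lt (eq_leq R0).
rewrite -lt0n in Rp.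
have -> : [set a : gatom | (tag a == R) && (#|gsupp a| <= 1)] = (fun i => ga (nseq_tuple (ar R) i)) @: setT.
  apply/setP => a; rewrite inE; apply/andP/imsetP => [[/eqP e le]|[i _ ->]]; last first.
    split=> //; rewrite -(cards1 i); apply: subset_leq_card; apply/subsetP => x; rewrite !inE.
    by rewrite mem_nseq => /andP [].
  case: a e le => R' t /= e; subst R' => le.
  exists (tnth t (Ordinal Rp)) => //; apply: tag_ext => //=; apply: eq_nseq (size_tuple t) _ => y yt.
  by apply: (card_le1_eqP le); rewrite inE //=; apply: mem_tnth.
rewrite card_imset ?cardsT ?card_ord // => i j /(@ga_inj _ _ _ _ _) /(congr1 val) /=.
by case: (ar R) Rp => //= m _ [].
Qed.

(** Each two-element set supports as many atoms of [R] as there are mixed Boolean tuples, by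
    [inst2_img]. *)
Lemma card_supp2 R : #|[set a : gatom | (tag a == R) && (#|gsupp a| == 2)]| = c2 R * 'C(n, 2).
Proof.
rewrite -sum1_card (partition_big gsupp (fun D => #|D| == 2)) /=; last first.
  by move=> a; rewrite inE => /andP [].
rewrite (eq_bigr (fun _ => c2 R)) => [|D /cards2P [i [j [ij ->]]]].
  rewrite sum_nat_const mulnC; congr (_ * _).
  by rewrite -[in RHS](card_ord n) -card_draws; apply: eq_card => D; rewrite inE.
rewrite sum1dep_card /c2 -(card_imset _ (inst2_inj (Gamma := Gamma) ij)).
rewrite -(card_imset _ (_ : injective (inl : gatom -> atom Gamma n))); last by move=> x y [].
apply: eq_card => a; apply/imsetP/imsetP => [[b]|[u]].
  rewrite !inE => /andP [/andP [/eqP tb _] /eqP sb] ->.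
  have : inl b \in @inst2 _ _ Gamma n i j @: setT by rewrite inst2_img // inE /= -sb.
  by case/imsetP => u _ e; exists u => //; rewrite inE -tb; case: e => ->.
rewrite inE => /eqP tu ->; exists (ga (map_tuple (fun b : bool => if b then j else i) (tagged (val u)))) => //.
have : @inst2 _ _ Gamma n i j u \in @inst2 _ _ Gamma n i j @: setT by apply: imset_f; rewrite inE.
rewrite inst2_img // inE => /eqP su.
by rewrite !inE [gsupp _]su cards2 ij !eqxx !andbT; apply/eqP.
Qed.

Lemma card_supp3 R : #|[set a : gatom | (tag a == R) && (2 < #|gsupp a|)]| = e3 R.
Proof.
rewrite /e3 -(card_supp1 R) -(card_supp2 R) -(card_tag ar n R).
suff -> : #|[set a : gatom | tag a == R]| = #|[set a : gatom | (tag a == R) && (#|gsupp a| <= 1)]| +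
    #|[set a : gatom | (tag a == R) && (#|gsupp a| == 2)]| + #|[set a : gatom | (tag a == R) && (2 < #|gsupp a|)]|.
  by rewrite addKn.
rewrite -!sum1dep_card big_mkcond [X in _ = X + _ + _]big_mkcond [X in _ = _ + X + _]big_mkcond.
rewrite [X in _ = _ + _ + X]big_mkcond -!big_split; apply: eq_bigr => a _ /=.
by case: (tag a == R) => //=; case: (#|gsupp a|) => [|[|[|m]]].
Qed.

Variables (w wb : P -> rat).
Lemma prod_A3 : (\prod_(a in A3 Gamma n) (wtA w wb a true + wtA w wb a false) = \prod_(R : P) (w R + wb R) ^+ e3 R)%R.
Proof.
rewrite big_sumType /= [X in (_ * X)%R]big1 => [|[i k]]; last by rewrite inE /= cards1.
rewrite mulr1 (partition_big (fun a : gatom => tag a) predT) //=; apply: eq_bigr => R _.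
rewrite -(card_supp3 R) -prodr_const; apply: eq_big => [a|a /andP [_ /eqP <- //]].
by rewrite !inE andbC.
Qed.

End Exponents.

(** Every ground atom contributes exactly one factor, [w] or [wb], to the weight of a world; the
    count is thus homogeneous of degree the number of ground atoms. *)
Lemma WFOMC_scale (P : finType) (ar : P -> nat) (Gamma : c2form ar) (w wb : P -> rat) (D : rat) n :
  (WFOMC Gamma (fun R => w R * D) (fun R => wb R * D) n =
   D ^+ (\sum_(R : P) n ^ ar R)%N * WFOMC Gamma w wb n)%R.
Proof.
rewrite /WFOMC mulr_sumr; apply: eq_bigr => om _.
rewrite -prodrXr -big_split /=; apply: eq_bigr => R _.
have le : Ncount R om <= n ^ ar R.
  rewrite -(card_tag ar n R); apply: subset_leq_card; apply/subsetP => a.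
  by rewrite !inE => /andP [].
by rewrite !exprMn mulrACA -exprD subnKC // mulrC.
Qed.

(** * The algorithm and its correctness *)

Section Final.
Variables (P : finType) (ar : P -> nat) (Gamma : c2form ar).

Notation inst := (seq unit * seq (ratd * ratd))%type.
Implicit Types e : inst.
Definition dd : ratd * ratd := ((false, (0, 0)), (false, (0, 0))).
Definition wd (R : P) (b : bool) e : ratd :=
  if b then (nth dd e.2 (enum_rank R)).1 else (nth dd e.2 (enum_rank R)).2.
(* A common denominator: the recursion runs on the weights multiplied by it, and [WFOMC_scale]
   undoes the scaling. *)
Definition den e : nat := foldr muln 1 [seq (wd R true e).2.2 * (wd R false e).2.2 | R <- enum P].
Definition wz R b e : zz :=
  if (wd R b e).1 then (0, (wd R b e).2.1 * (den e %/ (wd R b e).2.2))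
  else ((wd R b e).2.1 * (den e %/ (wd R b e).2.2), 0).

Arguments wd : simpl never.
Arguments wz : simpl never.

Lemma pt_wd R b : pt (wd R b).
Proof. by rewrite /wd; case: b; pts. Qed.
Lemma pt_den : pt den.
Proof.
apply: (pt_const_big (op := muln) _ (f := fun R e => (wd R true e).2.2 * (wd R false e).2.2)); first by pts.
move=> R; have p1 := pt_wd R true; have p2 := pt_wd R false.
by apply: pt_muln; do 2 apply: pt_snd1.
Qed.
Lemma pt_wz R b : pt (wz R b).
Proof.
have p1 := pt_wd R b; have p2 := pt_den.
have p3 : pt (fun e : inst => (wd R b e).2.1 * (den e %/ (wd R b e).2.2)).
  by apply: pt_muln; [apply: pt_fst1; apply: pt_snd1|apply: pt_divn => //; do 2 apply: pt_snd1].
by apply: pt_if; [exact: pt_fst1|apply: pt_pair => //; pts|apply: pt_pair => //; pts].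
Qed.

Definition parse s : inst := ((parse_un s).1, parse_ws (enum P) (behead (parse_un s).2)).
Definition inst_of n (w wb : P -> rat) : inst := (nseq n tt, [seq (rat_data (w R), rat_data (wb R)) | R <- enum P]).

Lemma parseE n w wb : parse (enc_instance n w wb) = inst_of n w wb.
Proof. by rewrite /parse /enc_instance cat1s parse_unE /= parse_wsE. Qed.

Lemma pt_parse : pt parse.
Proof.
apply: pt_pair; first by apply: pt_fst1; exact: pt_parse_un.
by apply: pt_parse_ws; apply: pt_behead; apply: pt_snd1; exact: pt_parse_un.
Qed.

Section Weights.
Variables (n : nat) (w wb : P -> rat).
Let e := inst_of n w wb.

Lemma wdE R b : wd R b e = rat_data (wt w wb R b).
Proof.
rewrite /wd /e /inst_of (nth_map R) /= ?nth_enum_rank; first by case: b.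
by rewrite -cardE ltn_ord.
Qed.

Lemma den_gt0 : 0 < den e.
Proof.
rewrite /den; elim: (enum P) => //= R l IH; rewrite !wdE /= muln_gt0 IH andbT.
by rewrite muln_gt0 !absz_gt0 !denq_neq0.
Qed.

Lemma wzE R b : zv (wz R b e) = (wt w wb R b * (den e)%:R)%R.
Proof.
set x := wt w wb R b; rewrite /wz wdE -/x.
have dv : `|denq x| %| den e.
  apply: dvdn_trans (dvdn_foldr (x := (wd R true e).2.2 * (wd R false e).2.2) _); last first.
    by apply/mapP; exists R; rewrite ?mem_enum.
  by rewrite !wdE /x /=; case: b {x}; [apply: dvdn_mulr|apply: dvdn_mull].
have d0 : (`|denq x|%:R != 0 :> rat)%R by rewrite pnatr_eq0 absz_eq0 denq_neq0.
have dE : ((denq x)%:~R = `|denq x|%:R :> rat)%R by rewrite -[in LHS](absz_denq x).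
have aE : ((`|numq x| * (den e %/ `|denq x|))%:R = `|numq x|%:R / `|denq x|%:R * (den e)%:R :> rat)%R.
  by rewrite -{2}(divnK dv) !natrM; field.
rewrite -[x in RHS]divq_num_den dE; case: ifP => /= s; rewrite /zv /= aE.
  rewrite mulr0n sub0r -mulNr -mulNr; congr (_ / _ * _)%R.
  by rewrite -[numq x in RHS]opprK -(ltz0_abs s) mulrNz.
rewrite mulr0n subr0; congr (_ / _ * _)%R.
by have := gez0_abs (_ : 0 <= numq x)%R; rewrite leNgt s => /(_ isT) {2}<-.
Qed.
End Weights.

Section Run.
Variable g : {set U0 ar}.
Definition w1z (x : U1 Gamma) b e : zz := match x with inl R1 => wz (val R1) b e | inr _ => (1, 0) end.
Definition w2z (x : U2 ar) b e : zz := wz (tag (val x)) b e.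
Definition uz (C : {set U1 Gamma}) e : zz := foldr zmul (1, 0) [seq w1z x (x \in C) e | x <- enum (U1 Gamma)].
Definition vz (t : {set U2 ar}) e : zz := foldr zmul (1, 0) [seq w2z x (x \in t) e | x <- enum (U2 ar)].
Definition run_g := result (i0 (Kb Gamma) (self g)) (d1 (contrib g)) (d2 (@flip _ ar) (contrib g)) (b0 Gamma g) (aS g)
  uz vz (fun e : inst => e.1).

Lemma pt_uz C : pt (uz C).
Proof.
apply: (pt_const_big (op := zmul) _ (f := fun x e => w1z x (x \in C) e)); first by pts.
by case=> [R|k] /=; [apply: pt_wz|apply: pt_const].
Qed.
Lemma pt_vz t : pt (vz t).
Proof.
apply: (pt_const_big (op := zmul) _ (f := fun x e => w2z x (x \in t) e)); first by pts.
by move=> x; apply: pt_wz.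
Qed.
Lemma pt_run_g : pt run_g.
Proof.
apply: pt_result.
- exact: pt_uz.
- exact: pt_vz.
- exact: pt_fst.
Qed.
End Run.

Definition wg (g : {set U0 ar}) e : zz := foldr zmul (1, 0) [seq wz (val R0) (R0 \in g) e | R0 <- enum (U0 ar)].
Definition sum_g e : zz := foldr zadd (0, 0) [seq zmul (wg g e) (run_g g e) | g <- enum {set U0 ar}].
(** The exponent [e3] in unary: dropping a prefix is truncated subtraction of lengths. *)
Definition e3u R e : seq unit := drop
  (size ((if ar R == 0 then [:: tt] else e.1) ++ urep (c2 ar R) (tri e.1))) (upow e.1 (ar R)).
Definition prodA3 e : zz :=
  foldr zmul (1, 0) [seq zpow (zadd (wz R true e) (wz R false e)) (e3u R e) | R <- enum P].
Definition expo e : seq unit := foldr cat [::] [seq upow e.1 (ar R) | R <- enum P].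
Definition answer s : seq bool :=
  enc_frac (zmul (prodA3 (parse s)) (sum_g (parse s))) (zpow (den (parse s), 0) (expo (parse s))).1.

Lemma pt_answer : pt answer.
Proof.
have pe1 : pt (fun e : inst => e.1) by exact: pt_fst.
have pA : pt prodA3.
  apply: (pt_const_big (op := zmul) _ (f := fun R e => zpow (zadd (wz R true e) (wz R false e)) (e3u R e))); first by pts.
  move=> R; apply: pt_zpow; first by apply: pt_zadd; apply: pt_wz.
  apply: pt_drop; last exact: pt_upow.
  by apply: pt_cat; [case: (ar R == 0); pts|apply: pt_rep; apply: pt_tri].
have pS : pt sum_g.
  apply: (pt_const_big (op := zadd) _ (f := fun g e => zmul (wg g e) (run_g g e))); first by pts.
  move=> g; apply: pt_zmul; last exact: pt_run_g.
  apply: (pt_const_big (op := zmul) _ (f := fun (R0 : U0 ar) e => wz (val R0) (R0 \in g) e)); first by pts.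
  by move=> R0; apply: pt_wz.
have pE : pt expo.
  apply: (pt_const_big (op := cat) _ (f := fun R e => upow e.1 (ar R))); first by pts.
  by move=> R; apply: pt_upow.
have pD := pt_den.
apply: (pt_comp (f := fun e : inst => enc_frac (zmul (prodA3 e) (sum_g e)) (zpow (den e, 0) (expo e)).1)) pt_parse.
apply: pt_enc_frac; first exact: pt_zmul.
by apply: pt_fst1; apply: pt_zpow => //; apply: pt_pair => //; pts.
Qed.

Lemma answerE n (w wb : P -> rat) : sentence Gamma ->
  answer (enc_instance n w wb) = enc_rat (WFOMC Gamma w wb n).
Proof.
move=> sG; rewrite /answer parseE; set e := inst_of n w wb.
have d0 : 0 < den e by apply: den_gt0.
rewrite zpow_nat /= -enc_fracE; last by rewrite expn_gt0 d0.
congr enc_rat; rewrite zvM.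
(* The recursion has been run on these scaled weights; the power of [den] in the denominator of
   [answer] compensates for them. *)
pose w' R := (w R * (den e)%:R)%R; pose wb' R := (wb R * (den e)%:R)%R.
have wzE' R b : zv (wz R b e) = wt w' wb' R b by rewrite wzE; case: b.
have sze : size e.1 = n by rewrite size_nseq.
have -> : zv (prodA3 e) = (\prod_(a in A3 Gamma n) (wtA w' wb' a true + wtA w' wb' a false))%R.
  rewrite prod_A3 /prodA3 zv_prod big_enum; apply: eq_bigr => R _.
  rewrite zv_zpow zvD !wzE'; congr (_ ^+ _)%R.
  rewrite /e3u size_drop size_upow size_cat size_rep size_tri sze /e3 /small.
  by case: ifP; rewrite ?sze.
have -> : zv (sum_g e) = (\sum_(g : {set U0 ar}) (\prod_(R0 : U0 ar) wt w' wb' (val R0) (R0 \in g)) *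
     grow (i0 (Kb Gamma) (self g)) (d1 (contrib g)) (d2 (@flip _ ar) (contrib g)) (b0 Gamma g) (aS g)
       (fun C => \prod_u w1 w' wb' u (u \in C)) (fun t => \prod_u w2 w' wb' u (u \in t)) n [::])%R.
  rewrite /sum_g zv_sum big_enum; apply: eq_bigr => g _; rewrite zvM; congr (_ * _)%R.
    by rewrite /wg zv_prod big_enum; apply: eq_bigr => R0 _; rewrite wzE'.
  rewrite /run_g result_val ?sze; last first.
  - exact: d2_comm.
  - exact: d1_comm.
  congr grow; apply: functional_extensionality => C; rewrite zv_prod big_enum; apply: eq_bigr => x _.
    by case: x => [R1|k]; rewrite /= ?wzE' ?zv1.
  exact: wzE'.
rewrite -(WFOMC_grow n w' wb' sG) WFOMC_scale natrX.
have -> : size (expo e) = \sum_(R : P) n ^ ar R.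
  rewrite /expo -sze -big_enum /=; elim: (enum P) => [|R l IH]; first by rewrite big_nil.
  by rewrite big_cons /= size_cat IH size_upow.
by rewrite mulrC mulKf // expf_neq0 // pnatr_eq0 -lt0n.
Qed.
End Final.

Theorem theorem3 (P : finType) (ar : P -> nat) (Gamma : c2form ar) :
  sentence Gamma ->
  exists (M : TM) (c : nat),
    forall (n : nat) (w wb : P -> rat),
      exists t : nat,
        (t <= (size (enc_instance n w wb)).+1 ^ c)%N /\
        tm_computes M t (enc_instance n w wb) (enc_rat (WFOMC Gamma w wb n)).
Proof.
move=> sG; have [M [c H]] := pt_tm (pt_answer Gamma); exists M, c => n w wb.
(* The bit that ends the unary domain size makes every instance nonempty. *)
have [|t [le tc]] := H (enc_instance n w wb); first by rewrite !size_cat /=; lia.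
by exists t; split; rewrite // -(answerE n w wb sG).
Qed.
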